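(* Let $\Lambda$ be a basic Artin algebra such that $\mathcal{P}^{<\infty}(\Lambda\text{-mod})$ is contravariantly finite in $\Lambda\text{-mod}$. Let ${}_\Lambda T$ be the basic strong tilting module in $\Lambda\text{-mod}$ and $\widetilde{\Lambda}=\operatorname{End}_\Lambda(T)^{\mathrm{op}}$. If $\mathcal{P}^{<\infty}(\text{mod-}\widetilde{\Lambda})$ is contravariantly finite in $\text{mod-}\widetilde{\Lambda}$, then $\Lambda\text{-mod}$ allows for unlimited iteration of strong tilting. The resulting sequence of basic Artin algebras $\Lambda=\Lambda_0,\Lambda_1,\Lambda_2,\Lambda_3,\dots$ satisfies $\Lambda_i\cong\Lambda_j$ whenever $i$ and $j$ are positive integers with the same parity. Moreover, the categories of modules of finite projective dimension are linked by dualities $$\mathcal{P}^{<\infty}(\text{mod-}\Lambda_1)\leftrightarrow\mathcal{P}^{<\infty}(\Lambda_2\text{-mod})\leftrightarrow\mathcal{P}^{<\infty}(\text{mod-}\Lambda_3)\leftrightarrow\cdots$$ induced by the contravariant $\operatorname{Hom}$-functors $\operatorname{Hom}_{\Lambda_i}(-,T_i)$ and $\operatorname{Hom}_{\Lambda_{i+1}}(-,T_i)$ ($i\ge 1$) of the corresponding basic strong tilting bimodules ${}_{\Lambda_i}(T_i)_{\Lambda_{i+1}}$ ($i$ even), resp. ${}_{\Lambda_{i+1}}(T_i)_{\Lambda_i}$ ($i$ odd). In general, $\Lambda_0$ need not be isomorphic to $\Lambda_2$ (i.e., there exist basic Artin algebras $\Lambda$ such that $\mathcal{P}^{<\infty}(\Lambda\text{-mod})$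 is contravariantly finite in $\Lambda\text{-mod}$ and, with ${}_\Lambda T$ the basic strong tilting module in $\Lambda\text{-mod}$ and $\widetilde{\Lambda}=\operatorname{End}_\Lambda(T)^{\mathrm{op}}$, $\mathcal{P}^{<\infty}(\text{mod-}\widetilde{\Lambda})$ is contravariantly finite in $\text{mod-}\widetilde{\Lambda}$, but $\Lambda_0\not\cong\Lambda_2$).
   Context: For an Artin algebra $A$, $A\text{-mod}$ (resp. $\text{mod-}A$) is the category of finitely generated left (resp. right) $A$-modules, and $\mathcal{P}^{<\infty}(A\text{-mod})$ (resp. $\mathcal{P}^{<\infty}(\text{mod-}A)$) its full subcategory of modules of finite projective dimension. $A$ is basic if $A/J(A)$ is a product of division rings; a module is basic if it has no indecomposable direct summand of multiplicity $>1$. $\mathcal{P}^{<\infty}(A\text{-mod})$ is contravariantly finite in $A\text{-mod}$ if for each $M\in A\text{-mod}$ there is a map $\phi:X\to M$ with $X\in\mathcal{P}^{<\infty}(A\text{-mod})$ through which every homomorphism from an object of $\mathcal{P}^{<\infty}(A\text{-mod})$ to $M$ factors. Similarly for right modules. A module $T\in A\text{-mod}$ is a tilting module if (1) $T\in\mathcal{P}^{<\infty}(A\text{-mod})$, (2) $\operatorname{Ext}^i_A(T,T)=0$ for $i\ge1$, (3) there is an exact sequence $0\to A\to T_0\to\cdots\to T_m\to0$ with all $T_j\in\operatorname{add}(T)$. It is strong if, in addition, $\operatorname{Ext}^i_A(M,T)=0$ for all $M\in\mathcal{P}^{<\infty}(A\text{-mod})$ and $i\ge1$. Similarly for right modules.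 It is known (Auslander–Reiten) that a strong tilting module exists in $A\text{-mod}$ if and only if $\mathcal{P}^{<\infty}(A\text{-mod})$ is contravariantly finite, and that the basic strong tilting module is then unique up to isomorphism. If $T\in A\text{-mod}$ is tilting and $\widetilde A=\operatorname{End}_A(T)^{\mathrm{op}}$, then $T_{\widetilde A}$ is a tilting module with $\operatorname{End}_{\widetilde A}(T)\cong A$. For basic Artin algebras $A,B$: $\text{mod-}B$ results from $A\text{-mod}$ via strong tilting if $B\cong\operatorname{End}_A(T)^{\mathrm{op}}$, where $T$ is the basic strong tilting module in $A\text{-mod}$; $B\text{-mod}$ results from $\text{mod-}A$ via strong tilting if $B\cong\operatorname{End}_A(T)$, where $T$ is the basic strong tilting module in $\text{mod-}A$. The category $\Lambda\text{-mod}$ allows for unlimited iteration of strong tilting if there is an infinite sequence of basic algebras $(\Lambda_i)_{i\ge0}$ with $\Lambda_0=\Lambda$ such that $\text{mod-}\Lambda_{i+1}$ results from $\Lambda_i\text{-mod}$ via strong tilting for $i$ even, and $\Lambda_{i+1}\text{-mod}$ results from $\text{mod-}\Lambda_i$ via strong tilting for $i$ odd. In this case $T_i$ denotes the basic strong tilting module in $\Lambda_i\text{-mod}$ ($i$ even), resp. in $\text{mod-}\Lambda_i$ ($i$ odd). *)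

(* Defs.v *)
From HB Require Import structures.
From mathcomp Require Import all_boot all_algebra.
From mathcomp Require Import boolp.

Set Implicit Arguments.
Unset Strict Implicit.
Unset Printing Implicit Defensive.

Import GRing.Theory.
Local Open Scope ring_scope.

(* Modules over a ring R are left modules (lmodType R); a right module over R *)
(* is a left module over the converse ring R^c.  Zero rings are allowed.      *)

Definition surjective (X Y : Type) (f : X -> Y) := forall y, exists x, f x = y.

Section Modules.
Variable R : pzRingType.
Implicit Types M N X Y Z T P : lmodType R.

Definition is_zero M := forall x : M, x = 0.

Definition fin_gen M :=
  exists n (g : 'I_n -> M), forall x, exists c : 'I_n -> R,
    x = \sum_(i < n) c i *: g i.

Definition projective P :=
  forall M N (p : {linear M -> N}) (f : {linear P -> N}), surjective p ->
  exists h : {linear P -> M}, forall x, p (h x) = f x.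

Definition exact_at X Y Z (f : {linear X -> Y}) (g : {linear Y -> Z}) :=
  forall y, g y = 0 <-> exists x, f x = y.

Record resolution M := Resolution {
  res :> nat -> lmodType R;
  res_d : forall i, {linear res i.+1 -> res i};
  res_aug : {linear res 0%N -> M};
  res_fin_gen : forall i, fin_gen (res i);
  res_projective : forall i, projective (res i);
  res_aug_surj : surjective res_aug;
  res_exact0 : exact_at (res_d 0) res_aug;
  res_exact : forall i, exact_at (res_d i.+1) (res_d i)
}.

Definition proj_dim_le (n : nat) M :=
  exists Q : resolution M, forall i, (n < i)%N -> is_zero (Q i).

(* The objects of P^{<oo}(R-mod). *)
Definition fin_proj_dim M := fin_gen M /\ exists n, proj_dim_le n M.

(* Ext^(i+1)(M, N) = 0: the cohomology of Hom(Q, N) vanishes in degree i+1;   *)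
(* this does not depend on the projective resolution Q of M.                  *)
Definition Ext_succ_eq0 (i : nat) M N :=
  forall (Q : resolution M) (f : {linear Q i.+1 -> N}),
  (forall x, f (res_d Q i.+1 x) = 0) ->
  exists g : {linear Q i -> N}, forall x, f x = g (res_d Q i x).

Definition contravariantly_finite :=
  forall M, fin_gen M ->
  exists X (phi : {linear X -> M}), fin_proj_dim X /\
    forall Y (f : {linear Y -> M}), fin_proj_dim Y ->
    exists g : {linear Y -> X}, forall y, f y = phi (g y).

Definition direct_summand M N :=
  exists (i : {linear M -> N}) (p : {linear N -> M}), cancel i p.

Definition in_add T M := exists n : nat, direct_summand M {ffun 'I_n -> T}.

Definition add_coresolution T :=
  exists (m : nat) (C : nat -> lmodType R) (e : {linear R^o -> C 0%N})
         (d : forall i, {linear C i -> C i.+1}),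
  [/\ injective e, exact_at e (d 0%N), forall i, exact_at (d i) (d i.+1),
      forall i, in_add T (C i) & forall i, (m < i)%N -> is_zero (C i)].

Definition tilting T :=
  [/\ fin_proj_dim T, forall i, Ext_succ_eq0 i T T & add_coresolution T].

Definition strong_tilting T :=
  tilting T /\ forall M, fin_proj_dim M -> forall i, Ext_succ_eq0 i M T.

Definition indecomposable M :=
  ~ is_zero M /\
  forall X Y (f : {linear M -> (X * Y)%type}), bijective f ->
  is_zero X \/ is_zero Y.

(* By Krull-Schmidt, an indecomposable X has multiplicity > 1 in M iff X + X  *)
(* is a direct summand of M.                                                  *)
Definition basic_module M :=
  forall X, indecomposable X -> ~ direct_summand (X * X)%type M.

Definition basic_strong_tilting T := strong_tilting T /\ basic_module T.

End Modules.

Section Rings.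
Variable R : pzRingType.

Definition left_ideal (I : R -> Prop) :=
  [/\ I 0, forall x y, I x -> I y -> I (x + y) & forall a x, I x -> I (a * x)].

Definition maximal_left_ideal (I : R -> Prop) :=
  [/\ left_ideal I, ~ I 1 &
      forall J, left_ideal J -> (forall x, I x -> J x) -> ~ J 1 ->
      forall x, J x -> I x].

Definition jacobson (x : R) := forall I, maximal_left_ideal I -> I x.

Definition artinian :=
  forall I : nat -> R -> Prop, (forall n, left_ideal (I n)) ->
  (forall n x, I n.+1 x -> I n x) ->
  exists N, forall n, (N <= n)%N -> forall x, I N x -> I n x.

Definition division_ring :=
  (1 : R) <> 0 /\ forall x : R, x <> 0 -> exists y, y * x = 1 /\ x * y = 1.

End Rings.

(* R / J(R) is isomorphic to the product of the division rings D i: the       *)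
(* joint map R -> prod_i D i is onto, with kernel J(R).                       *)
Definition basic_ring (R : pzRingType) :=
  exists (n : nat) (D : 'I_n -> pzRingType)
         (p : forall i, {rmorphism R -> D i}),
  [/\ forall i, division_ring (D i),
      forall d : (forall i, D i), exists x, forall i, p i x = d i &
      forall x, jacobson x <-> forall i, p i x = 0].

Definition ring_iso (R S : pzRingType) :=
  exists f : {rmorphism R -> S}, bijective f.

Section Hom.
Variables (R : pzRingType) (X Y : lmodType R).

Lemma linear_ext (f g : {linear X -> Y}) : f =1 g -> f = g.
Proof.
case: f g => [f [[fD] [fZ]]] [g [[gD] [gZ]]] /= /funext efg.
by subst g; rewrite (Prop_irrelevance fD gD) (Prop_irrelevance fZ gZ).
Qed.

Definition Hom := {linear X -> Y}.

End Hom.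

HB.instance Definition _ R X Y := gen_eqMixin (@Hom R X Y).
HB.instance Definition _ R X Y := gen_choiceMixin (@Hom R X Y).

Section HomZmodule.
Variables (R : pzRingType) (X Y : lmodType R).
Implicit Types f g h : {linear X -> Y}.

Lemma opp_fun_linear f : linear (fun x => - f x).
Proof. by move=> a x y; rewrite linearP opprD scalerN. Qed.

Definition hom_zero : Hom X Y := (\0 : {linear X -> Y}).
Definition hom_add (f g : Hom X Y) : Hom X Y := (f \+ g : {linear X -> Y}).
Definition hom_opp (f : Hom X Y) : Hom X Y :=
  HB.pack_for {linear X -> Y} (fun x => - f x)
    (GRing.isLinear.Build _ _ _ _ _ (opp_fun_linear f)).

Fact hom_addA : associative hom_add.
Proof. by move=> f g h; apply: linear_ext => x /=; rewrite addrA. Qed.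
Fact hom_addC : commutative hom_add.
Proof. by move=> f g; apply: linear_ext => x /=; rewrite addrC. Qed.
Fact hom_add0 : left_id hom_zero hom_add.
Proof. by move=> f; apply: linear_ext => x /=; rewrite add0r. Qed.
Fact hom_addN : left_inverse hom_zero hom_opp hom_add.
Proof. by move=> f; apply: linear_ext => x /=; rewrite addNr. Qed.

HB.instance Definition _ := GRing.isZmodule.Build (Hom X Y)
  hom_addA hom_addC hom_add0 hom_addN.

End HomZmodule.

(* End_R(T), with composition of maps as product; it acts on T from the left. *)
Definition endo (R : pzRingType) (T : lmodType R) := Hom T T.

Section Endo.
Variables (R : pzRingType) (T : lmodType R).
Implicit Types f g h : {linear T -> T}.

HB.instance Definition _ := GRing.Zmodule.on (endo T).

Definition endo_one : endo T := (idfun : {linear T -> T}).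
Definition endo_mul (f g : endo T) : endo T := (f \o g : {linear T -> T}).

Fact endo_mulA : associative endo_mul.
Proof. by move=> f g h; apply: linear_ext. Qed.
Fact endo_mul1l : left_id endo_one endo_mul.
Proof. by move=> f; apply: linear_ext. Qed.
Fact endo_mul1r : right_id endo_one endo_mul.
Proof. by move=> f; apply: linear_ext. Qed.
Fact endo_mulDl : left_distributive endo_mul +%R.
Proof. by move=> f g h; apply: linear_ext. Qed.
Fact endo_mulDr : right_distributive endo_mul +%R.
Proof. by move=> f g h; apply: linear_ext => x /=; rewrite raddfD. Qed.

HB.instance Definition _ := GRing.Zmodule_isPzRing.Build (endo T)
  endo_mulA endo_mul1l endo_mul1r endo_mulDl endo_mulDr.

End Endo.

Section Bimodules.
Variables (R S : pzRingType) (T : lmodType R) (phi : {rmorphism S -> endo T}).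

(* T as an S-module, for the action of S on T given by phi. *)
Definition bimod (_ : {rmorphism S -> endo T}) : Type := T.

HB.instance Definition _ := GRing.Zmodule.on (bimod phi).

Definition bimod_scale (s : S) (t : bimod phi) : bimod phi := phi s t.

Fact bimod_scaleA a b v :
  bimod_scale a (bimod_scale b v) = bimod_scale (a * b) v.
Proof. by rewrite /bimod_scale rmorphM. Qed.
Fact bimod_scale1 : left_id 1 bimod_scale.
Proof. by move=> v; rewrite /bimod_scale rmorph1. Qed.
Fact bimod_scaleDr : right_distributive bimod_scale +%R.
Proof. by move=> a u v; rewrite /bimod_scale raddfD. Qed.
Fact bimod_scaleDl v : {morph bimod_scale^~ v : a b / a + b}.
Proof. by move=> a b; rewrite /bimod_scale rmorphD. Qed.

HB.instance Definition _ := GRing.Zmodule_isLmodule.Build S (bimod phi)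
  bimod_scaleA bimod_scale1 bimod_scaleDr bimod_scaleDl.

(* The action of R on T, by S-linear maps. *)
Lemma lact_linear (r : R) :
  linear ((fun t : T => r *: t) : bimod phi -> bimod phi).
Proof.
move=> s u v; rewrite [LHS]scalerDr; congr (_ + _).
by rewrite /GRing.scale /= /bimod_scale -[LHS]linearZ.
Qed.

Definition lact_fun (r : R) : endo (bimod phi) :=
  HB.pack_for {linear bimod phi -> bimod phi}
    ((fun t : T => r *: t) : bimod phi -> bimod phi)
    (GRing.isLinear.Build _ _ _ _ _ (lact_linear r)).

Fact lact_zmod : zmod_morphism lact_fun.
Proof. by move=> a b; apply: linear_ext => t /=; rewrite scalerBl. Qed.
Fact lact_monoid : monoid_morphism lact_fun.
Proof.
split=> [|a b]; apply: linear_ext => t /=; first by rewrite scale1r.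
by rewrite -scalerA.
Qed.

Definition lact : {rmorphism R -> endo (bimod phi)} :=
  HB.pack_for {rmorphism R -> endo (bimod phi)} lact_fun
    (GRing.isZmodMorphism.Build _ _ _ lact_zmod)
    (GRing.isMonoidMorphism.Build _ _ _ lact_monoid).

(* Hom_R(X, T) as an S-module: (s *: h) x = phi s (h x). *)
Definition hom_mod (_ : {rmorphism S -> endo T}) (X : lmodType R) : Type :=
  Hom X T.

Section HomMod.
Variable X : lmodType R.

HB.instance Definition _ := GRing.Zmodule.on (hom_mod phi X).

Definition hom_scale (s : S) (h : hom_mod phi X) : hom_mod phi X :=
  ((phi s : {linear T -> T}) \o (h : {linear X -> T}) : {linear X -> T}).

Fact hom_scaleA a b v : hom_scale a (hom_scale b v) = hom_scale (a * b) v.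
Proof. by apply: linear_ext => x /=; rewrite rmorphM. Qed.
Fact hom_scale1 : left_id 1 hom_scale.
Proof. by move=> v; apply: linear_ext => x /=; rewrite rmorph1. Qed.
Fact hom_scaleDr : right_distributive hom_scale +%R.
Proof. by move=> a u v; apply: linear_ext => x /=; rewrite raddfD. Qed.
Fact hom_scaleDl v : {morph hom_scale^~ v : a b / a + b}.
Proof. by move=> a b; apply: linear_ext => x /=; rewrite rmorphD. Qed.

HB.instance Definition _ := GRing.Zmodule_isLmodule.Build S (hom_mod phi X)
  hom_scaleA hom_scale1 hom_scaleDr hom_scaleDl.

End HomMod.

(* The functor Hom_R(-, T) on maps: h |-> h \o f. *)
Definition hom_map_fun (X X' : lmodType R) (f : {linear X -> X'})
    (h : hom_mod phi X') : hom_mod phi X :=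
  ((h : {linear X' -> T}) \o f : {linear X -> T}).

Fact hom_map_linear (X X' : lmodType R) (f : {linear X -> X'}) :
  linear (hom_map_fun f).
Proof. by move=> s g h; apply: linear_ext. Qed.

Definition hom_map (X X' : lmodType R) (f : {linear X -> X'}) :
    {linear hom_mod phi X' -> hom_mod phi X} :=
  HB.pack_for {linear hom_mod phi X' -> hom_mod phi X} (hom_map_fun f)
    (GRing.isLinear.Build _ _ _ _ _ (hom_map_linear f)).

End Bimodules.

(* Hom_R(-, T) and Hom_S(-, T) restrict to functors between the full          *)
(* subcategories P and Q which are quasi-inverse contravariant equivalences.  *)
Section Duality.
Variables (R S : pzRingType) (T : lmodType R) (phi : {rmorphism S -> endo T}).
Variables (P : lmodType R -> Prop) (Q : lmodType S -> Prop).

Let F (X : lmodType R) : lmodType S := hom_mod phi X.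
Let G (Y : lmodType S) : lmodType R := hom_mod (lact phi) Y.

Definition natural_iso_GF :=
  exists eta : forall X : lmodType R, P X -> {linear X -> G (F X)},
    (forall X (PX : P X), bijective (eta X PX)) /\
    forall X X' (PX : P X) (PX' : P X') (f : {linear X -> X'}) x,
      eta X' PX' (f x) = hom_map (lact phi) (hom_map phi f) (eta X PX x).

Definition natural_iso_FG :=
  exists eps : forall Y : lmodType S, Q Y -> {linear Y -> F (G Y)},
    (forall Y (QY : Q Y), bijective (eps Y QY)) /\
    forall Y Y' (QY : Q Y) (QY' : Q Y') (f : {linear Y -> Y'}) y,
      eps Y' QY' (f y) = hom_map phi (hom_map (lact phi) f) (eps Y QY y).

Definition hom_duality :=
  [/\ forall X, P X -> Q (F X), forall Y, Q Y -> P (G Y),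
      natural_iso_GF & natural_iso_FG].

End Duality.

(* A k-algebra is a ring A with a ring morphism from k to the center of A.    *)
Record kalg (k : comPzRingType) := KAlg {
  kalg_ring :> pzRingType;
  kalg_map : {rmorphism k -> kalg_ring};
  kalg_mapC : forall c a, kalg_map c * a = a * kalg_map c
}.
Arguments kalg_map {k} A : rename.

Section Algebras.
Variable k : comPzRingType.
Implicit Types A B : kalg k.

Definition alg_iso A B :=
  exists f : {rmorphism A -> B},
    bijective f /\ forall c, f (kalg_map A c) = kalg_map B c.

Definition artin_algebra A :=
  artinian k /\
  exists n (g : 'I_n -> A), forall a, exists c : 'I_n -> k,
    a = \sum_(i < n) kalg_map A (c i) * g i.

Section Opposite.
Variable A : kalg k.

Definition op_map (c : k) : A^c := kalg_map A c.

Fact op_map_zmod : zmod_morphism op_map.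
Proof. by move=> c d; rewrite /op_map rmorphB. Qed.
Fact op_map_monoid : monoid_morphism op_map.
Proof.
split=> [|c d]; first exact: (rmorph1 (kalg_map A)).
by rewrite /op_map rmorphM; exact: kalg_mapC.
Qed.

Definition op_rmorph : {rmorphism k -> A^c} :=
  HB.pack_for {rmorphism k -> A^c} op_map
    (GRing.isZmodMorphism.Build _ _ _ op_map_zmod)
    (GRing.isMonoidMorphism.Build _ _ _ op_map_monoid).

Fact op_mapC c (a : A^c) : op_rmorph c * a = a * op_rmorph c.
Proof. by symmetry; exact: (kalg_mapC c (a : A)). Qed.

Definition op_alg : kalg k := KAlg op_mapC.

End Opposite.

Section EndoAlgebra.
Variables (A : kalg k) (T : lmodType A).

Lemma endo_map_linear (c : k) : linear (fun t : T => kalg_map A c *: t).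
Proof. by move=> a u v; rewrite scalerDr !scalerA kalg_mapC. Qed.

Definition endo_map (c : k) : endo T :=
  HB.pack_for {linear T -> T} (fun t : T => kalg_map A c *: t)
    (GRing.isLinear.Build _ _ _ _ _ (endo_map_linear c)).

Fact endo_map_zmod : zmod_morphism endo_map.
Proof. by move=> c d; apply: linear_ext => t /=; rewrite rmorphB scalerBl. Qed.
Fact endo_map_monoid : monoid_morphism endo_map.
Proof.
split=> [|c d]; apply: linear_ext => t /=; first by rewrite rmorph1 scale1r.
by rewrite rmorphM -scalerA.
Qed.

Definition endo_rmorph : {rmorphism k -> endo T} :=
  HB.pack_for {rmorphism k -> endo T} endo_map
    (GRing.isZmodMorphism.Build _ _ _ endo_map_zmod)
    (GRing.isMonoidMorphism.Build _ _ _ endo_map_monoid).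

Fact endo_mapC c (f : endo T) : endo_rmorph c * f = f * endo_rmorph c.
Proof.
by apply: linear_ext => t; rewrite /= -[RHS]/((f : {linear T -> T}) _) linearZ.
Qed.

Definition endo_alg : kalg k := KAlg endo_mapC.

End EndoAlgebra.

(* A-mod is the category of (side false A)-modules, mod-A that of             *)
(* (side true A)-modules.                                                     *)
Definition side (right : bool) A : kalg k := if right then op_alg A else A.

End Algebras.

Section StrongTilting.
Variable k : comPzRingType.
Implicit Types A B E : kalg k.

Section Converse.
Variables (B E : kalg k) (f : {rmorphism B -> op_alg E}).

Definition conv_fun (b : op_alg B) : E := f b.

Fact conv_fun_zmod : zmod_morphism conv_fun.
Proof. by move=> a b; exact: (rmorphB f). Qed.
Fact conv_fun_monoid : monoid_morphism conv_fun.
Proof.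
split=> [|a b]; first exact: (rmorph1 f).
exact: (rmorphM f (b : B) (a : B)).
Qed.

Definition conv_rmorph : {rmorphism op_alg B -> E} :=
  HB.pack_for {rmorphism op_alg B -> E} conv_fun
    (GRing.isZmodMorphism.Build _ _ _ conv_fun_zmod)
    (GRing.isMonoidMorphism.Build _ _ _ conv_fun_monoid).

End Converse.

Definition side_rmorph (right : bool) B E :
    {rmorphism B -> side right E} -> {rmorphism side right B -> E} :=
  if right is true then @conv_rmorph B E else id.

(* right = false: mod-B results from A-mod via strong tilting, by means of    *)
(*                B ~ End_A(T)^op, T the basic strong tilting left A-module;  *)
(* right = true:  B-mod results from mod-A via strong tilting, by means of    *)
(*                B ~ End_A(T), T the basic strong tilting right A-module.    *)
Record strong_tilting_step (right : bool) A B := StrongTiltingStep {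
  step_mod : lmodType (side right A);
  step_modP : basic_strong_tilting step_mod;
  step_iso : {rmorphism B -> side (~~ right) (endo_alg step_mod)};
  step_iso_bij : bijective step_iso;
  step_iso_map : forall c,
    step_iso (kalg_map B c) = kalg_map (side (~~ right) (endo_alg step_mod)) c
}.

(* T as a right, resp. left, B-module. *)
Definition step_action right A B (s : strong_tilting_step right A B) :
    {rmorphism side (~~ right) B -> endo_alg (step_mod s)} :=
  side_rmorph (step_iso s).

Record strong_tilting_sequence := StrongTiltingSequence {
  seq_alg :> nat -> kalg k;
  seq_artin : forall i, artin_algebra (seq_alg i);
  seq_basic : forall i, basic_ring (seq_alg i);
  seq_step : forall i, strong_tilting_step (odd i) (seq_alg i) (seq_alg i.+1)
}.

Definition unlimited_strong_tilting A :=
  exists L : strong_tilting_sequence, L 0%N = A.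

End StrongTilting.

(* Main.v *)
(* Let T be a tilting R-module and S = End(T).  Then T is strong if and only if every
   embedding of T in a finite power of T splits.  For necessity, the cokernel of such an
   embedding has finite projective dimension.  For sufficiency, let 0 -> FK -> FP come from
   a projective presentation P -> X with kernel K, where F = Hom(-, T); by induction on the
   projective dimension F is a duality on K and P, so every map from the cokernel of
   FP -> FK to T is evaluation at an element of K that vanishes in P, hence zero.

   If T_0 is strong over R_0 and T_1 is strong over R_1 = End(T_0), then T_0 has finite
   projective dimension over R_1 and is therefore cogenerated by T_1; this makes T_1 strong
   over R_2 = End(T_1) as well.  Hence from T_1 on, the bimodules are strong on both sides,
   the Hom functors are dualities on all modules of finite projective dimension, and
   uniqueness of the basic strong tilting module gives period two.

   Existence of strong tilting modules (Auslander-Reiten): minimal approximations have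
   kernels in the Ext-orthogonal Y (Wakamatsu); the approximations of the finitely many
   simple modules bound the finitistic dimension; pulling back an approximation of I/M,
   where I is an injective envelope of M, embeds M in an object of Y of finite projective
   dimension with cokernel of finite projective dimension, and iterating from M = R
   terminates.

   In the example, modules of finite projective dimension are projective on one side, and
   the regular module R is strong there.  If the third algebra were isomorphic to R, then
   T_1 would be torsionless over it; but e and a do not generate the unit left ideal, so by
   the splitting criterion they kill a nonzero element of T_1, whereas no nonzero element
   of R is killed by both from the left. *)

From HB Require Import structures.
Require Import Defs.
From mathcomp Require Import all_boot all_algebra ring.
From mathcomp Require Import boolp.
From mathcomp Require classical_sets.

Set Implicit Arguments.
Unset Strict Implicit.
Unset Printing Implicit Defensive.

Import GRing.Theory.
Local Open Scope ring_scope.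

(** * Submodules and quotients *)

(** The splitting criterion makes the iteration possible because it speaks only of elements of one
    ring and of their common annihilators in a module. It can therefore be compared for two modules
    over the same ring: T_0 and T_1 are both R_1-modules, and R_1 is the endomorphism ring of T_0
    over R_0 and of T_1 over R_2. Strongness itself quantifies over modules over different rings and
    cannot be transferred directly. Homological algebra is reduced to vanishing statements: Ext^1 is
    a property of extension of maps, and higher Ext is a recursion over all presentations. This
    needs syzygies to stay finitely generated, while Krull-Schmidt, envelopes and minimal
    approximations need finite length. Both come from the base ring k: length is measured after
    restriction of scalars to k, so that an algebra, its opposite and its endomorphism algebras are
    treated alike. As k is only given as artinian, its finite length has to be proved. *)

Definition mklin (R : pzRingType) (X Y : lmodType R) (f : X -> Y)
    (Hf : linear f) : {linear X -> Y} :=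
  HB.pack_for {linear X -> Y} f (GRing.isLinear.Build _ _ _ _ _ Hf).

Section Submodules.
Variable R : pzRingType.
Implicit Types M X Y : lmodType R.

Definition submod M (N : M -> Prop) :=
  N 0 /\ forall a x y, N x -> N y -> N (a *: x + y).

Lemma submodD M (N : M -> Prop) x y : submod N -> N x -> N y -> N (x + y).
Proof. by case=> _ NP Nx Ny; have := NP 1 _ _ Nx Ny; rewrite scale1r. Qed.

Lemma submodZ M (N : M -> Prop) a x : submod N -> N x -> N (a *: x).
Proof. by case=> N0 NP Nx; have := NP a _ _ Nx N0; rewrite addr0. Qed.

Lemma submodN M (N : M -> Prop) x : submod N -> N x -> N (- x).
Proof. by move=> HN /(submodZ (-1) HN); rewrite scaleN1r. Qed.

Lemma submodB M (N : M -> Prop) x y : submod N -> N x -> N y -> N (x - y).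
Proof. by move=> HN Nx Ny; apply: submodD => //; apply: submodN. Qed.

Lemma submod_sum M (N : M -> Prop) I (r : seq I) (P : pred I) (F : I -> M) :
  submod N -> (forall i, P i -> N (F i)) -> N (\sum_(i <- r | P i) F i).
Proof.
by move=> HN NF; apply: big_ind => // [|x y]; [case: HN | exact: submodD].
Qed.

Lemma submod_ker X Y (f : {linear X -> Y}) : submod (fun x => f x = 0).
Proof.
split=> [|a x y fx fy]; first by rewrite linear0.
by rewrite linearP fx fy scaler0 addr0.
Qed.

Lemma submod_im X Y (f : {linear X -> Y}) : submod (fun y => exists x, f x = y).
Proof.
split=> [|a _ _ [x <-] [y <-]]; first by exists 0; rewrite linear0.
by exists (a *: x + y); rewrite linearP.
Qed.

(** The difference of two values over one point is a value over 0, so single-valuedness needs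
    checking only there. This is the tool for maps defined by choosing preimages in a diagram. *)
Lemma linear_of_rel X Y (P : X -> Y -> Prop) :
  (forall x, exists y, P x y) ->
  (forall a x x' y y', P x y -> P x' y' -> P (a *: x + x') (a *: y + y')) ->
  (forall y, P 0 y -> y = 0) ->
  exists f : {linear X -> Y}, forall x, P x (f x).
Proof.
move=> /choice[f fP] PP P0.
have uniq x y y' : P x y -> P x y' -> y = y'.
  move=> Pxy Pxy'; have := PP (-1) _ _ _ _ Pxy' Pxy.
  rewrite !scaleN1r addNr => /P0 /eqP.
  by rewrite addrC subr_eq0 => /eqP.
have flin : linear f by move=> a x y; apply: (uniq _ _ _ (fP _)); apply: PP.
by exists (mklin flin).
Qed.

Section SubType.
Variables (M : lmodType R) (N : M -> Prop) (HN : submod N).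

Definition subty of submod N : Type := {x : M | N x}.
Notation K := (subty HN).
HB.instance Definition _ := gen_eqMixin K.
HB.instance Definition _ := gen_choiceMixin K.

Let mk x (Nx : N x) : K := exist _ x Nx.
Let inc (x : K) : M := sval x.

Lemma sub_inj : injective inc.
Proof.
move=> [x Nx] [y Ny] /= exy; rewrite /inc /= in exy; subst y.
by rewrite (Prop_irrelevance Nx Ny).
Qed.

Let zero := mk (proj1 HN).
Let opp (x : K) := mk (submodN HN (svalP x)).
Let add (x y : K) := mk (submodD HN (svalP x) (svalP y)).
Let scal a (x : K) := mk (submodZ a HN (svalP x)).

Fact sub_addA : associative add.
Proof. by move=> x y z; apply: sub_inj; exact: addrA. Qed.
Fact sub_addC : commutative add.
Proof. by move=> x y; apply: sub_inj; exact: addrC. Qed.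
Fact sub_add0 : left_id zero add.
Proof. by move=> x; apply: sub_inj; exact: add0r. Qed.
Fact sub_addN : left_inverse zero opp add.
Proof. by move=> x; apply: sub_inj; exact: addNr. Qed.
HB.instance Definition _ :=
  GRing.isZmodule.Build K sub_addA sub_addC sub_add0 sub_addN.

Fact sub_scaleA a b v : scal a (scal b v) = scal (a * b) v.
Proof. by apply: sub_inj; exact: scalerA. Qed.
Fact sub_scale1 : left_id 1 scal.
Proof. by move=> x; apply: sub_inj; exact: scale1r. Qed.
Fact sub_scaleDr : right_distributive scal +%R.
Proof. by move=> a x y; apply: sub_inj; exact: scalerDr. Qed.
Fact sub_scaleDl v : {morph scal^~ v : a b / a + b}.
Proof. by move=> a b; apply: sub_inj; exact: scalerDl. Qed.
HB.instance Definition _ := GRing.Zmodule_isLmodule.Build R K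
  sub_scaleA sub_scale1 sub_scaleDr sub_scaleDl.

Fact inc_linear : linear inc. Proof. by []. Qed.

Lemma sub_exists : exists (S : lmodType R) (i : {linear S -> M}),
  injective i /\ forall x, N x <-> exists y, i y = x.
Proof.
exists (K : lmodType R), (mklin inc_linear); split; first exact: sub_inj.
by move=> x; split=> [Nx|[[y Ny] <-]] //; exists (exist _ x Nx).
Qed.

End SubType.

Section Quotient.
Variables (M : lmodType R) (N : M -> Prop) (HN : submod N).

(** The representative is chosen as a function of the coset, seen as a predicate; extensionality
    makes the predicates of congruent elements equal. *)
Lemma coset_repr_exists : exists c : M -> M,
  (forall x, N (x - c x)) /\ forall x y, N (x - y) -> c x = c y.
Proof.
have [c cP] : exists c : (M -> Prop) -> M, forall P, (exists x, P x) -> P (c P).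
  have H (P : M -> Prop) : exists x, (exists x, P x) -> P x.
    by case: (pselect (exists x, P x)) => [[x Px]|nP]; [exists x | exists 0].
  by have [c cP] := choice H; exists c.
exists (fun x => c (fun y => N (x - y))); split=> [x|x y Nxy].
  by apply: (cP (fun y => N (x - y))); exists x; rewrite subrr; case: HN.
congr c; apply: funext => z; apply: propext; split=> Nz.
  have -> : y - z = (x - z) - (x - y) by rewrite opprB [RHS]addrC addrA subrK.
  exact: submodB.
by have := submodD HN Nxy Nz; rewrite addrA subrK.
Qed.

Variables (c : M -> M) (Nc : forall x, N (x - c x)).
Variable (cE : forall x y, N (x - y) -> c x = c y).

Let cc x : c (c x) = c x. Proof. by symmetry; apply: cE. Qed.
Let cD x y : c (c x + c y) = c (x + y).
Proof. by symmetry; apply: cE; rewrite opprD addrACA; exact: submodD. Qed.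
Let cZ a x : c (a *: c x) = c (a *: x).
Proof. by symmetry; apply: cE; rewrite -scalerBr; exact: submodZ. Qed.

(** The quotient is realised by the chosen representatives, the fixed points of [c]; operations are
    computed in [M] and brought back by [c]. *)
Definition quoty of (forall x, N (x - c x)) : Type := {x : M | c x = x}.
Notation Q := (quoty Nc).
HB.instance Definition _ := gen_eqMixin Q.
HB.instance Definition _ := gen_choiceMixin Q.

Let pi (x : M) : Q := exist _ (c x) (cc x).
Let rep (x : Q) : M := sval x.

Lemma quo_rep_inj : injective rep.
Proof.
move=> [x Nx] [y Ny] /= exy; rewrite /rep /= in exy; subst y.
by rewrite (Prop_irrelevance Nx Ny).
Qed.
Let repK x : c (rep x) = rep x. Proof. by case: x. Qed.
Let rpi x : rep (pi x) = c x. Proof. by []. Qed.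
Let rep_inj (x y : Q) : rep x = rep y -> x = y. Proof. exact: quo_rep_inj. Qed.

Let zero := pi 0.
Let opp x := pi (- rep x).
Let add x y := pi (rep x + rep y).
Let scal a x := pi (a *: rep x).

Let cDl x y : c (c x + y) = c (x + y).
Proof. by rewrite -[LHS]cD cc cD. Qed.
Let cDr x y : c (x + c y) = c (x + y).
Proof. by rewrite addrC cDl addrC. Qed.

Fact quo_addA : associative add.
Proof. by move=> x y z; apply: rep_inj; rewrite !rpi cDl cDr addrA. Qed.
Fact quo_addC : commutative add.
Proof. by move=> x y; apply: rep_inj; rewrite !rpi addrC. Qed.
Fact quo_add0 : left_id zero add.
Proof. by move=> x; apply: rep_inj; rewrite !rpi cDl add0r repK. Qed.
Fact quo_addN : left_inverse zero opp add.
Proof. by move=> x; apply: rep_inj; rewrite !rpi cDl addNr. Qed.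
HB.instance Definition _ :=
  GRing.isZmodule.Build Q quo_addA quo_addC quo_add0 quo_addN.

Fact quo_scaleA a b v : scal a (scal b v) = scal (a * b) v.
Proof. by apply: rep_inj; rewrite !rpi cZ scalerA. Qed.
Fact quo_scale1 : left_id 1 scal.
Proof. by move=> x; apply: rep_inj; rewrite !rpi scale1r repK. Qed.
Fact quo_scaleDr : right_distributive scal +%R.
Proof.
by move=> a x y; apply: rep_inj; rewrite !rpi cDl cDr cZ scalerDr.
Qed.
Fact quo_scaleDl v : {morph scal^~ v : a b / a + b}.
Proof. by move=> a b; apply: rep_inj; rewrite !rpi cDl cDr scalerDl. Qed.
HB.instance Definition _ := GRing.Zmodule_isLmodule.Build R Q
  quo_scaleA quo_scale1 quo_scaleDr quo_scaleDl.

Fact quo_pi_linear : linear pi.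
Proof.
by move=> a x y; apply: rep_inj; rewrite /= cDl cDr -[RHS]cDl cZ cDl.
Qed.

Lemma quotient_of_repr : exists (Q : lmodType R) (p : {linear M -> Q}),
  surjective p /\ forall x, p x = 0 <-> N x.
Proof.
exists (Q : lmodType R), (mklin quo_pi_linear); split=> [x|x].
  by exists (rep x); apply: rep_inj; exact: repK.
split=> [/(congr1 rep)|Nx].
  rewrite /= => e; have := submodD HN (Nc x) (submodN HN (Nc 0)).
  by rewrite e sub0r opprK subrK.
by apply: rep_inj; apply: cE; rewrite subr0.
Qed.

End Quotient.

Lemma quotient_exists M (N : M -> Prop) : submod N ->
  exists (Q : lmodType R) (p : {linear M -> Q}),
  surjective p /\ forall x, p x = 0 <-> N x.
Proof.
by move=> HN; have [c [Nc cE]] := coset_repr_exists HN;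
  exact: quotient_of_repr Nc cE.
Qed.

End Submodules.

(** * Short exact sequences *)

Section ExactSequences.
Variable R : pzRingType.
Implicit Types A B C K M N P Q X Y Z : lmodType R.

Definition ses A B C (i : {linear A -> B}) (p : {linear B -> C}) :=
  [/\ injective i, surjective p & exact_at i p].

Lemma ses_inj A B C (i : {linear A -> B}) (p : {linear B -> C}) :
  ses i p -> injective i.
Proof. by case. Qed.

Lemma ses_surj A B C (i : {linear A -> B}) (p : {linear B -> C}) :
  ses i p -> surjective p.
Proof. by case. Qed.

Lemma ses_ex A B C (i : {linear A -> B}) (p : {linear B -> C}) b :
  ses i p -> p b = 0 -> exists a, i a = b.
Proof. by case=> _ _ ik /ik. Qed.

Lemma ses0 A B C (i : {linear A -> B}) (p : {linear B -> C}) a :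
  ses i p -> p (i a) = 0.
Proof. by case=> _ _ ik; apply/ik; exists a. Qed.

Lemma inj0 X Y (f : {linear X -> Y}) :
  (forall x, f x = 0 -> x = 0) -> injective f.
Proof.
by move=> f0 x y exy; apply/subr0_eq/f0; rewrite linearB exy subrr.
Qed.

Lemma pair_linear X Y Z (f : {linear Z -> X}) (g : {linear Z -> Y}) :
  linear (fun z => (f z, g z) : (X * Y)%type).
Proof. by move=> a x y; rewrite !linearP. Qed.
Definition linpair X Y Z (f : {linear Z -> X}) (g : {linear Z -> Y}) :=
  mklin (pair_linear f g).

Lemma copair_linear X Y Z (f : {linear X -> Z}) (g : {linear Y -> Z}) :
  linear (fun z : (X * Y)%type => f z.1 + g z.2).
Proof.
by move=> a x y /=; rewrite !linearP /= scalerDr addrACA.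
Qed.
Definition lincopair X Y Z (f : {linear X -> Z}) (g : {linear Y -> Z}) :=
  mklin (copair_linear f g).

Definition inl_lin X Y : {linear X -> (X * Y)%type} :=
  linpair (idfun : {linear X -> X}) (\0 : {linear X -> Y}).
Definition inr_lin X Y : {linear Y -> (X * Y)%type} :=
  linpair (\0 : {linear Y -> X}) (idfun : {linear Y -> Y}).

Lemma scale_to_linear X (x : X) : linear (fun r : R^o => (r : R) *: x).
Proof. by move=> a r s; rewrite scalerDl scalerA. Qed.
Definition scale_to X (x : X) : {linear R^o -> X} := mklin (scale_to_linear x).

Lemma ses_coker A B (i : {linear A -> B}) : injective i ->
  exists C (p : {linear B -> C}), ses i p.
Proof.
by move=> ii; have [C [p [ps pk]]] := quotient_exists (submod_im i); exists C, p.
Qed.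

Lemma ses_ker B C (p : {linear B -> C}) : surjective p ->
  exists A (i : {linear A -> B}), ses i p.
Proof.
by move=> ps; have [A [i [ii ik]]] := sub_exists (submod_ker p); exists A, i.
Qed.

Lemma factor_inj A B X (i : {linear A -> B}) (f : {linear X -> B}) :
  injective i -> (forall x, exists a, i a = f x) ->
  exists g : {linear X -> A}, forall x, i (g x) = f x.
Proof.
move=> ii fi; apply: (linear_of_rel (P := fun x a => i a = f x)) => //.
  by move=> a x x' y y' ex ex'; rewrite !linearP ex ex'.
by move=> y; rewrite linear0 -(linear0 i) => /ii.
Qed.

Lemma factor_ker A B C X (i : {linear A -> B}) (p : {linear B -> C})
    (f : {linear X -> B}) : ses i p -> (forall x, p (f x) = 0) ->
  exists g : {linear X -> A}, forall x, i (g x) = f x.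
Proof. by case=> ii _ ik pf; apply: factor_inj => // x; apply/ik. Qed.

Lemma factor_surj B C Y (p : {linear B -> C}) (f : {linear B -> Y}) :
  surjective p -> (forall x, p x = 0 -> f x = 0) ->
  exists g : {linear C -> Y}, forall x, g (p x) = f x.
Proof.
move=> ps pf.
have [g gP] : exists g : {linear C -> Y}, forall x, exists b, p b = x /\ f b = g x.
  apply: (linear_of_rel (P := fun x y => exists b, p b = x /\ f b = y)).
  - by move=> x; have [b <-] := ps x; exists (f b), b.
  - move=> a x x' y y' [b [<- <-]] [b' [<- <-]].
    by exists (a *: b + b'); rewrite !linearP.
  - by move=> y [b [/pf -> <-]].
exists g => x; have [b [pb <-]] := gP (p x).
by apply/eqP; rewrite -subr_eq0 -linearB pf // linearB pb subrr.
Qed.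

Lemma pullback_exists A B C (f : {linear A -> C}) (g : {linear B -> C}) :
  exists Q (u : {linear Q -> A}) (v : {linear Q -> B}),
  [/\ forall z, f (u z) = g (v z),
      forall a b, f a = g b -> exists z, u z = a /\ v z = b &
      forall z, u z = 0 -> v z = 0 -> z = 0].
Proof.
have H : submod (fun z : (A * B)%type => f z.1 = g z.2).
  split=> [|a x y /= ex ey]; first by rewrite !linear0.
  by rewrite !linearP ex ey.
have [Q [i [ii iP]]] := sub_exists H.
exists Q, (fst \o i : {linear Q -> A}), (snd \o i : {linear Q -> B}).
split=> [z|a b e|z /= e1 e2]; first by apply/(iP (i z)); exists z.
  by have /(iP (a, b))[z ez] := e; exists z; rewrite /= ez.
apply: ii; rewrite linear0; case: (i z) e1 e2 => /= ? ? -> ->.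
by [].
Qed.

Lemma pushout_exists A B X (i : {linear A -> B}) (f : {linear A -> X}) :
  exists Q (u : {linear X -> Q}) (v : {linear B -> Q}),
  [/\ forall a, u (f a) = v (i a),
      forall q, exists x b, q = u x + v b &
      forall x b, u x + v b = 0 -> exists a, x = f a /\ b = - i a].
Proof.
have H : submod (fun z : (X * B)%type => exists a, z = (f a, - i a)).
  split=> [|r _ _ [a ->] [b ->]]; first by exists 0; rewrite !linear0.
  by exists (r *: a + b); rewrite (linearP f) (linearP i) opprD -scalerN.
have [Q [p [ps pP]]] := quotient_exists H.
have lu : linear (fun x : X => (x, 0) : (X * B)%type).
  by move=> a x y; congr pair; rewrite /= scaler0 addr0.
have lv : linear (fun b : B => (0, b) : (X * B)%type).
  by move=> a x y; congr pair; rewrite /= scaler0 addr0.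
exists Q, (p \o mklin lu : {linear X -> Q}), (p \o mklin lv : {linear B -> Q}).
have dec x b : p (x, 0) + p (0, b) = p (x, b).
  by rewrite -linearD; congr (p _); congr pair; rewrite /= ?addr0 ?add0r.
split=> [a|q|x b] /=.
- apply/eqP; rewrite -subr_eq0 -linearB; apply/eqP/pP; exists a.
  by congr pair; rewrite /= ?subr0 ?sub0r.
- by have [[x b] <-] := ps q; exists x, b; rewrite dec.
- by rewrite dec => /pP[a [-> ->]]; exists a.
Qed.

Lemma ses_pullback A B C X (i : {linear A -> B}) (p : {linear B -> C})
    (f : {linear X -> C}) : ses i p ->
  exists Q (j : {linear A -> Q}) (q : {linear Q -> X}) (r : {linear Q -> B}),
  [/\ ses j q, forall z, p (r z) = f (q z), forall a, r (j a) = i a,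
      forall b x, p b = f x -> exists z, r z = b /\ q z = x &
      forall z, r z = 0 -> q z = 0 -> z = 0].
Proof.
case=> ii ps ik; have [Q [r [q [e1 e2 e3]]]] := pullback_exists p f.
have [j jP] : exists j : {linear A -> Q}, forall a, r (j a) = i a /\ q (j a) = 0.
  apply: (linear_of_rel (P := fun a z => r z = i a /\ q z = 0)).
  - by move=> a; apply: e2; rewrite linear0; apply/ik; exists a.
  - move=> s x x' y y' [h1 h2] [h3 h4].
    by rewrite !linearP h1 h2 h3 h4 scaler0 addr0.
  - by move=> y []; rewrite linear0 => *; apply: e3.
exists Q, j, q, r; split=> //; last by move=> a; have [] := jP a.
split.
- apply: inj0 => a ja; apply: ii; have [<- _] := jP a.
  by rewrite ja !linear0.
- by move=> x; have [b bx] := ps (f x); have [z [_ zx]] := e2 _ _ bx; exists z.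
- move=> z; split=> [qz|[a <-]]; last by have [] := jP a.
  have /ik[a ia] : p (r z) = 0 by rewrite e1 qz linear0.
  exists a; apply: subr0_eq; have [h1 h2] := jP a.
  by apply: e3; rewrite linearB ?h1 ?h2 ?qz ?ia subrr.
Qed.

Lemma ses_pushout A B C X (i : {linear A -> B}) (p : {linear B -> C})
    (f : {linear A -> X}) : ses i p ->
  exists Q (j : {linear X -> Q}) (q : {linear Q -> C}) (r : {linear B -> Q}),
  [/\ ses j q, forall a, r (i a) = j (f a), forall b, q (r b) = p b &
      forall z, exists x b, z = j x + r b].
Proof.
case=> ii ps ik; have [Q [u [v [e1 e2 e3]]]] := pushout_exists i f.
have [q qP] : exists q : {linear Q -> C}, forall z, exists x b,
    z = u x + v b /\ q z = p b.
  apply: (linear_of_rel (P := fun z c => exists x b, z = u x + v b /\ c = p b)).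
  - by move=> z; have [x [b zE]] := e2 z; exists (p b), x, b.
  - move=> s _ _ _ _ [x [b [-> ->]]] [y [c [-> ->]]].
    exists (s *: x + y), (s *: b + c).
    by rewrite !linearP scalerDr addrACA.
  - move=> _ [x [b [/esym/e3[a [_ ->]] ->]]].
    by rewrite linearN (_ : p (i a) = 0) ?oppr0 //; apply/ik; exists a.
(* [q] is only known through some decomposition of its argument; two decompositions differ by a pair
   [(f a, - i a)], which contributes nothing because [p] kills [i a]. *)
have quv x b : q (u x + v b) = p b.
  have [x' [b' [e ->]]] := qP (u x + v b).
  have /e3[a [_ /eqP]] : u (x - x') + v (b - b') = 0.
    by rewrite !linearB addrACA -opprD e subrr.
  rewrite subr_eq => /eqP ->; rewrite linearD linearN (_ : p (i a) = 0).
    by rewrite oppr0 add0r.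
  by apply/ik; exists a.
exists Q, u, q, v; split=> // [|b]; last first.
  by have := quv 0 b; rewrite linear0 add0r.
split.
- apply: inj0 => x ux; have := e3 x 0; rewrite linear0 addr0 => /(_ ux)[a [-> /eqP]].
  rewrite eq_sym oppr_eq0 => /eqP ia.
  by rewrite (_ : a = 0) ?linear0 //; apply: ii; rewrite linear0.
- by move=> c; have [b <-] := ps c; exists (u 0 + v b).
- move=> z; have [x [b ->]] := e2 z; rewrite quv; split=> [/ik[a <-]|].
    by exists (x + f a); rewrite linearD e1.
  case=> y e; have /e3[a [_ ->]] : u (x - y) + v b = 0.
    by rewrite linearB addrAC -e subrr.
  by rewrite linearN (_ : p (i a) = 0) ?oppr0 //; apply/ik; exists a.
Qed.

Lemma ses_retraction A B C (i : {linear A -> B}) (p : {linear B -> C})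
    (r : {linear B -> A}) : ses i p -> cancel i r ->
  exists s : {linear C -> B}, cancel s p /\ forall b, b = i (r b) + s (p b).
Proof.
case=> ii ps ik ir.
have l : linear (fun b => b - i (r b)).
  by move=> a x y; rewrite (linearP r) (linearP i) scalerBr opprD addrACA.
have [s sP] : exists s : {linear C -> B}, forall b, s (p b) = mklin l b.
  apply: factor_surj => // x /ik[a <-] /=; by rewrite ir subrr.
exists s; split=> [c|b]; last by rewrite sP /= addrC subrK.
have [b <-] := ps c; rewrite sP /= linearB (_ : p (i _) = 0) ?subr0 //.
by apply/ik; exists (r b).
Qed.

Lemma ses_section A B C (i : {linear A -> B}) (p : {linear B -> C})
    (s : {linear C -> B}) : ses i p -> cancel s p ->
  exists r : {linear B -> A}, cancel i r /\ forall b, b = i (r b) + s (p b).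
Proof.
move=> ip sp.
have l : linear (fun b => b - s (p b)).
  by move=> a x y; rewrite (linearP p) (linearP s) scalerBr opprD addrACA.
have [x|r rP] := factor_ker (f := mklin l) ip; first by rewrite /= linearB sp subrr.
exists r; split=> [a|b]; last by rewrite rP /= subrK.
case: ip => ii _ ik; apply: ii; rewrite rP /= (_ : p (i a) = 0).
  by rewrite linear0 subr0.
by apply/ik; exists a.
Qed.

Lemma summand_inj M N (i : {linear M -> N}) (p : {linear N -> M}) :
  cancel i p -> injective i /\ surjective p.
Proof. by move=> ip; split=> [|x]; [exact: can_inj ip | exists (i x)]. Qed.

Lemma summand_complement M N : direct_summand M N ->
  exists M' (i : {linear M -> N}) (p : {linear N -> M'}),
  ses i p /\ exists f : {linear N -> (M * M')%type}, bijective f.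
Proof.
case=> i [r ir]; have [ii _] := summand_inj ir.
have [M' [p ip]] := ses_coker ii; exists M', i, p; split=> //.
have [s [sp E]] := ses_retraction ip ir.
exists (linpair r p), (lincopair i s) => [b|[m m']] /=; first by rewrite -E.
case: (ip) => _ _ ik.
have pi0 x : p (i x) = 0 by apply/ik; exists x.
have rs : r (s m') = 0.
  apply: ii; apply: (@addIr _ (s (p (s m')))); rewrite -E sp linear0 add0r.
  by [].
by rewrite !linearD ir pi0 rs sp addr0 add0r.
Qed.

Lemma direct_summand_refl M : direct_summand M M.
Proof. by exists (idfun : {linear M -> M}), (idfun : {linear M -> M}). Qed.

Lemma direct_summand_trans M N Q :
  direct_summand M N -> direct_summand N Q -> direct_summand M Q.
Proof.
move=> [i [p ip]] [j [q jq]].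
exists (j \o i : {linear M -> Q}), (p \o q : {linear Q -> M}) => x /=.
by rewrite jq ip.
Qed.

Lemma bij_inv X Y (f : {linear X -> Y}) : bijective f ->
  exists g : {linear Y -> X}, cancel f g /\ cancel g f.
Proof.
case=> g0 fg gf; have lg : linear g0.
  by move=> a x y; apply: (can_inj fg); rewrite linearP !gf.
by exists (mklin lg).
Qed.

Lemma inj_surj_bij X Y (f : {linear X -> Y}) :
  injective f -> surjective f -> bijective f.
Proof.
move=> fi fs; have [g gP] := choice fs; exists g => // x.
by apply: fi; rewrite gP.
Qed.

Lemma summandl A B : direct_summand A (A * B)%type.
Proof.
exists (linpair (idfun : {linear A -> A}) (\0 : {linear A -> B})).
by exists (fst : {linear (A * B)%type -> A}).
Qed.

Lemma summandr A B : direct_summand B (A * B)%type.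
Proof.
exists (linpair (\0 : {linear B -> A}) (idfun : {linear B -> B})).
by exists (snd : {linear (A * B)%type -> B}).
Qed.

Lemma ses_prod A B : exists (i : {linear A -> (A * B)%type})
  (p : {linear (A * B)%type -> B}), ses i p.
Proof.
exists (linpair (idfun : {linear A -> A}) (\0 : {linear A -> B})).
exists (snd : {linear (A * B)%type -> B}); split.
- by move=> x y [].
- by move=> y; exists (0, y).
- by move=> [a b] /=; split=> [->|[x [] //]]; exists a.
Qed.

Lemma zero_summand Z M : is_zero Z -> direct_summand Z M.
Proof.
by move=> Z0; exists (\0 : {linear Z -> M}), (\0 : {linear M -> Z}) => x; rewrite [RHS]Z0.
Qed.

End ExactSequences.

(** * Finitely generated modules and Ext^1 *)

Section FinGen.
Variable R : pzRingType.
Implicit Types A B C K M N P Q X Y Z : lmodType R.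

Lemma fin_genP M : fin_gen M <-> exists (I : finType) (g : I -> M),
  forall x, exists c : I -> R, x = \sum_i c i *: g i.
Proof.
split=> [[n [g gP]]|[I [g gP]]]; first by exists 'I_n, g.
exists #|I|, (g \o enum_val) => x; have [c ->] := gP x.
exists (c \o enum_val); rewrite (reindex_onto enum_val enum_rank) /=.
  by apply: eq_bigl => i; rewrite enum_valK eqxx.
by move=> i _; rewrite enum_rankK.
Qed.

Lemma fin_gen_surj M N (p : {linear M -> N}) :
  surjective p -> fin_gen M -> fin_gen N.
Proof.
move=> ps [n [g gP]]; exists n, (p \o g) => y; have [x <-] := ps y.
have [c ->] := gP x; exists c; rewrite linear_sum.
by apply: eq_bigr => i _; rewrite linearZ.
Qed.

Lemma fin_gen_summand M N : direct_summand M N -> fin_gen N -> fin_gen M.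
Proof. by case=> i [p /summand_inj[_ ps]]; exact: fin_gen_surj ps. Qed.

Lemma fin_gen_ext A B C (i : {linear A -> B}) (p : {linear B -> C}) :
  ses i p -> fin_gen A -> fin_gen C -> fin_gen B.
Proof.
case=> ii ps ik [n [g gP]] [m [h hP]].
have [h' h'P] := choice (fun j => ps (h j)).
apply/fin_genP; exists ('I_n + 'I_m)%type.
exists (fun j => match j with inl j => i (g j) | inr j => h' j end) => x.
have [c cE] := hP (p x).
have /ik[a aE] : p (x - \sum_j c j *: h' j) = 0.
  rewrite linearB cE linear_sum; apply/eqP; rewrite subr_eq0; apply/eqP.
  by apply: eq_bigr => j _; rewrite linearZ /= h'P.
have [d dE] := gP a.
exists (fun j => match j with inl j => d j | inr j => c j end).
rewrite big_sumType /= -[LHS](subrK (\sum_j c j *: h' j)) -aE dE linear_sum.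
by congr (_ + _); apply: eq_bigr => j _; rewrite linearZ.
Qed.

Lemma fin_gen_prod M N : fin_gen M -> fin_gen N -> fin_gen (M * N)%type.
Proof. by have [i [p ip]] := ses_prod M N; exact: fin_gen_ext ip. Qed.

Lemma free_linear n M (g : 'I_n -> M) :
  linear (fun c : {ffun 'I_n -> R^o} => \sum_i (c i : R) *: g i).
Proof.
move=> a c d; rewrite scaler_sumr -big_split /=; apply: eq_bigr => i _.
by rewrite !ffunE scalerDl scalerA.
Qed.
Definition free_map n M (g : 'I_n -> M) := mklin (free_linear g).

Definition unitv (n : nat) (i : 'I_n) : {ffun 'I_n -> R^o} := [ffun j => (j == i)%:R].

Lemma free_mapE n M (f : {linear {ffun 'I_n -> R^o} -> M}) c :
  f c = \sum_i (c i : R) *: f (unitv i).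
Proof.
rewrite (_ : f c = f (\sum_i (c i : R) *: unitv i)).
  by rewrite linear_sum; apply: eq_bigr => i _; rewrite linearZ.
congr (f _); apply/ffunP => j; rewrite sum_ffunE (bigD1 j) //= big1 ?addr0.
  by rewrite !ffunE eqxx [RHS]mulr1.
by move=> i ij; rewrite !ffunE eq_sym (negbTE ij) [LHS]mulr0.
Qed.

Lemma fin_gen_free n : fin_gen {ffun 'I_n -> R^o}.
Proof.
exists n, (@unitv n) => c; exists c.
exact: (free_mapE (idfun : {linear _ -> _})).
Qed.

Lemma projective_free n : projective {ffun 'I_n -> R^o}.
Proof.
move=> M N p f ps.
have [g gP] := choice (fun i : 'I_n => ps (f (unitv i))).
exists (free_map g) => c; rewrite [RHS]free_mapE linear_sum /=.
by apply: eq_bigr => i _; rewrite linearZ /= gP.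
Qed.

Lemma fin_gen_free_cover M : fin_gen M ->
  exists n (p : {linear {ffun 'I_n -> R^o} -> M}), surjective p.
Proof.
case=> n [g gP]; exists n, (free_map g) => x; have [c ->] := gP x.
by exists (finfun c); apply: eq_bigr => i _; rewrite ffunE.
Qed.

Definition fgproj P := fin_gen P /\ projective P.

Lemma fgproj_free n : fgproj {ffun 'I_n -> R^o}.
Proof. by split; [exact: fin_gen_free | exact: projective_free]. Qed.

Lemma projective_summand P Q : direct_summand P Q -> projective Q -> projective P.
Proof.
move=> [i [r ir]] pQ M N p f ps.
have [h hP] := pQ _ _ p (f \o r : {linear Q -> N}) ps.
by exists (h \o i : {linear P -> M}) => x; rewrite /= hP /= ir.
Qed.

Lemma fgproj_summand P Q : direct_summand P Q -> fgproj Q -> fgproj P.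
Proof.
move=> PQ [fQ pQ]; split; first exact: fin_gen_summand PQ fQ.
exact: projective_summand PQ pQ.
Qed.

Lemma projective_prod P Q : projective P -> projective Q -> projective (P * Q)%type.
Proof.
move=> pP pQ M N p f ps.
have l1 : linear (fun x : P => (x, 0) : (P * Q)%type).
  by move=> a x y; congr pair; rewrite /= scaler0 addr0.
have l2 : linear (fun b : Q => (0, b) : (P * Q)%type).
  by move=> a x y; congr pair; rewrite /= scaler0 addr0.
have [g gP] := pP _ _ p (f \o mklin l1 : {linear P -> N}) ps.
have [h hP] := pQ _ _ p (f \o mklin l2 : {linear Q -> N}) ps.
exists (lincopair g h) => -[x y]; rewrite /= linearD gP hP /= -linearD.
by congr (f _); congr pair; rewrite /= ?addr0 ?add0r.
Qed.

Lemma fgproj_prod P Q : fgproj P -> fgproj Q -> fgproj (P * Q)%type.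
Proof.
by case=> fP pP [fQ pQ]; split; [exact: fin_gen_prod | exact: projective_prod].
Qed.

Lemma fgproj_split A B P (i : {linear A -> B}) (p : {linear B -> P}) :
  ses i p -> projective P -> exists s : {linear P -> B}, cancel s p.
Proof.
by case=> _ ps _ pP; have [s] := pP _ _ p (idfun : {linear P -> P}) ps; exists s.
Qed.

Lemma fgproj_cover M : fin_gen M ->
  exists K P (i : {linear K -> P}) (p : {linear P -> M}), ses i p /\ fgproj P.
Proof.
move=> /fin_gen_free_cover[n [p ps]]; have [K [i ip]] := ses_ker ps.
by exists K, {ffun 'I_n -> R^o}, i, p; split=> //; exact: fgproj_free.
Qed.

Lemma fgproj_in_add P : fgproj P -> in_add R^o P.
Proof.
case=> /fin_gen_free_cover[n [p ps]] pP.
have [s sP] := pP _ _ p (idfun : {linear P -> P}) ps.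
by exists n, s, p.
Qed.

(** Vanishing of Ext^1(M, N) in Yoneda form: the pushout of an extension along [f] splits exactly
    when [f] extends. Quantifying over all sequences ending in [M] avoids a choice of resolution. *)
Definition ext1 M N := forall A B (i : {linear A -> B}) (p : {linear B -> M})
  (f : {linear A -> N}), ses i p -> exists g : {linear B -> N}, forall a, g (i a) = f a.

(* extn i M N stands for Ext^(i+1)(M, N) = 0. *)
Fixpoint extn i M N := if i is i'.+1 then
  forall K P (j : {linear K -> P}) (p : {linear P -> M}), ses j p -> fgproj P ->
  extn i' K N else ext1 M N.

(** Lift [P] into a given extension [B] of [M]. Then [B] is a quotient of [A * P], and [f] together
    with a compatible map on [P] descends to [B]. *)
Lemma ext1_of_proj K P M N (i : {linear K -> P}) (p : {linear P -> M}) :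
  ses i p -> projective P ->
  (forall f : {linear K -> N}, exists g : {linear P -> N}, forall a, g (i a) = f a) ->
  ext1 M N.
Proof.
move=> ip pP HN A B j q f jq.
have [l lP] : exists l : {linear P -> B}, forall x, q (l x) = p x.
  by apply: pP; case: jq.
have [x|h hP] := factor_ker (f := l \o i : {linear K -> B}) jq.
  by rewrite /= lP; exact: ses0 ip.
have [g gP] := HN (f \o h : {linear K -> N}).
have [||u uP] := @factor_surj _ _ _ _ (lincopair j l) (lincopair f g).
- move=> b; have [x px] : exists x, p x = q b by case: ip.
  have [a ja] : exists a, j a = b - l x.
    by apply: (ses_ex jq); rewrite linearB lP px subrr.
  by exists (a, x); rewrite /= ja subrK.
- move=> [a x] /= e.
  have px : p x = 0.
    by have := congr1 q e; rewrite linearD (ses0 a jq) add0r lP linear0.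
  have [k kx] := ses_ex ip px; subst x.
  have -> : a = - h k.
    apply: (ses_inj jq); rewrite linearN hP; apply/eqP.
    by rewrite -addr_eq0 e.
  by rewrite gP linearN /= addNr.
by exists u => a; have := uP (a, 0); rewrite /= !linear0 !addr0.
Qed.

Lemma ext1_proj P N : projective P -> ext1 P N.
Proof.
move=> pP A B i p f ip; have [s sp] := fgproj_split ip pP.
have [r [ir _]] := ses_section ip sp.
by exists (f \o r : {linear B -> N}) => a; rewrite /= ir.
Qed.

Lemma projective_of_ext1 M : fin_gen M -> (forall N, ext1 M N) -> fgproj M.
Proof.
move=> fM HM; have [K [P [i [p [ip fP]]]]] := fgproj_cover fM.
have [r rP] := HM K K P i p (idfun : {linear K -> K}) ip.
have [s [sp _]] := ses_retraction ip rP.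
by apply: fgproj_summand fP; exists s, p.
Qed.

Lemma fgproj_kernel K P Q (i : {linear K -> P}) (p : {linear P -> Q}) :
  ses i p -> fgproj P -> projective Q -> fgproj K.
Proof.
move=> ip fP pQ; have [s sp] := fgproj_split ip pQ.
have [r [ir _]] := ses_section ip sp.
by apply: fgproj_summand fP; exists i, r.
Qed.

Lemma extn_proj i P N : projective P -> extn i P N.
Proof.
elim: i P => [|i IH] P pP; first exact: ext1_proj.
by move=> K Q j p jp fQ; apply: IH; case: (fgproj_kernel jp fQ pP).
Qed.

Lemma ext1_summand M M' N : direct_summand M M' -> ext1 M' N -> ext1 M N.
Proof.
move=> [s [t st]] H A B i p f ip.
have [Q [j [q [r [jq e1 e2 e3 e4]]]]] := ses_pullback t ip.
have [g gP] := H _ _ _ _ f jq.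
have [u uP] : exists u : {linear B -> Q}, forall b, r (u b) = b /\ q (u b) = s (p b).
  apply: (linear_of_rel (P := fun b z => r z = b /\ q z = s (p b))).
  - by move=> b; apply: e3; rewrite st.
  - by move=> a x x' y y' [h1 h2] [h3 h4]; rewrite !linearP h1 h2 h3 h4.
  - by move=> y; rewrite !linear0 => -[*]; exact: e4.
exists (g \o u : {linear B -> N}) => a /=; rewrite -gP; congr (g _).
apply: subr0_eq; have [h1 h2] := uP (i a).
apply: e4; rewrite linearB ?e2 ?h1 ?subrr // h2.
by rewrite (ses0 a ip) linear0 (ses0 a jq) subr0.
Qed.

Lemma ses_prod_map A B C A' B' C' (i : {linear A -> B}) (p : {linear B -> C})
    (i' : {linear A' -> B'}) (p' : {linear B' -> C'}) : ses i p -> ses i' p' ->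
  exists (u : {linear (A * A')%type -> (B * B')%type})
         (v : {linear (B * B')%type -> (C * C')%type}), ses u v.
Proof.
move=> ip ip'.
have lu : linear (fun z => (i z.1, i' z.2) : (B * B')%type).
  by move=> a x y; rewrite !linearP.
have lv : linear (fun z => (p z.1, p' z.2) : (C * C')%type).
  by move=> a x y; rewrite !linearP.
exists (mklin lu), (mklin lv); case: ip ip' => ii ps ik [ii' ps' ik']; split.
- by move=> [x x'] [y y'] /= [/ii -> /ii' ->].
- by move=> [y y']; have [x <-] := ps y; have [x' <-] := ps' y'; exists (x, x').
- move=> [y y'] /=; split=> [[/ik[x <-] /ik'[x' <-]]|[[x x'] /= [<- <-]]].
    by exists (x, x').
  by congr pair; [apply/ik; exists x | apply/ik'; exists x'].
Qed.

Lemma ses_iso A B C C' (i : {linear A -> B}) (p : {linear B -> C})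
    (f : {linear C -> C'}) : ses i p -> bijective f ->
  ses i (f \o p : {linear B -> C'}).
Proof.
move=> [ii ps ik] [g fg gf]; split=> // [y|y] /=.
  by have [x e] := ps (g y); exists x; rewrite /= e gf.
split=> [|[x <-]]; last by rewrite (_ : p (i x) = 0) ?linear0 //; apply/ik; exists x.
by move=> h; apply/ik; apply: (can_inj fg); rewrite h linear0.
Qed.

Definition noeth := forall M N (i : {linear N -> M}), fin_gen M -> injective i -> fin_gen N.

Section Noetherian.
Hypothesis noethR : noeth.

(** A presentation of [M] becomes one of [M'] after adding a presentation of the complement, and the
    syzygy of [M] is then a summand of that of [M']. The noetherian hypothesis keeps these syzygies
    finitely generated. *)
Lemma extn_summand i M M' N : fin_gen M' ->
  direct_summand M M' -> extn i M' N -> extn i M N.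
Proof.
elim: i M M' => [|i IH] M M' fM' MM'; first exact: ext1_summand.
move=> H K P j p jp fP.
have [M2 [u [q [uq [f bf]]]]] := summand_complement MM'.
have fM2 : fin_gen M2 by exact: fin_gen_surj (ses_surj uq) fM'.
have [K2 [P2 [j2 [p2 [jp2 fP2]]]]] := fgproj_cover fM2.
have [a [b ab]] := ses_prod_map jp jp2.
have [g [fg gf]] := bij_inv bf.
have bg : bijective g by exists f.
have fK : fin_gen (K * K2)%type.
  by case: ab => ia _ _; apply: noethR ia; case: (fgproj_prod fP fP2).
by apply: (IH _ _ fK (summandl K K2)); exact: H (ses_iso ab bg) (fgproj_prod fP fP2).
Qed.

End Noetherian.
End FinGen.

(** * Long exact sequences, projective dimension *)

Section LongExactSequence.
Variable R : pzRingType.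
Hypothesis noethR : noeth R.
Implicit Types A B C K M N P Q X Y Z : lmodType R.

(** One projective [P] covering [B] also covers [C], and the two syzygies differ by [A]. Passing to
    the rotated sequence lowers the degree of Ext by one, which drives the induction in
    [extn_les]. *)
Lemma rotation A B C (i : {linear A -> B}) (p : {linear B -> C}) :
  ses i p -> fin_gen B ->
  exists P (KB KC : lmodType R) (jB : {linear KB -> P}) (pB : {linear P -> B})
    (jC : {linear KC -> P}) (pC : {linear P -> C})
    (u : {linear KB -> KC}) (v : {linear KC -> A}),
  [/\ fgproj P, ses jB pB, ses jC pC, ses u v & forall k, jC (u k) = jB k].
Proof.
move=> ip fB; have [KB [P [jB [pB [sB fP]]]]] := fgproj_cover fB.
have [|KC [jC sC]] := @ses_ker _ _ _ (p \o pB : {linear P -> C}).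
  move=> c; have [b <-] := ses_surj ip c; have [x <-] := ses_surj sB b.
  by exists x.
have [x|u uE] := factor_ker (f := jB) sC; first by rewrite /= (ses0 x sB) linear0.
have [x|v vE] := factor_ker (f := (pB \o jC : {linear KC -> B})) ip.
  exact: (ses0 x sC).
exists P, KB, KC, jB, pB, jC, (p \o pB : {linear P -> C}), u, v; split=> //.
split.
- by move=> x y e; apply: (ses_inj sB); rewrite -!uE e.
- move=> a; have [x xE] := ses_surj sB (i a).
  have [|k kE] := ses_ex (b := x) sC; first by rewrite /= xE (ses0 _ ip).
  by exists k; apply: (ses_inj ip); rewrite vE /= kE.
- move=> k; split=> [vk|[k' <-]].
    have [|k' k'E] := ses_ex (b := jC k) sB; first by rewrite -[LHS]vE vk linear0.
    by exists k'; apply: (ses_inj sC); rewrite uE.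
  by apply: (ses_inj ip); rewrite vE /= uE (ses0 _ sB) linear0.
Qed.

(** [Q] is the preimage of [A] in [Y]. The map is extended from [X] to [Q], a step with quotient
    [A], and then to [Y], a step with quotient [C]. *)
Lemma ext1_middle A B C N (i : {linear A -> B}) (p : {linear B -> C}) :
  ses i p -> ext1 A N -> ext1 C N -> ext1 B N.
Proof.
move=> ip HA HC X Y k q f kq.
have [Q [j [r [w [jr e1 e2 e3 e4]]]]] := ses_pullback i kq.
have [g gP] := HA _ _ _ _ f jr.
have wp : ses w (p \o q : {linear Y -> C}).
  split.
  - apply: inj0 => z wz; apply: e4 => //; apply: (ses_inj ip).
    by rewrite -e1 wz !linear0.
  - move=> c; have [b <-] := ses_surj ip c; have [y <-] := ses_surj kq b.
    by exists y.
  - move=> y /=; split=> [qy|[z <-]]; last by rewrite e1 (ses0 _ ip).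
    have [a aE] := ses_ex ip qy; have [z [<- _]] := e3 y a (esym aE).
    by exists z.
have [h hP] := HC _ _ _ _ g wp.
by exists h => a; rewrite -e2 hP gP.
Qed.

Lemma ext1_coker A B C N (i : {linear A -> B}) (p : {linear B -> C}) :
  ses i p -> ext1 B N ->
  (forall f : {linear A -> N}, exists g : {linear B -> N}, forall a, g (i a) = f a) ->
  ext1 C N.
Proof.
move=> ip HB HN X Y k q f kq.
have [Q [j [r [w [jr e1 e2 e3 e4]]]]] := ses_pullback p kq.
have [g gP] := HB _ _ _ _ f jr.
have [v vP] : exists v : {linear A -> Q}, forall a, w (v a) = 0 /\ r (v a) = i a.
  apply: (linear_of_rel (P := fun a z => w z = 0 /\ r z = i a)).
  - by move=> a; apply: e3; rewrite linear0 (ses0 _ ip).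
  - by move=> a x x' y y' [h1 h2] [h3 h4]; rewrite !linearP h1 h2 h3 h4 scaler0 addr0.
  - by move=> y; rewrite !linear0 => -[*]; exact: e4.
have [h hP] := HN (g \o v : {linear A -> N}).
(* [g] need not vanish on the kernel of [w], which is the image of [v]. Its restriction there
   extends to a map [h] on [B]; then [g - h r] still extends [f], since [r j = 0], and descends to
   [Y]. *)
have lg : linear (fun z => g z - h (r z)).
  by move=> a x y; rewrite (linearP r) (linearP g) (linearP h) scalerBr opprD addrACA.
have [||t tP] := @factor_surj _ _ _ _ w (mklin lg).
- move=> y; have [b bE] := ses_surj ip (q y).
  by have [z [<- _]] := e3 y b (esym bE); exists z.
- move=> z wz; have [a aE] : exists a, i a = r z.
    by apply: (ses_ex ip); rewrite -e1 wz linear0.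
  have -> : z = v a.
    have [h1 h2] := vP a.
    by apply: subr0_eq; apply: e4; rewrite linearB ?wz ?h1 ?h2 ?aE subrr.
  have [_ ra] := vP a; by rewrite /= ra hP subrr.
by exists t => x; rewrite -e2 tP /= gP (ses0 _ jr) linear0 subr0.
Qed.

Lemma ext1_left A B C N (i : {linear A -> B}) (p : {linear B -> C}) :
  ses i p -> fin_gen B -> ext1 B N -> extn 1 C N -> ext1 A N.
Proof.
move=> ip fB HB HC.
have [P [KB [KC [jB [pB [jC [pC [u [v [fP sB sC uv e]]]]]]]]]] := rotation ip fB.
apply: (ext1_coker uv); first exact: HC sC fP.
move=> f; have [g gP] := HB _ _ _ _ f sB.
by exists (g \o jC : {linear KC -> N}) => a; rewrite /= e gP.
Qed.

(** The three claims need each other: the last, independence of the presentation, follows from the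
    first two in the same degree, and it lets them climb to the next degree through [rotation]. *)
Lemma extn_les n N :
  [/\ forall A B C (i : {linear A -> B}) (p : {linear B -> C}), ses i p ->
        fin_gen B -> extn n A N -> extn n C N -> extn n B N,
      forall A B C (i : {linear A -> B}) (p : {linear B -> C}), ses i p ->
        fin_gen B -> extn n B N -> extn n.+1 C N -> extn n A N &
      forall K P M (i : {linear K -> P}) (p : {linear P -> M}), ses i p ->
        fgproj P -> extn n K N -> extn n.+1 M N].
Proof.
have O m : (forall A B C (i : {linear A -> B}) (p : {linear B -> C}), ses i p ->
        fin_gen B -> extn m A N -> extn m C N -> extn m B N) ->
      (forall A B C (i : {linear A -> B}) (p : {linear B -> C}), ses i p ->
        fin_gen B -> extn m B N -> extn m.+1 C N -> extn m A N) ->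
      forall K P M (i : {linear K -> P}) (p : {linear P -> M}), ses i p ->
        fgproj P -> extn m K N -> extn m.+1 M N.
  move=> L1 L2 K P M i p ip fP HK K' P' j q jq fP'.
  (* As in Schanuel's lemma, the pullback [Q] of two presentations has [K] as kernel over [P'] and
     [K'] as kernel over [P]. *)
  have [Q [t [w [r [tw e1 e2 e3 e4]]]]] := ses_pullback q ip.
  have fQ : fin_gen Q.
    apply: fin_gen_ext tw _ (proj1 fP'); apply: noethR (proj1 fP) (ses_inj ip).
  have [l lP] : exists l : {linear K' -> Q}, forall a, r (l a) = 0 /\ w (l a) = j a.
    apply: (linear_of_rel (P := fun a z => r z = 0 /\ w z = j a)).
    - by move=> a; apply: e3; rewrite linear0 (ses0 _ jq).
    - by move=> a x x' y y' [h1 h2] [h3 h4]; rewrite !linearP h1 h2 h3 h4 scaler0 addr0.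
    - by move=> y; rewrite !linear0 => -[*]; exact: e4.
  have lr : ses l r.
    split.
    - move=> x y exy; have [_ h1] := lP x; have [_ h2] := lP y.
      by apply: (ses_inj jq); rewrite -h1 -h2 exy.
    - move=> y; have [b bE] := ses_surj jq (p y).
      by have [z [<- _]] := e3 y b (esym bE); exists z.
    - move=> z; split=> [rz|[k <-]]; last by have [] := lP k.
      have [k kE] : exists k, j k = w z.
        by apply: (ses_ex jq); rewrite -e1 rz linear0.
      exists k; have [h1 h2] := lP k.
      by apply: subr0_eq; apply: e4; rewrite linearB ?rz ?h1 ?h2 ?kE subrr.
  apply: (L2 _ _ _ _ _ lr fQ); last exact: extn_proj (proj2 fP).
  by apply: (L1 _ _ _ _ _ tw fQ HK); apply: extn_proj (proj2 fP').
elim: n => [|n [L1 L2 L4]].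
  have L1 : forall A B C (i : {linear A -> B}) (p : {linear B -> C}), ses i p ->
        fin_gen B -> extn 0 A N -> extn 0 C N -> extn 0 B N.
    by move=> A B C i p ip _; exact: ext1_middle ip.
  have L2 : forall A B C (i : {linear A -> B}) (p : {linear B -> C}), ses i p ->
        fin_gen B -> extn 0 B N -> extn 1 C N -> extn 0 A N.
    by move=> A B C i p; exact: ext1_left.
  by split=> //; exact: O.
have fKC A B (i : {linear A -> B}) : injective i -> fgproj B -> fin_gen A.
  by move=> ii [fB _]; exact: noethR ii.
have L3 A B C (i : {linear A -> B}) (p : {linear B -> C}) : ses i p -> fin_gen B ->
    extn n A N -> extn n.+1 B N -> extn n.+1 C N.
  move=> ip fB HA HB.
  have [P [KB [KC [jB [pB [jC [pC [u [v [fP sB sC uv e]]]]]]]]]] := rotation ip fB.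
  apply: (L4 _ _ _ _ _ sC fP); apply: (L1 _ _ _ _ _ uv) => //.
    exact: fKC (ses_inj sC) fP.
  exact: HB sB fP.
have L1' A B C (i : {linear A -> B}) (p : {linear B -> C}) : ses i p ->
    fin_gen B -> extn n.+1 A N -> extn n.+1 C N -> extn n.+1 B N.
  move=> ip fB HA HC.
  have [P [KB [KC [jB [pB [jC [pC [u [v [fP sB sC uv e]]]]]]]]]] := rotation ip fB.
  apply: (L4 _ _ _ _ _ sB fP); apply: (L2 _ _ _ _ _ uv) => //.
    exact: fKC (ses_inj sC) fP.
  exact: HC sC fP.
have L2' A B C (i : {linear A -> B}) (p : {linear B -> C}) : ses i p ->
    fin_gen B -> extn n.+1 B N -> extn n.+2 C N -> extn n.+1 A N.
  move=> ip fB HB HC.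
  have [P [KB [KC [jB [pB [jC [pC [u [v [fP sB sC uv e]]]]]]]]]] := rotation ip fB.
  apply: (L3 _ _ _ _ _ uv); first exact: fKC (ses_inj sC) fP.
    exact: HB sB fP.
  exact: HC sC fP.
by split=> //; exact: O.
Qed.

Section Sequence.
Variables (A B C N : lmodType R) (i : {linear A -> B}) (p : {linear B -> C}).
Hypotheses (ip : ses i p) (fB : fin_gen B).

Lemma extn_middle n : extn n A N -> extn n C N -> extn n B N.
Proof. by have [L _ _] := extn_les n N; exact: L ip fB. Qed.

Lemma extn_left n : extn n B N -> extn n.+1 C N -> extn n A N.
Proof. by have [_ L _] := extn_les n N; exact: L ip fB. Qed.

Lemma extn_right n : extn n A N -> extn n.+1 B N -> extn n.+1 C N.
Proof.
have [L1 _ L4] := extn_les n N => HA HB.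
have [P [KB [KC [jB [pB [jC [pC [u [v [fP sB sC uv e]]]]]]]]]] := rotation ip fB.
apply: (L4 _ _ _ _ _ sC fP); apply: (L1 _ _ _ _ _ uv) => //.
  by apply: noethR (ses_inj sC); case: fP.
exact: HB sB fP.
Qed.

End Sequence.

Lemma extn_of_presentation n K P M N (i : {linear K -> P}) (p : {linear P -> M}) :
  ses i p -> fgproj P -> extn n K N -> extn n.+1 M N.
Proof. by have [_ _ L] := extn_les n N; exact: L. Qed.

(** Since [extn] is shifted by one, this is the vanishing of Ext^(n+1)(M, -), hence projective
    dimension at most [n]. *)
Definition pd_le n M := forall N, extn n M N.
Definition fpd M := fin_gen M /\ exists n, pd_le n M.

Lemma pd_leS n M : pd_le n M -> pd_le n.+1 M.
Proof.
elim: n M => [|n IH] M HM N K P j p jp fP; last first.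
  by apply: IH => N'; exact: HM jp fP.
apply: (@extn_proj _ 0); have fM := fin_gen_surj (ses_surj jp) (proj1 fP).
by case: (fgproj_kernel jp fP (proj2 (projective_of_ext1 fM HM))).
Qed.

Lemma pd_le_mono m n M : (m <= n)%N -> pd_le m M -> pd_le n M.
Proof.
move=> mn; rewrite -(subnK mn); elim: (_ - _)%N => // d IH /IH; exact: pd_leS.
Qed.

Lemma fpd_proj P : fgproj P -> fpd P.
Proof. by case=> fP pP; split=> //; exists 0%N => N; exact: extn_proj. Qed.

Section SequenceFpd.
Variables (A B C : lmodType R) (i : {linear A -> B}) (p : {linear B -> C}).
Hypothesis ip : ses i p.

Lemma fpd_middle : fpd A -> fpd C -> fpd B.
Proof.
move=> [fA [m HA]] [fC [n HC]]; have fB := fin_gen_ext ip fA fC; split=> //.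
exists (maxn m n) => N; apply: (extn_middle ip fB).
  exact: pd_le_mono (leq_maxl m n) HA N.
exact: pd_le_mono (leq_maxr m n) HC N.
Qed.

Lemma fpd_left : fpd B -> fpd C -> fpd A.
Proof.
move=> [fB [m HB]] [fC [n HC]]; split; first exact: noethR (ses_inj ip).
exists (maxn m n) => N; apply: (extn_left ip fB).
  exact: pd_le_mono (leq_maxl m n) HB N.
by apply: (pd_le_mono _ HC); rewrite leqW // leq_maxr.
Qed.

Lemma fpd_right : fpd A -> fpd B -> fpd C.
Proof.
move=> [fA [m HA]] [fB [n HB]]; split; first exact: fin_gen_surj (ses_surj ip) fB.
exists (maxn m n).+1 => N; apply: (extn_right ip fB).
  exact: pd_le_mono (leq_maxl m n) HA N.
by apply: (pd_le_mono _ HB); rewrite leqW // leq_maxr.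
Qed.

End SequenceFpd.

Lemma fpd_summand M M' : direct_summand M M' -> fpd M' -> fpd M.
Proof.
move=> MM' [fM' [n HM']]; split; first exact: fin_gen_summand MM' fM'.
by exists n => N; exact: extn_summand MM' (HM' N).
Qed.

Lemma fpd_prod M N : fpd M -> fpd N -> fpd (M * N)%type.
Proof. by have [i [p ip]] := ses_prod M N; exact: fpd_middle ip. Qed.

Definition perp M N := forall n, extn n M N.

Lemma perp_proj P N : projective P -> perp P N.
Proof. by move=> pP n; exact: extn_proj. Qed.

Section SequencePerp.
Variables (A B C N : lmodType R) (i : {linear A -> B}) (p : {linear B -> C}).
Hypotheses (ip : ses i p) (fB : fin_gen B).

Lemma perp_middle : perp A N -> perp C N -> perp B N.
Proof. by move=> HA HC n; apply: (extn_middle ip fB); [exact: HA | exact: HC]. Qed.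

Lemma perp_left : perp B N -> perp C N -> perp A N.
Proof. by move=> HA HC n; apply: (extn_left ip fB); [exact: HA | exact: HC]. Qed.

Lemma perp_right : perp A N -> perp B N ->
  (forall f : {linear A -> N}, exists g : {linear B -> N}, forall a, g (i a) = f a) ->
  perp C N.
Proof.
move=> HA HB HN [|n]; first exact: ext1_coker ip (HB 0%N) HN.
by apply: (extn_right ip fB); [exact: HA | exact: HB].
Qed.

End SequencePerp.

Lemma perp_summand M M' N : fin_gen M' -> direct_summand M M' ->
  perp M' N -> perp M N.
Proof. by move=> fM' MM' H n; exact: extn_summand MM' (H n). Qed.

Lemma extn_summand_r i M N N' : direct_summand N N' -> extn i M N' -> extn i M N.
Proof.
move=> [s [t st]]; elim: i M => [|i IH] M H A B j p.
  move=> f jp; have [g gP] := H _ _ _ _ (s \o f : {linear A -> N'}) jp.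
  by exists (t \o g : {linear B -> N}) => a; rewrite /= gP /= st.
by move=> jp fP; apply: IH; exact: H jp fP.
Qed.

(* If Ext^1(X, N) = 0 for all X of finite projective dimension, then so do the
   higher Ext groups, because syzygies are again of finite projective dimension. *)
Lemma perp_of_ext1 N : (forall X, fpd X -> ext1 X N) -> forall X, fpd X -> perp X N.
Proof.
move=> H X fX n; elim: n X fX => [|n IH] X fX; first exact: H.
by move=> K P j p jp fP; apply: IH; exact: fpd_left jp (fpd_proj fP) fX.
Qed.

End LongExactSequence.

(** * Comparison with projective resolutions *)

Section Resolutions.
Variable R : pzRingType.
Implicit Types A B C K M N P X Y Z : lmodType R.

Section Splice.
Variables (K P M : lmodType R) (j : {linear K -> P}) (p : {linear P -> M}).
Hypotheses (jp : ses j p) (fP : fgproj P).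
Variable Q : resolution K.

Definition splice_res (n : nat) : lmodType R := if n is m.+1 then Q m else P.

Definition splice_d (n : nat) : {linear splice_res n.+1 -> splice_res n} :=
  match n with
  | 0 => (j \o res_aug Q : {linear Q 0%N -> P})
  | m.+1 => res_d Q m
  end.

Lemma splice_fin_gen n : fin_gen (splice_res n).
Proof. by case: n => [|n]; [case: fP | exact: res_fin_gen]. Qed.

Lemma splice_projective n : projective (splice_res n).
Proof. by case: n => [|n]; [case: fP | exact: res_projective]. Qed.

Lemma splice_exact0 : exact_at (splice_d 0) p.
Proof.
move=> x; split=> [px|[y <-]]; last exact: ses0 jp.
have [k <-] := ses_ex jp px; have [y <-] := @res_aug_surj _ _ Q k; by exists y.
Qed.

Lemma splice_exact n : exact_at (splice_d n.+1) (splice_d n).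
Proof.
case: n => [|n]; last exact: (@res_exact _ _ Q n).
move=> x; split=> [e|[y <-]] /=.
  have /(@res_exact0 _ _ Q) // : res_aug Q x = 0.
  by apply: (ses_inj jp); rewrite linear0; exact: e.
rewrite (_ : res_aug Q _ = 0) ?linear0 //.
by apply/(@res_exact0 _ _ Q); exists y.
Qed.

Definition splice : resolution M :=
  Resolution splice_fin_gen splice_projective (ses_surj jp) splice_exact0 splice_exact.

End Splice.

Section Shift.
Variables (M : lmodType R) (Q : resolution M).

(** [K] is the first syzygy, resolved by the terms of [Q] from degree 1 on. Together with [splice]
    this translates between resolutions and recursion over presentations. *)
Lemma shift_exists : exists (K : lmodType R) (i : {linear K -> Q 0%N})
    (a : {linear Q 1%N -> K}),
  [/\ ses i (res_aug Q), surjective a, forall x, i (a x) = res_d Q 0 x &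
      exact_at (res_d Q 1) a].
Proof.
have [K [i ip]] := ses_ker (@res_aug_surj _ _ Q).
have [x|a aE] := factor_ker (f := res_d Q 0) ip.
  by apply/(@res_exact0 _ _ Q); exists x.
exists K, i, a; split=> // [k|x].
  have /(@res_exact0 _ _ Q)[x xE] := ses0 k ip; exists x.
  by apply: (ses_inj ip); rewrite aE.
rewrite -(@res_exact _ _ Q 0) -aE; split=> [->|e]; first by rewrite linear0.
by apply: (ses_inj ip); rewrite e linear0.
Qed.

Variables (K : lmodType R) (a : {linear Q 1%N -> K}).
Hypotheses (sa : surjective a) (ea : exact_at (res_d Q 1) a).

Definition shift_res : resolution K :=
  @Resolution R K (fun n => Q n.+1) (fun n => res_d Q n.+1) a
    (fun n => res_fin_gen Q n.+1) (fun n => @res_projective _ _ Q n.+1) sa ea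
    (fun n => @res_exact _ _ Q n.+1).

End Shift.

Lemma res_fgproj M (Q : resolution M) n : fgproj (Q n).
Proof. by split; [exact: res_fin_gen | exact: res_projective]. Qed.

Hypothesis noethR : noeth R.

Section Existence.

Let fgmod := {M : lmodType R | fin_gen M}.

(** Bundled so that a presentation can be chosen for every finitely generated module at once;
    iterating the choice produces a resolution. *)
Record presentation (Z : fgmod) := Presentation {
  pres_K : fgmod; pres_P : lmodType R;
  pres_i : {linear sval pres_K -> pres_P}; pres_p : {linear pres_P -> sval Z};
  pres_ses : ses pres_i pres_p; pres_proj : fgproj pres_P }.

Lemma presentation_exists (Z : fgmod) : inhabited (presentation Z).
Proof.
case: Z => M fM; have [K [P [i [p [ip fP]]]]] := fgproj_cover fM.
have fK : fin_gen K := noethR (proj1 fP) (ses_inj ip).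
by split; exists (exist _ K fK) P i p.
Qed.

Let pres (Z : fgmod) : presentation Z := inhabited_witness (presentation_exists Z).

Lemma resolution_exists M : fin_gen M -> inhabited (resolution M).
Proof.
move=> fM; pose Z n : fgmod := iter n (fun Z : fgmod => pres_K (pres Z)) (exist _ M fM).
pose d n : {linear pres_P (pres (Z n.+1)) -> pres_P (pres (Z n))} :=
  (pres_i (pres (Z n)) \o pres_p (pres (Z n.+1))
     : {linear pres_P (pres (Z n.+1)) -> pres_P (pres (Z n))}).
split; apply: (@Resolution R M (fun n => pres_P (pres (Z n))) d (pres_p (pres (Z 0%N)))).
- by move=> n; case: (pres_proj (pres (Z n))).
- by move=> n; case: (pres_proj (pres (Z n))).
- exact: ses_surj (pres_ses (pres (Z 0%N))).
- move=> x; split=> [/(ses_ex (pres_ses (pres (Z 0%N))))[y <-]|[y <-]].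
    by have [z <-] := ses_surj (pres_ses (pres (Z 1%N))) y; exists z.
  exact: ses0 (pres_ses (pres (Z 0%N))).
- move=> n x; split=> [e|[y <-]].
    have /(ses_ex (pres_ses (pres (Z n.+1))))[y <-] :
        pres_p (pres (Z n.+1)) x = 0.
      by apply: (ses_inj (pres_ses (pres (Z n)))); rewrite linear0.
    by have [z <-] := ses_surj (pres_ses (pres (Z n.+2))) y; exists z.
  rewrite /d /= (ses0 _ (pres_ses (pres (Z n.+1)))); exact: linear0.
Qed.

End Existence.

(** [Ext_succ_eq0] may be applied to a presentation spliced with any resolution of its kernel. In
    degree 0 a map on [K] becomes a cocycle after composition with the augmentation. *)
Lemma ext_succ_extn n M N : fin_gen M -> Ext_succ_eq0 n M N -> extn n M N.
Proof.
elim: n M => [|n IH] M fM H.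
  have [K [P [i [p [ip fP]]]]] := fgproj_cover fM.
  have [Q] := resolution_exists (noethR (proj1 fP) (ses_inj ip)).
  apply: (ext1_of_proj ip (proj2 fP)) => f.
  have [|g gP] := H (splice ip fP Q) (f \o res_aug Q : {linear Q 0%N -> N}).
    move=> x; have e : res_aug Q (res_d Q 0 x) = 0.
      by apply/(@res_exact0 _ _ Q); exists x.
    by have := congr1 f e; rewrite linear0.
  exists g => a; have [x <-] := @res_aug_surj _ _ Q a; by rewrite -(gP x).
move=> K P j p jp fP; apply: IH; first exact: noethR (proj1 fP) (ses_inj jp).
by move=> Q f fz; have := H (splice jp fP Q) f fz.
Qed.

Lemma extn_ext_succ n M N : extn n M N -> Ext_succ_eq0 n M N.
Proof.
elim: n M => [|n IH] M H Q f fz.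
  have [K [i [a [ip sa ia ea]]]] := shift_exists Q.
  have [|f' f'P] := factor_surj (f := f) sa.
    by move=> x /ea[y <-].
  have [g gP] := H _ _ _ _ f' ip.
  by exists g => x; rewrite -ia gP f'P.
have [K [i [a [ip sa ia ea]]]] := shift_exists Q.
exact: (IH _ (H _ _ _ _ ip (res_fgproj Q 0)) (shift_res sa ea) f fz).
Qed.

Lemma ext_succ_perp M N : fin_gen M ->
  (forall n, Ext_succ_eq0 n M N) <-> perp M N.
Proof.
move=> fM; split=> H n; first exact: ext_succ_extn.
exact: extn_ext_succ.
Qed.

Lemma proj_dim_le_pd_le n M : proj_dim_le n M -> pd_le n M.
Proof.
elim: n M => [|n IH] M [Q HQ] N; have [K [i [a [ip sa ia ea]]]] := shift_exists Q.
  apply: (@extn_proj _ 0); have [_ pQ] := res_fgproj Q 0.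
  have aug_inj : injective (res_aug Q).
    apply: inj0 => x /(ses_ex ip)[k <-]; have [y <-] := sa k.
    by rewrite (HQ 1%N isT y) !linear0.
  have [g [h1 h2]] := bij_inv (inj_surj_bij aug_inj (@res_aug_surj _ _ Q)).
  by apply: projective_summand pQ; exists g, (res_aug Q).
apply: (extn_of_presentation noethR ip (res_fgproj Q 0)).
by apply: IH; exists (shift_res sa ea) => k nk; exact: (HQ k.+1 nk).
Qed.

Lemma pd_le_proj_dim_le n M : fin_gen M -> pd_le n M -> proj_dim_le n M.
Proof.
elim: n M => [|n IH] M fM H; have [K [P [j [p [jp fP]]]]] := fgproj_cover fM.
  have fM' := projective_of_ext1 fM H.
  have [Q0] := resolution_exists (fin_gen_free R 0).
  pose z : {linear {ffun 'I_0 -> R^o} -> {ffun 'I_0 -> R^o}} := idfun.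
  have Z0 (x y : {ffun 'I_0 -> R^o}) : x = y by apply/ffunP => -[].
  have zs : surjective z by move=> y; exists y.
  have ez : exact_at (\0 : {linear {ffun 'I_0 -> R^o} -> {ffun 'I_0 -> R^o}}) z.
    by move=> y; split=> _; [exists 0 | ]; exact: Z0.
  have ez' : exact_at (\0 : {linear {ffun 'I_0 -> R^o} -> {ffun 'I_0 -> R^o}})
      (\0 : {linear {ffun 'I_0 -> R^o} -> {ffun 'I_0 -> R^o}}).
    by move=> y; split=> _; [exists 0 | ]; exact: Z0.
  (* The resolution of the zero module by zero modules; spliced behind the projective [M] it leaves
     only degree 0. *)
  pose QZ := @Resolution R {ffun 'I_0 -> R^o} (fun _ => {ffun 'I_0 -> R^o})
    (fun _ => \0) z (fun _ => fin_gen_free R 0) (fun _ => @projective_free R 0)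
    zs ez (fun _ => ez').
  have sM : ses (\0 : {linear {ffun 'I_0 -> R^o} -> M}) (idfun : {linear M -> M}).
    split=> [x y _|y|y]; [exact: Z0 | by exists y |].
    by split=> [y0|[x <-]]; [exists 0; exact: esym y0 | ].
  by exists (splice sM fM' QZ) => -[//|k] _ x; exact: Z0.
have fK := noethR (proj1 fP) (ses_inj jp).
have [|Q HQ] := IH K fK; first by move=> N; exact: H jp fP.
by exists (splice jp fP Q) => -[//|k] nk; exact: HQ.
Qed.

Lemma fin_proj_dimE M : fin_proj_dim M <-> fpd M.
Proof.
split=> -[fM [n Hn]]; split=> //; exists n; first exact: proj_dim_le_pd_le.
exact: pd_le_proj_dim_le.
Qed.

End Resolutions.

(** * add(T) and coresolutions *)

Section Additive.
Variable R : pzRingType.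
Implicit Types A B C K M N P Q T X Y Z : lmodType R.

Lemma fgproj_regular : fgproj (R^o : lmodType R).
Proof.
split.
  exists 1%N, (fun _ => 1) => x; exists (fun _ => x).
  by rewrite big_ord1; exact: (esym (mulr1 _)).
move=> M N p f ps; have [m mE] := ps (f 1).
exists (scale_to m) => x; rewrite /= linearZ /= mE -linearZ; congr (f _).
exact: mulr1.
Qed.

(** Membership in [add T] as a decomposition of the identity into maps through [T]: in this form
    products and composites need no matrices, and locality of endomorphism rings applies
    directly. *)
Lemma in_addP T M : in_add T M <-> exists (J : finType) (u : J -> {linear M -> T})
  (v : J -> {linear T -> M}), forall x, x = \sum_j v j (u j x).
Proof.
split=> [[n [i [p ip]]]|[J [u [v uv]]]].
  have lu (j : 'I_n) : linear (fun x => i x j) by move=> a x y; rewrite linearP !ffunE.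
  have lv (j : 'I_n) : linear (fun t => [ffun k => if k == j then t else 0] : {ffun 'I_n -> T}).
    move=> a x y; apply/ffunP => k; rewrite !ffunE.
    by case: eqP => // _; rewrite scaler0 addr0.
  exists 'I_n, (fun j => mklin (lu j)),
    (fun j => p \o mklin (lv j) : {linear T -> M}) => x.
  rewrite -[LHS]ip -linear_sum; congr (p _); apply/ffunP => k.
  rewrite sum_ffunE (bigD1 k) //= ffunE eqxx big1 ?addr0 // => j jk.
  by rewrite ffunE eq_sym (negbTE jk).
have li : linear (fun x => [ffun k : 'I_#|J| => u (enum_val k) x] : {ffun 'I_#|J| -> T}).
  by move=> a x y; apply/ffunP => k; rewrite !ffunE linearP.
have lp : linear (fun w : {ffun 'I_#|J| -> T} => \sum_k v (enum_val k) (w k)).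
  move=> a x y; rewrite scaler_sumr -big_split; apply: eq_bigr => k _ /=.
  by rewrite !ffunE linearP.
exists #|J|, (mklin li), (mklin lp) => x /=; rewrite [RHS](uv x).
rewrite [RHS](reindex_onto enum_val enum_rank) /=; last by move=> j _; rewrite enum_rankK.
by apply: eq_big => [k|k _]; [rewrite enum_valK eqxx | rewrite ffunE].
Qed.

Lemma in_add_refl T : in_add T T.
Proof.
apply/in_addP; exists 'I_1, (fun _ => idfun), (fun _ => idfun) => x.
by rewrite big_ord1.
Qed.

Lemma in_add_summand T M M' : direct_summand M M' -> in_add T M' -> in_add T M.
Proof. by move=> MM' [n h]; exists n; exact: direct_summand_trans MM' h. Qed.

Lemma in_add_trans T T' M : in_add T' T -> in_add T M -> in_add T' M.
Proof.
move=> /in_addP[J [u [v uv]]] /in_addP[I [u' [v' uv']]].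
apply/in_addP; exists (I * J)%type.
exists (fun k => (u k.2 \o u' k.1 : {linear M -> T'})).
exists (fun k => (v' k.1 \o v k.2 : {linear T' -> M})) => x.
rewrite [LHS](uv' x) -(pair_bigA _ (fun i j => v' i (v j (u j (u' i x))))) /=.
by apply: eq_bigr => i _; rewrite -linear_sum -uv.
Qed.

Lemma in_add_prod T A B : in_add T A -> in_add T B -> in_add T (A * B)%type.
Proof.
move=> /in_addP[J [u [v uv]]] /in_addP[I [u' [v' uv']]].
apply/in_addP; exists (J + I)%type.
exists (fun k => match k with
  | inl j => (u j \o fst : {linear (A * B)%type -> T})
  | inr i => (u' i \o snd : {linear (A * B)%type -> T}) end).
exists (fun k => match k with
  | inl j => (inl_lin A B \o v j : {linear T -> (A * B)%type})
  | inr i => (inr_lin A B \o v' i : {linear T -> (A * B)%type}) end).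
move=> [a b]; rewrite big_sumType /= -!(raddf_sum (inl_lin A B)) -!(raddf_sum (inr_lin A B)).
by rewrite -uv -uv'; congr pair; rewrite /= ?addr0 ?add0r.
Qed.

Lemma in_add_ind (Pr : lmodType R -> Prop) T :
  (forall A B, Pr A -> Pr B -> Pr (A * B)%type) ->
  (forall A B, direct_summand A B -> Pr B -> Pr A) ->
  Pr T -> forall M, in_add T M -> Pr M.
Proof.
move=> Pprod Psum PT M [n]; move=> /Psum; apply; elim: n => [|n IH].
  by apply: (Psum _ T) => //; apply: zero_summand => x; apply/ffunP => -[].
apply: Psum (Pprod _ _ PT IH).
have li : linear (fun w : {ffun 'I_n.+1 -> T} =>
    (w ord0, [ffun k => w (lift ord0 k)]) : (T * {ffun 'I_n -> T})%type).
  move=> a x y; congr pair; first by rewrite !ffunE.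
  by apply/ffunP => k; rewrite !ffunE.
have lp : linear (fun z : (T * {ffun 'I_n -> T})%type =>
    [ffun k => if unlift ord0 k is Some k' then z.2 k' else z.1] : {ffun 'I_n.+1 -> T}).
  by move=> a x y; apply/ffunP => k; rewrite !ffunE; case: unlift => [k'|]; rewrite ?ffunE.
exists (mklin li), (mklin lp) => w; apply/ffunP => k; rewrite ffunE.
by case: unliftP => [k' ->|->] /=; rewrite ?ffunE.
Qed.

(** A finite coresolution by [add T], cut into short exact sequences so that properties can be
    carried by induction from its right end to [M]. *)
Inductive cor T : lmodType R -> Prop :=
| cor_add M : in_add T M -> cor T M
| cor_step M C Z (i : {linear M -> C}) (p : {linear C -> Z}) :
    ses i p -> in_add T C -> cor T Z -> cor T M.

Lemma cor_mono T T' M : in_add T' T -> cor T M -> cor T' M.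
Proof.
move=> TT'; elim=> [M' h|M' C Z i p ip h _ IH]; first exact/cor_add/in_add_trans/h.
by apply: (cor_step ip) => //; exact: in_add_trans h.
Qed.

Lemma cor_of_coresolution T : add_coresolution T -> cor T R^o.
Proof.
case=> m [C [e [d [ei e0 ed addC zC]]]].
(* [Z] runs through the cocycles in [C n], and [k] counts the degrees left before the complex
   vanishes. *)
have main k : forall n Z (j : {linear Z -> C n}), (m <= n + k)%N -> injective j ->
    exact_at j (d n) -> cor T Z.
  elim: k => [|k IH] n Z j mn ji je.
    apply: cor_add; apply: in_add_summand (addC n).
    have js : surjective j by move=> y; apply/je; apply: zC; rewrite ltnS -[n]addn0.
    by have [g [h _]] := bij_inv (inj_surj_bij ji js); exists j, g.
  have [Z' [j' [ji' je']]] := sub_exists (submod_ker (d n.+1)).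
  have [x|q qE] := factor_inj (f := d n) ji'; first by apply/je'/ed; exists x.
  apply: (cor_step (p := q) (i := j)) (addC n) (IH n.+1 Z' j' _ ji' je').
    split=> // [z|x].
      have /ed[x xE] : d n.+1 (j' z) = 0 by apply/je'; exists z.
      by exists x; apply: ji'; rewrite qE.
    rewrite -je -qE; split=> [->|h]; first by rewrite linear0.
    by apply: ji'; rewrite h linear0.
  by rewrite addSnnS.
exact: (main m 0%N R^o e).
Qed.

Lemma coresolution_of_cor T M : cor T M ->
  exists (m : nat) (C : nat -> lmodType R) (e : {linear M -> C 0%N})
         (d : forall i, {linear C i -> C i.+1}),
  [/\ injective e, exact_at e (d 0%N), forall i, exact_at (d i) (d i.+1),
      forall i, in_add T (C i) & forall i, (m < i)%N -> is_zero (C i)].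
Proof.
have z0 : is_zero ({ffun 'I_0 -> T} : lmodType R) by move=> x; apply/ffunP => -[].
elim=> [{}M MT|{}M C0 Z i p ip C0T _ [m [C [e [d [ei e0 ed addC zC]]]]]].
  pose C n : lmodType R := if n is _.+1 then {ffun 'I_0 -> T} else M.
  pose d n : {linear C n -> C n.+1} := \0.
  exists 0%N, C, (idfun : {linear M -> M}), d; split=> [//|x|n x|[|n] //|[|n] // _].
  - by split=> _ //; exists x.
  - by split=> _ //; exists 0; rewrite [LHS]z0 [RHS]z0.
  - by exists 0%N; exact: direct_summand_refl.
pose D n : lmodType R := if n is n'.+1 then C n' else C0.
pose dd n : {linear D n -> D n.+1} :=
  match n with 0 => (e \o p : {linear C0 -> C 0%N}) | n'.+1 => d n' end.
exists m.+1, D, i, dd; split=> [|x|[|n]|[|n] //|[|n] //].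
- exact: ses_inj ip.
- split=> [ex|[a <-]]; last by rewrite /= (ses0 a ip) linear0.
  by apply: (ses_ex ip); apply: ei; rewrite linear0.
- move=> x; split=> [ex|[y <-]]; last by apply/e0; exists (p y).
  have [z <-] : exists z, e z = x by apply/e0.
  by have [y <-] := ses_surj ip z; exists y.
- exact: ed.
- exact: addC.
- by move=> mn; exact: zC mn.
Qed.

End Additive.

(** * The contravariant functors Hom(-, T) *)

Section TiltingDuality.
Variables (R S : pzRingType) (T : lmodType R) (phi : {rmorphism S -> endo T}).
Hypotheses (noethR : noeth R) (noethS : noeth S) (phi_bij : bijective phi).
Implicit Types A B C K M N P X Y Z : lmodType R.

Notation F X := (hom_mod phi X : lmodType S).
Notation bT := (bimod phi : lmodType S).

Definition happ X (h : F X) : {linear X -> T} := h.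

Lemma ev_linear X (x : X) : linear (fun h : F X => happ h x : bT).
Proof. by []. Qed.
Definition ev X (x : X) : {linear F X -> bT} := mklin (ev_linear x).

Definition is_ev X (x : X) (chi : {linear F X -> bT}) := forall h, chi h = happ h x.

Definition separated X := forall x : X, (forall h : {linear X -> T}, h x = 0) -> x = 0.

(** The last two conditions make evaluation from [X] to its double dual bijective. The first two are
    carried along because with them the class is stable under kernels and cokernels in sequences
    with Ext^1(C, T) = 0. *)
Definition good X := [/\ fpd (F X), perp (F X) bT,
  forall chi : {linear F X -> bT}, exists x, is_ev x chi & separated X].

Lemma hom_ses A B C (i : {linear A -> B}) (p : {linear B -> C}) :
  ses i p -> ext1 C T -> ses (hom_map phi p) (hom_map phi i).
Proof.
move=> ip HC; split.
- move=> f g /(congr1 (@happ B)) e; apply: linear_ext => c.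
  have [b <-] := ses_surj ip c.
  exact: (congr1 (fun h : {linear B -> T} => h b) e).
- move=> f; have [g gP] := HC _ _ _ _ (happ f) ip.
  by exists g; apply: linear_ext => a; exact: gP.
- move=> f; split=> [e|[g <-]].
    have [|g gP] := @factor_surj _ _ _ _ p (happ f) (ses_surj ip).
      move=> b /(ses_ex ip)[a <-].
      exact: (congr1 (fun h : {linear A -> T} => h a) e).
    by exists g; apply: linear_ext => b; exact: gP.
  by apply: linear_ext => a; rewrite /= (ses0 a ip) linear0.
Qed.

Lemma hom_prodE A B (h : F (A * B)%type) :
  h = hom_map phi (fst : {linear (A * B)%type -> A}) (hom_map phi (inl_lin A B) h)
    + hom_map phi (snd : {linear (A * B)%type -> B}) (hom_map phi (inr_lin A B) h).
Proof.
apply: linear_ext => -[x y]; rewrite /= -[RHS](linearD (happ h)).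
by congr (happ h _); congr pair; rewrite /= ?addr0 ?add0r.
Qed.

Lemma hom_prod_summand A B : direct_summand (F (A * B)%type) (F A * F B)%type.
Proof.
exists (linpair (hom_map phi (inl_lin A B)) (hom_map phi (inr_lin A B))).
exists (lincopair (hom_map phi (fst : {linear (A * B)%type -> A}))
                  (hom_map phi (snd : {linear (A * B)%type -> B}))) => h.
by rewrite [RHS]hom_prodE.
Qed.

Lemma good_prod A B : good A -> good B -> good (A * B)%type.
Proof.
move=> [fA pA dA sA] [fB pB dB sB]; have sumF := hom_prod_summand A B.
split.
- exact: fpd_summand sumF (fpd_prod noethS fA fB).
- apply: (perp_summand noethS _ sumF); first exact: fin_gen_prod (proj1 fA) (proj1 fB).
  have [u [v uv]] := ses_prod (F A) (F B).
  exact: (perp_middle noethS uv (fin_gen_prod (proj1 fA) (proj1 fB))).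
- move=> chi.
  have [a aP] := dA (chi \o hom_map phi (fst : {linear (A * B)%type -> A}) : {linear F A -> bT}).
  have [b bP] := dB (chi \o hom_map phi (snd : {linear (A * B)%type -> B}) : {linear F B -> bT}).
  exists (a, b) => h.
  rewrite [h in LHS]hom_prodE [h in RHS]hom_prodE.
  rewrite linearD; congr (_ + _).
    by have := aP (hom_map phi (inl_lin A B) h).
  by have := bP (hom_map phi (inr_lin A B) h).
- move=> [a b] H; congr pair.
    by apply: sA => h; exact: (H (h \o fst : {linear (A * B)%type -> T})).
  by apply: sB => h; exact: (H (h \o snd : {linear (A * B)%type -> T})).
Qed.

Lemma good_summand A B : direct_summand A B -> good B -> good A.
Proof.
move=> [i [p ip]] [fB pB dB sB].
have sumF : direct_summand (F A) (F B).
  by exists (hom_map phi p), (hom_map phi i) => h; apply: linear_ext => a /=; rewrite ip.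
split.
- exact: fpd_summand sumF fB.
- exact: (perp_summand noethS (proj1 fB) sumF).
- move=> chi; have [b bP] := dB (chi \o hom_map phi i : {linear F B -> bT}).
  exists (p b) => h; rewrite -[RHS]/(happ (hom_map phi p h) b) -bP /=.
  by congr (chi _); apply: linear_ext => a /=; rewrite ip.
- move=> a H; apply: (can_inj ip); rewrite linear0; apply: sB => h.
  exact: (H (h \o i : {linear A -> T})).
Qed.

Lemma good_kernel A B C (i : {linear A -> B}) (p : {linear B -> C}) :
  ses i p -> ext1 C T -> good B -> good C -> good A.
Proof.
move=> ip HC [fB pB dB sB] [fC pC dC sC]; have sF := hom_ses ip HC.
split.
- exact: (fpd_right noethS sF).
(* A map from [F C] to the bimodule is evaluation at some [c], so evaluation at a preimage of [c] in
   [B] extends it to [F B]. *)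
- apply: (perp_right noethS sF (proj1 fB)) => // f.
  have [c cP] := dC f; have [b bE] := ses_surj ip c.
  by exists (ev b) => h; rewrite cP -bE.
- move=> chi; have [b bP] := dB (chi \o hom_map phi i : {linear F B -> bT}).
  (* [chi] pulled back to [F B] is evaluation at [b] and vanishes on [F C], so every map from [C] to
     [T] kills [p b]. *)
  have pb : p b = 0.
    apply: sC => h; rewrite -[LHS]/(happ (hom_map phi p h) b) -bP /= (_ : hom_map_fun _ _ = 0) ?linear0 //.
    by apply: linear_ext => a; rewrite /= (ses0 a ip) linear0.
  have [a aE] := ses_ex ip pb; exists a => f.
  have [g <-] := ses_surj sF f.
  by rewrite -[RHS]/(happ g (i a)) aE -bP.
- move=> a H; apply: (ses_inj ip); rewrite linear0; apply: sB => h.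
  exact: (H (h \o i : {linear A -> T})).
Qed.

Lemma good_coker A B C (i : {linear A -> B}) (p : {linear B -> C}) :
  ses i p -> ext1 C T -> good A -> good B -> good C.
Proof.
move=> ip HC [fA pA dA sA] [fB pB dB sB]; have sF := hom_ses ip HC.
split.
- exact: (fpd_left noethS sF).
- exact: (perp_left noethS sF (proj1 fB)).
- move=> chi; have [psi psiP] := pA 0%N _ _ _ _ chi sF.
  have [b bP] := dB psi; exists (p b) => h.
  by rewrite -psiP bP.
- move=> c H; have [b bE] := ses_surj ip c; subst c.
  (* If all maps [C -> T] kill [p b], evaluation at [b] vanishes on the image of [F C], hence is a
     functional on [F A], hence evaluation at some [a]. Then no map to [T] distinguishes [b] from
     [i a]. *)
  have [|chi chiP] := @factor_surj _ _ _ _ (hom_map phi i) (ev b) (ses_surj sF).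
    by move=> g /(ses_ex sF)[h <-]; exact: H.
  have [a aP] := dA chi.
  have -> : b = i a.
    apply: subr0_eq; apply: sB => g; rewrite linearB.
    have e : chi (hom_map phi i g) = happ g b by rewrite chiP.
    by rewrite -[g b]/(happ g b) -e aP subrr.
  exact: ses0 ip.
Qed.

(** [F T] is free over [S] with basis the identity, so a functional on it is determined by its value
    there. *)
Lemma good_self : good T.
Proof.
have lS : linear (fun s : S^o => phi s : F T).
  by move=> a s t; rewrite rmorphD (rmorphM phi (a : S) s).
have [psi phiK psiK] := phi_bij.
have [g [gK Kg]] := @bij_inv S S^o (F T) (mklin lS) phi_bij.
have fFT : fgproj (F T).
  by apply: fgproj_summand (fgproj_regular S); exists g, (mklin lS).
split.
- exact: fpd_proj.
- exact: perp_proj (proj2 fFT).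
- move=> chi; exists (chi (idfun : {linear T -> T})) => h.
  have -> : h = psi h *: ((idfun : {linear T -> T}) : F T).
    by apply: linear_ext => t; rewrite -[h in LHS](psiK h).
  by rewrite linearZ.
- by move=> x /(_ idfun).
Qed.

Lemma good_add X M : good X -> in_add X M -> good M.
Proof.
move=> gX; apply: in_add_ind => //; [exact: good_prod | exact: good_summand].
Qed.

Hypotheses (fT : fin_gen T) (pT : perp T T).

Lemma in_add_fin_gen M : in_add T M -> fin_gen M.
Proof.
apply: in_add_ind => // [A B|A B]; [exact: fin_gen_prod | exact: fin_gen_summand].
Qed.

Lemma in_add_perp M : in_add T M -> perp M T.
Proof.
move=> MT; have [] : fin_gen M /\ perp M T; last by [].
move: M MT; apply: in_add_ind => // [A B [fA pA] [fB pB]|A B AB [fB pB]].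
  have [u [v uv]] := ses_prod A B; split; first exact: fin_gen_prod.
  by apply: (perp_middle noethR uv) => //; exact: fin_gen_prod.
by split; [exact: fin_gen_summand AB fB | apply: (perp_summand noethR fB AB)].
Qed.

Lemma cor_good M : cor T M -> perp M T /\ good M.
Proof.
elim=> [{}M MT|{}M C Z i p ip CT _ [pZ gZ]].
  by split; [exact: in_add_perp | exact: good_add good_self MT].
split.
  exact: (perp_left noethR ip (in_add_fin_gen CT) (in_add_perp CT) pZ).
exact: (good_kernel ip (pZ 0%N) (good_add good_self CT) gZ).
Qed.

Hypothesis corT : cor T R^o.

Lemma good_proj P : fgproj P -> good P.
Proof.
have [_ gR] := cor_good corT; move=> /fgproj_in_add; exact: good_add gR.
Qed.

(** Induction on the projective dimension: [good_coker] passes from the syzygy and the projective to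
    [X], and projectives are good through the coresolution of the ring. *)
Lemma good_perp X : fpd X -> perp X T -> good X.
Proof.
case=> fX [n Hn]; elim: n X fX Hn => [|n IH] X fX Hn pX.
  by apply: good_proj; exact: projective_of_ext1.
have [K [P [j [p [jp fP]]]]] := fgproj_cover fX.
have fK := noethR (proj1 fP) (ses_inj jp).
apply: (good_coker jp (pX 0%N)); last exact: good_proj.
apply: IH => // [N|]; first exact: Hn jp fP.
apply: (perp_left noethR jp (proj1 fP)) => //; exact: perp_proj (proj2 fP).
Qed.

Lemma hom_regular_summand : direct_summand bT (F R^o).
Proof.
have l1 : linear (fun t : bT => (scale_to (t : T) : {linear R^o -> T}) : F R^o).
  move=> s t u; apply: linear_ext => r /=.
  by rewrite /scale_to /= scalerDr -[X in X + _]linearZ.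
have l2 : linear (fun h : F R^o => happ h 1 : bT) by [].
by exists (mklin l1), (mklin l2) => t; exact: (scale1r (t : T)).
Qed.

Lemma bimod_fpd : fpd bT.
Proof.
by have [_ [h _ _ _]] := cor_good corT; exact: fpd_summand hom_regular_summand h.
Qed.

Lemma bimod_perp : perp bT bT.
Proof.
have [_ [h h' _ _]] := cor_good corT.
exact: (perp_summand noethS (proj1 h) hom_regular_summand h').
Qed.

(** Double centraliser property: an [S]-endomorphism [g] defines the functional sending [h] to
    [g (h 1)] on Hom(R, T), and goodness of the regular module makes it evaluation at some [r]. *)
Lemma lact_bij : bijective (lact phi).
Proof.
have [_ [_ _ dR sR]] := cor_good corT.
have inj : injective (lact phi).
  apply: (@raddf_inj _ _ (lact phi)) => r e; apply: sR => h.
  have := congr1 (fun g : {linear bT -> bT} => g (h 1)) e.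
  by rewrite /= -linearZ => h0; rewrite -[RHS]h0; congr (h _); rewrite -[LHS](mulr1 r).
have surj g : exists r, lact phi r = g.
  have lg : linear (fun h : F R^o => (g : {linear bT -> bT}) (happ h 1) : bT).
    by move=> a x y; rewrite -linearP.
  have [r rP] := dR (mklin lg); exists r; apply: linear_ext => t.
  by have := rP (scale_to (t : T)) => /= <-; rewrite /happ /= scale1r.
have [f fP] := choice surj; exists f => // r; exact: inj.
Qed.

(** Apply [F] to a finite projective resolution of [T]. Self-orthogonality keeps it exact, each
    Hom(P, T) lies in [add] of the bimodule, and the left end is Hom(T, T), that is [S]. *)
Lemma bimod_cor : fpd T -> cor bT S^o.
Proof.
move=> fpT; have /(fin_proj_dimE noethR)[_ [n [Q zQ]]] := fpT.
have HT i := @extn_ext_succ R i T T (pT i) Q.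
apply: cor_of_coresolution; exists n, (fun i => F (Q i)).
have le : linear (fun s : S^o => (phi s : {linear T -> T}) \o res_aug Q : F (Q 0%N)).
  by move=> a s t; apply: linear_ext => x; rewrite /= rmorphD (rmorphM phi (a : S) s).
have [psi phiK psiK] := phi_bij.
exists (mklin le), (fun i => hom_map phi (res_d Q i)); split.
- apply: inj0 => s e; apply: (can_inj phiK); rewrite rmorph0.
  apply: linear_ext => t; have [x <-] := @res_aug_surj _ _ Q t.
  exact: (congr1 (fun g : {linear Q 0%N -> T} => g x) e).
- move=> f; split=> [e|[s <-]].
    have [|g gP] := @factor_surj _ _ _ _ (res_aug Q) (happ f) (@res_aug_surj _ _ Q).
      move=> x /(@res_exact0 _ _ Q)[y <-].
      exact: (congr1 (fun g : {linear Q 1%N -> T} => g y) e).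
    exists (psi g); apply: linear_ext => x; rewrite /= psiK; exact: gP.
  apply: linear_ext => x; rewrite /= (_ : res_aug Q _ = 0) ?linear0 //.
  by apply/(@res_exact0 _ _ Q); exists x.
- move=> i f; split=> [e|[g <-]].
    have [|g gP] := HT i (happ f).
      move=> x; exact: (congr1 (fun g : {linear Q i.+2 -> T} => g x) e).
    by exists g; apply: linear_ext => x; rewrite gP.
  apply: linear_ext => x; rewrite /= (_ : res_d Q i _ = 0) ?linear0 //.
  by apply/(@res_exact _ _ Q i); exists x.
- move=> i; have /fgproj_in_add := res_fgproj Q i.
  apply: (@in_add_ind R (fun P => in_add bT (F P)) R^o) => [A B hA hB|A B AB hB|].
  + by apply: in_add_summand (in_add_prod hA hB); exact: hom_prod_summand.
  + apply: in_add_summand hB; case: AB => [a [p ap]].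
    by exists (hom_map phi p), (hom_map phi a) => h; apply: linear_ext => x /=; rewrite ap.
  + apply: in_add_summand (in_add_refl bT).
    have l1 : linear (fun t : bT => (scale_to (t : T) : {linear R^o -> T}) : F R^o).
      move=> s t u; apply: linear_ext => r /=.
      by rewrite /scale_to /= scalerDr -[X in X + _]linearZ.
    have l2 : linear (fun h : F R^o => happ h 1 : bT) by [].
    exists (mklin l2), (mklin l1) => h; apply: linear_ext => r.
    by rewrite /= -linearZ; congr (happ h _); exact: mulr1.
- move=> i /zQ z; move=> f; apply: linear_ext => x.
  by rewrite (z x) !linear0.
Qed.

End TiltingDuality.

(** * Strong tilting modules *)

Section Strong.
Variable R : pzRingType.
Hypothesis noethR : noeth R.
Implicit Types M N K P T X Y : lmodType R.

Lemma in_add_fpd T M : fpd T -> in_add T M -> fpd M.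
Proof.
move=> fT; move: M; apply: in_add_ind => // [A B|A B].
  exact: fpd_prod.
exact: fpd_summand.
Qed.

Lemma fpd_power T n : fpd T -> fpd ({ffun 'I_n -> T} : lmodType R).
Proof. by move=> fT; apply: (in_add_fpd fT); exists n; exact: direct_summand_refl. Qed.

Definition strong T := [/\ fpd T, cor T R^o & forall M, fpd M -> perp M T].

Lemma strongP T : strong_tilting T <-> strong T.
Proof.
split=> [[[fT pT cT] sT]|[fT cT sT]].
  split=> [||M fM]; [exact/(fin_proj_dimE noethR) | exact: cor_of_coresolution |].
  by apply/(ext_succ_perp noethR _ (proj1 fM)); apply: sT; exact/(fin_proj_dimE noethR).
split=> [|M /(fin_proj_dimE noethR) fM n]; last by apply: extn_ext_succ; exact: sT.
split; first exact/(fin_proj_dimE noethR).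
  by move=> n; apply: extn_ext_succ; exact: sT.
have [m [C [e [d H]]]] := coresolution_of_cor cT; by exists m, C, e, d.
Qed.

(** A nonzero cyclic quotient, instead of a simple one, is enough later. Generators are absorbed
    into [W] one at a time while the result stays proper; the first one that would fill [M] is
    [h]. *)
Lemma fin_gen_cosimple M (W : M -> Prop) : fin_gen M -> submod W -> (exists m, ~ W m) ->
  exists (W' : M -> Prop) (h : M), [/\ submod W', forall m, W m -> W' m, ~ W' h &
    forall m, exists w s, W' w /\ m = w + s *: h].
Proof.
case=> n [g gP] HW nW.
have {gP}gP m : exists w c, W w /\ m = w + \sum_(i < n) c i *: g i.
  by have [c ->] := gP m; exists 0, c; rewrite add0r; split=> //; case: HW.
elim: n g W HW nW gP => [|n IH] g W HW [m nWm] gP.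
  by have [w [c [Ww]]] := gP m; rewrite big_ord0 addr0 => e; case: nWm; rewrite e.
pose W1 m := exists w s, W w /\ m = w + s *: g ord0.
have HW1 : submod W1.
  split=> [|a _ _ [w [s [Ww ->]]] [w' [s' [Ww' ->]]]].
    by exists 0, 0; rewrite scale0r addr0; split=> //; case: HW.
  exists (a *: w + w'), (a * s + s'); split; first by case: HW => _; apply.
  by rewrite scalerDr scalerDl scalerA addrACA.
have [allW1|] := pselect (forall m, W1 m).
  exists W, (g ord0); split=> // Wg; case: nWm.
  by have [w [s [Ww ->]]] := allW1 m; apply: (submodD HW Ww); exact: submodZ HW Wg.
move=> /existsNP nW1.
have [m'|W' [h [HW' WW' nh hP]]] := IH (fun i => g (lift ord0 i)) W1 HW1 nW1.
  have [w [c [Ww ->]]] := gP m'; exists (w + c ord0 *: g ord0), (fun i => c (lift ord0 i)).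
  by split; [exists w, (c ord0) | rewrite big_ord_recl addrA].
exists W', h; split=> // x Wx; apply: WW'; exists x, 0.
by rewrite scale0r addr0.
Qed.

Lemma fin_gen_submod (I : R -> Prop) : submod (I : R^o -> Prop) ->
  exists n (y : 'I_n -> R), (forall j, I (y j)) /\
    forall s, I s -> exists c : 'I_n -> R, s = \sum_j c j * y j.
Proof.
move=> HI; have [K [i [ii iP]]] := sub_exists HI.
have [n [g gP]] := noethR (proj1 (fgproj_regular R)) ii.
exists n, (fun j => i (g j)); split=> [j|s /iP[k <-]]; first by apply/iP; exists (g j).
have [c ->] := gP k; exists c; rewrite linear_sum; apply: eq_bigr => j _.
by rewrite linearZ.
Qed.

End Strong.

(** * The splitting criterion for strongness *)

Section Criterion.
Variables (R S : pzRingType) (T : lmodType R) (phi : {rmorphism S -> endo T}).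
Hypotheses (noethR : noeth R) (noethS : noeth S) (phi_bij : bijective phi).

(* Every embedding of T in a finite power of T splits; equivalently, every
   nonzero finitely generated S-module has a nonzero homomorphism to T. *)
Definition embeddings_split := forall n (y : 'I_n -> S),
  (forall t : T, (forall j, (phi (y j) : {linear T -> T}) t = 0) -> t = 0) ->
  exists z : 'I_n -> S, \sum_j z j * y j = 1.

Lemma strong_embeddings_split : strong T -> embeddings_split.
Proof.
move=> [fT _ sT] n y y0.
have lu : linear (fun t => [ffun j => (phi (y j) : {linear T -> T}) t] : {ffun 'I_n -> T}).
  by move=> a s t; apply/ffunP => j; rewrite !ffunE linearP.
have ui : injective (mklin lu).
  by apply: inj0 => t /ffunP ut; apply: y0 => j; have := ut j; rewrite !ffunE.
have [C [p up]] := ses_coker ui.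
have fTn : fpd ({ffun 'I_n -> T} : lmodType R).
  exact: fpd_power.
have fC := fpd_right noethR up fT fTn.
have [g gP] := sT C fC 0%N _ _ _ _ (idfun : {linear T -> T}) up.
have li (j : 'I_n) : linear (fun t => [ffun k => if k == j then t else 0] : {ffun 'I_n -> T}).
  move=> a s t; apply/ffunP => k; rewrite !ffunE.
  by case: eqP => // _; rewrite scaler0 addr0.
have [psi phiK psiK] := phi_bij.
(* [z j] is the [j]-th component of the retraction [g] of the embedding of [T] given by the
   [y j]. *)
exists (fun j => psi (g \o mklin (li j) : {linear T -> T})).
apply: (can_inj phiK); rewrite rmorph1 rmorph_sum /=; apply: linear_ext => t.
transitivity (g (mklin lu t)); last exact: gP.
have -> : mklin lu t = \sum_j mklin (li j) ((phi (y j) : {linear T -> T}) t).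
  apply/ffunP => k; rewrite sum_ffunE (bigD1 k) //= !ffunE eqxx big1 ?addr0 // => j jk.
  by rewrite ffunE eq_sym (negbTE jk).
rewrite linear_sum.
have sumE (E : 'I_n -> endo T) : (\sum_j E j : {linear T -> T}) t = \sum_j (E j : {linear T -> T}) t.
  by elim/big_rec2: _ => // j x f _ <-.
rewrite sumE; apply: eq_bigr => j _.
by rewrite rmorphM psiK.
Qed.

Hypotheses (fT : fpd T) (pT : perp T T) (cT : cor T R^o).

(** If restriction from [F P] to [F K] were not onto, its cokernel would map nontrivially to [T]: it
    has a nonzero cyclic quotient [S / I], and by [embeddings_split] the proper, finitely generated
    left ideal [I] kills some [t <> 0]. Goodness of [K] and [P] excludes such a map. *)
Lemma embeddings_split_onto (K P X : lmodType R) (j : {linear K -> P}) (p : {linear P -> X}) :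
  embeddings_split -> ses j p -> good phi K -> good phi P ->
  forall f : {linear K -> T}, exists g : {linear P -> T}, forall a, g (j a) = f a.
Proof.
move=> spl jp [fFK _ dK _] [_ _ _ sP] f; apply: contrapT => nf.
pose W : hom_mod phi K -> Prop := fun f => exists g, hom_map phi j g = f.
have HW : submod W := submod_im _.
have [|W' [h [HW' WW' nh hP]]] := fin_gen_cosimple (proj1 fFK) HW.
  exists f => -[g gf]; apply: nf; exists g => a.
  exact: (congr1 (fun h : {linear K -> T} => h a) gf).
pose I (s : S) := W' (s *: h).
have HI : submod (I : S^o -> Prop).
  split=> [|a s t Is It]; rewrite /I; first by rewrite scale0r; case: HW'.
  by rewrite scalerDl -scalerA; case: HW' => _; apply.
have [n [y [Iy Igen]]] := fin_gen_submod noethS HI.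
have nz : ~ exists z : 'I_n -> S, \sum_j z j * y j = 1.
  case=> z z1; apply: nh; rewrite -[h]scale1r -z1 scaler_suml.
  apply: (@submod_sum _ _ W' _ (index_enum _) xpredT (fun k => (z k * y k) *: h)) => // k _.
  by rewrite -scalerA; exact: (submodZ _ HW' (Iy k)).
have [t ty t0] : exists2 t : T, (forall k, (phi (y k) : {linear T -> T}) t = 0) & t <> 0.
  apply: contrapT => nt; apply: nz; apply: spl => t ty.
  by apply: contrapT => t0; apply: nt; exists t.
have It s : I s -> (phi s : {linear T -> T}) t = 0.
  move=> /Igen[c ->]; rewrite rmorph_sum /=.
  have sumE (E : 'I_n -> endo T) : (\sum_j E j : {linear T -> T}) t = \sum_j (E j : {linear T -> T}) t.
    by elim/big_rec2: _ => // k x g _ <-.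
  by rewrite sumE big1 // => k _; rewrite rmorphM /= ty linear0.
have [chi chiP] : exists chi : {linear hom_mod phi K -> bimod phi}, forall m, exists w s,
    [/\ W' w, m = w + s *: h & chi m = (phi s : {linear T -> T}) t].
  apply: (@linear_of_rel S (hom_mod phi K) (bimod phi) (fun m v => exists w s,
    [/\ W' w, m = w + s *: h & v = (phi s : {linear T -> T}) t])).
  - by move=> m; have [w [s [Ww ->]]] := hP m; exists ((phi s : {linear T -> T}) t), w, s.
  - move=> a _ _ _ _ [w [s [Ww -> ->]]] [w' [s' [Ww' -> ->]]].
    exists (a *: w + w'), (a * s + s'); split; first by case: HW' => _; apply.
      by rewrite scalerDr scalerDl scalerA addrACA.
    by rewrite rmorphD rmorphM.
  - move=> _ [w [s [Ww e ->]]]; apply: It; rewrite /I.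
    have -> : s *: h = - w by apply/eqP; rewrite -addr_eq0 addrC -e.
    exact: submodN HW' Ww.
have [x xP] := dK chi.
have x0 : x = 0.
  apply: (ses_inj jp); rewrite linear0; apply: sP => g.
  transitivity (happ (hom_map phi j g) x) => //; rewrite -xP.
  have [w [s [Ww e ->]]] := chiP (hom_map phi j g); apply: It; rewrite /I.
  have -> : s *: h = hom_map phi j g - w by rewrite e addrC addKr.
  by apply: (submodB HW' _ Ww); apply: WW'; exists g.
apply: t0; have : chi h = 0 by rewrite xP x0 linear0.
have [w [s [Ww e ->]]] := chiP h => e2.
(* From [h = w + s *: h] with [w] in [W'], the element [1 - s] lies in [I] and kills [t]; since [s]
   kills [t] as well, [t = 0]. *)
have : (phi (1 - s) : {linear T -> T}) t = 0.
  apply: It; rewrite /I scalerBl scale1r {1}e addrK //.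
by rewrite rmorphB rmorph1 /= => /eqP; rewrite e2 subr0 => /eqP.
Qed.

Lemma strong_of_embeddings_split : embeddings_split -> strong T.
Proof.
move=> spl; split=> // X [fX [n Hn]]; elim: n X fX Hn => [|n IH] X fX Hn.
  by apply: perp_proj; exact: (proj2 (projective_of_ext1 fX Hn)).
have [K [P [j [p [jp fP]]]]] := fgproj_cover fX.
have fK := noethR (proj1 fP) (ses_inj jp).
have HK : pd_le n K by move=> N; exact: Hn jp fP.
have pK := IH K fK HK.
have gK : good phi K.
  by apply: (good_perp noethR noethS phi_bij (proj1 fT) pT cT) => //; split=> //; exists n.
have gP : good phi P.
  exact: (good_proj noethR noethS phi_bij (proj1 fT) pT cT).
apply: (perp_right noethR jp (proj1 fP) pK); first exact: perp_proj (proj2 fP).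
exact: embeddings_split_onto jp gK gP.
Qed.

End Criterion.

(** * Consequences of strongness: duality, embeddings in powers of T *)

Section Duality.
Variables (R S : pzRingType) (T : lmodType R) (phi : {rmorphism S -> endo T}).
Hypotheses (noethR : noeth R) (noethS : noeth S) (phi_bij : bijective phi).
Hypothesis sT : strong T.

Lemma strong_good (X : lmodType R) : fpd X -> good phi X.
Proof.
case: sT => fT cT pT fX.
exact: (good_perp noethR noethS phi_bij (proj1 fT) (pT _ fT) cT fX (pT _ fX)).
Qed.

Lemma strong_lact_bij : bijective (lact phi).
Proof.
by case: sT => fT cT pT; exact: (lact_bij noethR noethS phi_bij (proj1 fT) (pT _ fT) cT).
Qed.

Lemma bimod_strong : embeddings_split (lact phi) -> strong (bimod phi).
Proof.
case: sT => fT cT pT.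
have pTT := pT _ fT; have fgT := proj1 fT.
apply: (strong_of_embeddings_split noethS noethR strong_lact_bij).
- exact: (bimod_fpd noethR noethS phi_bij fgT pTT cT).
- exact: (bimod_perp noethR noethS phi_bij fgT pTT cT).
- exact: (bimod_cor noethR phi_bij pTT fT).
Qed.

(** Finitely many generators of Hom(X, T) over [S] already separate the points of [X]. *)
Lemma strong_embedding (X : lmodType R) : fpd X -> exists n (u : {linear X -> {ffun 'I_n -> T}}), injective u.
Proof.
move=> fX; have [[[n [g gP]] _] _ _ sX] := strong_good fX.
have lu : linear (fun x => [ffun j => happ (g j) x] : {ffun 'I_n -> T}).
  by move=> a s t; apply/ffunP => j; rewrite !ffunE linearP.
exists n, (mklin lu); apply: inj0 => x /ffunP ux; apply: sX => h.
have [c hE] := gP h; have -> : h x = happ (\sum_i c i *: g i) x by rewrite -hE.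
have sumE (E : 'I_n -> hom_mod phi X) : happ (\sum_j E j) x = \sum_j happ (E j) x.
  by elim/big_rec2: _ => // k y f _ <-.
rewrite sumE big1 // => k _ /=.
by have := ux k; rewrite !ffunE /happ /= => ->; rewrite linear0.
Qed.

(** The cokernel of an embedding of [X] in a power of [T] has finite projective dimension, so the
    embedding splits. Applied in both directions, this shows that two strong tilting modules have
    the same additive closure. *)
Lemma strong_in_add (X : lmodType R) : fpd X -> (forall M, fpd M -> ext1 M X) -> in_add T X.
Proof.
move=> fX eX; have [n [u ui]] := strong_embedding fX.
have [C [p up]] := ses_coker ui.
have fTn : fpd ({ffun 'I_n -> T} : lmodType R).
  by case: sT => fT _ _; exact: fpd_power.
have fC := fpd_right noethR up fX fTn.
have [r rP] := eX C fC _ _ _ _ (idfun : {linear X -> X}) up.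
by exists n, u, r.
Qed.

Hypothesis sbT : strong (bimod phi).

Lemma strong_duality : hom_duality phi (@fin_proj_dim R) (@fin_proj_dim S).
Proof.
have gX := strong_good.
have gY : forall Y : lmodType S, fpd Y -> good (lact phi) Y.
  case: sbT => fT cT pT Y fY.
  exact: (good_perp noethS noethR strong_lact_bij (proj1 fT) (pT _ fT) cT fY (pT _ fY)).
split.
- by move=> X /(fin_proj_dimE noethR)/gX[h _ _ _]; exact/(fin_proj_dimE noethS).
- by move=> Y /(fin_proj_dimE noethS)/gY[h _ _ _]; exact/(fin_proj_dimE noethR).
- have leta (X : lmodType R) : linear (fun x : X => (ev phi x : hom_mod (lact phi) (hom_mod phi X))).
    by move=> a x y; apply: linear_ext => h; exact: (linearP (happ h)).
  exists (fun X _ => mklin (leta X)); split=> [X|X X' _ _ f x]; last exact: linear_ext.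
  move=> /(fin_proj_dimE noethR)/gX[_ _ dX sX]; apply: inj_surj_bij.
    apply: inj0 => x e; apply: sX => h.
    exact: (congr1 (fun g : {linear hom_mod phi X -> bimod phi} => g h) e).
  by move=> chi; have [x xP] := dX chi; exists x; apply: linear_ext => h; rewrite xP.
- have leps0 (Y : lmodType S) (y : Y) : linear (fun h : hom_mod (lact phi) Y => (happ h y : T)) by [].
  have leps (Y : lmodType S) : linear (fun y : Y =>
      (mklin (leps0 Y y) : hom_mod phi (hom_mod (lact phi) Y))).
    by move=> a x y; apply: linear_ext => h; exact: (linearP (happ h)).
  exists (fun Y _ => mklin (leps Y)); split=> [Y|Y Y' _ _ f y]; last exact: linear_ext.
  move=> /(fin_proj_dimE noethS)/gY[_ _ dY sY]; apply: inj_surj_bij.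
    apply: inj0 => y e; apply: sY => h.
    exact: (congr1 (fun g : {linear hom_mod (lact phi) Y -> T} => g h) e).
  move=> chi.
  (* [T] and [bimod (lact phi)] carry the same action of [R]; [chi] is only retyped so that goodness
     of [Y] over [S] applies. *)
  have lchi : linear (fun h : hom_mod (lact phi) Y =>
      ((chi : {linear hom_mod (lact phi) Y -> T}) h : bimod (lact phi))).
    by move=> a g h; exact: (linearP (chi : {linear hom_mod (lact phi) Y -> T})).
  have [y yP] := dY (mklin lchi); exists y; apply: linear_ext => h.
  by have := yP h => /= ->.
Qed.

End Duality.

Section TwoSteps.
Variables (R0 R1 R2 : pzRingType) (T0 : lmodType R0) (T1 : lmodType R1).
Variables (phi0 : {rmorphism R1 -> endo T0}) (phi1 : {rmorphism R2 -> endo T1}).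
Hypotheses (noeth0 : noeth R0) (noeth1 : noeth R1) (noeth2 : noeth R2).
Hypotheses (bij0 : bijective phi0) (bij1 : bijective phi1).
Hypotheses (s0 : strong T0) (s1 : strong T1).

(** Elements of [R1] without common zero in [T1] have none in [T0]: maps [T0 -> T1] over [R1] send
    common zeros to common zeros and separate the points of [T0]. The criterion for [T0] over [R0]
    then gives the combination equal to 1. *)
Lemma strong_step : strong (bimod phi1).
Proof.
apply: (bimod_strong noeth1 noeth2 bij1 s1) => n y y0.
apply: (strong_embeddings_split noeth0 bij0 s0) => t ty.
have fT0 : fpd (bimod phi0).
  case: s0 => fT cT pT.
  exact: (bimod_fpd noeth0 noeth1 bij0 (proj1 fT) (pT _ fT) cT).
have [_ _ _ sT0] := strong_good noeth1 noeth2 bij1 s1 fT0.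
apply: sT0 => h; apply: y0 => j.
by rewrite /= -linearZ /= [X in h X]ty linear0.
Qed.

End TwoSteps.

(** * Artinian rings are noetherian *)

Section Zorn.
Variables (R : pzRingType) (M : lmodType R).

Definition subm (A B : M -> Prop) := forall x, A x -> B x.

(** With [x = 1] in the regular module this yields maximal left ideals; other [x] serve to find a
    maximal proper part of an ideal in the finite length argument for [k]. *)
Lemma submod_avoiding (N : M -> Prop) (x : M) : submod N -> ~ N x ->
  exists N' : M -> Prop, [/\ submod N', subm N N', ~ N' x &
    forall N'', submod N'' -> subm N' N'' -> ~ N'' x -> subm N'' N'].
Proof.
move=> HN Nx.
pose E := {N' : M -> Prop | [/\ submod N', subm N N' & ~ N' x]}.
have EP (A : E) := proj2_sig A.
have [||C totC|[N' [HN' NN' nN'x]] maxN'] :=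
  @classical_sets.ZL_preorder E (exist _ N (And3 HN (fun _ h => h) Nx))
    (fun A B => `[< subm (sval A) (sval B) >]).
- by move=> A; apply/asboolP.
- by move=> A B D /asboolP BA /asboolP AD; apply/asboolP => y /BA /AD.
- have [[A0 CA0]|C0] := pselect (exists A, C A); last first.
    by exists (exist _ N (And3 HN (fun _ h => h) Nx)) => A CA; case: C0; exists A.
  pose U y := exists2 A : E, C A & sval A y.
  have HU : [/\ submod U, subm N U & ~ U x].
    split; last by case=> A _; case: (EP A).
      split; first by exists A0 => //; case: (EP A0) => -[].
      move=> a y z [A CA Ay] [B CB Bz].
      have [/asboolP AB|/asboolP BA] := totC _ _ CA CB.
        by exists B => //; case: (EP B) => -[_ HB] _ _; apply: HB => //; exact: AB.
      by exists A => //; case: (EP A) => -[_ HA] _ _; apply: HA => //; exact: BA.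
    by move=> y Ny; exists A0 => //; case: (EP A0) => _ + _; apply.
  by exists (exist _ U HU) => A CA; apply/asboolP => y Ay; exists A.
exists N'; split=> // N'' HN'' N'N'' nN''x.
have H : [/\ submod N'', subm N N'' & ~ N'' x] by split=> // y /NN' /N'N''.
have /asboolP := maxN' (exist _ N'' H) (asboolT N'N''); exact.
Qed.

End Zorn.

Section Rank.
Variable R : pzRingType.
Implicit Types M N V : lmodType R.

Definition addm M (A B : M -> Prop) := fun x => exists a b, [/\ A a, B b & x = a + b].

Lemma submod_addm M (A B : M -> Prop) : submod A -> submod B -> submod (addm A B).
Proof.
move=> [A0 HA] [B0 HB]; split=> [|r _ _ [a [b [Aa Bb ->]]] [a' [b' [Aa' Bb' ->]]]].
  by exists 0, 0; rewrite addr0.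
exists (r *: a + a'), (r *: b + b'); split; [exact: HA | exact: HB |].
by rewrite scalerDr addrACA.
Qed.

Lemma addm_mono M (A A' B : M -> Prop) : subm A A' -> subm (addm A B) (addm A' B).
Proof. by move=> AA' _ [a [b [Aa Bb ->]]]; exists a, b; split=> //; exact: AA'. Qed.

Lemma subm_addl M (A B : M -> Prop) : submod B -> subm A (addm A B).
Proof. by move=> [B0 _] x Ax; exists x, 0; rewrite addr0. Qed.

Lemma subm_addr M (A B : M -> Prop) : submod A -> subm B (addm A B).
Proof. by move=> [A0 _] x Ax; exists 0, x; rewrite add0r. Qed.

Definition span1 M (x : M) := fun y => exists a : R, y = a *: x.

Lemma submod_span1 M (x : M) : submod (span1 x).
Proof.
split=> [|r _ _ [a ->] [b ->]]; first by exists 0; rewrite scale0r.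
by exists (r * a + b); rewrite scalerDl scalerA.
Qed.

Lemma span1_id M (x : M) : span1 x x.
Proof. by exists 1; rewrite scale1r. Qed.

(* Modules of finite length are encoded by a strictly monotone function from
   submodules to nat. *)
Definition strict_rank M (I : M -> Prop) (l : (M -> Prop) -> nat) :=
  forall A B, submod A -> submod B -> subm I A -> subm A B ->
  (l A <= l B)%N /\ (l A = l B -> subm B A).

Definition ranked_above M I := exists l, @strict_rank M I l.

Definition cover M (I' I : M -> Prop) := subm I' I /\
  forall B, submod B -> subm I' B -> subm B I -> subm B I' \/ subm I B.

(** For [A] above [I'], the intersection with [I] is [I'] or [I]. By the modular law two comparable
    [A] coincide when they agree in this alternative, recorded by the added Boolean, and in
    [A + I]. *)
Lemma ranked_cover M (I' I : M -> Prop) : submod I' -> submod I -> cover I' I ->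
  ranked_above I -> ranked_above I'.
Proof.
move=> HI' HI [I'I cov] [l Hl].
exists (fun A => l (addm A I) + `[< subm I A >])%N => A B HA HB I'A AB.
have [leAB eqAB] := Hl (addm A I) (addm B I) (submod_addm HA HI) (submod_addm HB HI)
  (subm_addr HA) (addm_mono AB).
have bAB : (`[< subm I A >] <= `[< subm I B >])%N.
  by case: asboolP => // IA; rewrite asboolT // => x /IA /AB.
split=> [|e]; first exact: leq_add.
have e1 : l (addm A I) = l (addm B I).
  by apply/eqP; rewrite eqn_leq leAB /= -(leq_add2r `[< subm I A >]) e leq_add2l.
have e2 : `[< subm I A >] = `[< subm I B >].
  by move: e; rewrite e1 => /addnI; case: asboolP; case: asboolP.
move=> b Bb; have [a [i [Aa Ii bE]]] := eqAB e1 b (subm_addl HI Bb).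
rewrite bE; apply: (submodD HA) => //.
have Bi : B i.
  by rewrite -[i](addKr a) -bE addrC; apply: (submodB HB) => //; exact: AB.
have HBI : submod (fun x => B x /\ I x).
  split=> [|r x y [Bx Ix] [By Iy]]; first by split; [case: HB | case: HI].
  by split; [case: HB => _; apply | case: HI => _; apply].
have [||h|h] := cov _ HBI; last 1 first.
- have : subm I A by apply/asboolP; rewrite e2; apply/asboolP => x /h[].
  by apply.
- by move=> x I'x; split; [apply/AB/I'A | exact: I'I].
- by move=> x [].
- by apply/I'A/h.
Qed.

(** Split [A] at its intersection with [I]: the quotient is seen in [A + I], and the part inside [I]
    is seen in its sum with [J]. *)
Lemma ranked_inter M (I J : M -> Prop) : submod I -> submod J ->
  ranked_above I -> ranked_above J -> ranked_above (fun x => I x /\ J x).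
Proof.
move=> HI HJ [l Hl] [l' Hl'].
have HAI A : submod A -> submod (fun x : M => A x /\ I x).
  move=> HA; split=> [|r x y [Bx Ix] [By Iy]]; first by split; [case: HA | case: HI].
  by split; [case: HA => _; apply | case: HI => _; apply].
exists (fun A => l (addm A I) + l' (addm (fun x => A x /\ I x) J))%N => A B HA HB IJA AB.
have [leAB eqAB] := Hl (addm A I) (addm B I) (submod_addm HA HI) (submod_addm HB HI)
  (subm_addr HA) (addm_mono AB).
have [leAB' eqAB'] := Hl' (addm (fun x => A x /\ I x) J) (addm (fun x => B x /\ I x) J)
  (submod_addm (HAI _ HA) HJ) (submod_addm (HAI _ HB) HJ) (subm_addr (HAI _ HA))
  (addm_mono (fun x '(conj Ax Ix) => conj (AB x Ax) Ix)).
split=> [|e]; first exact: leq_add.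
have e1 : l (addm A I) = l (addm B I).
  apply/eqP; rewrite eqn_leq leAB /= -(leq_add2r (l' (addm (fun x => A x /\ I x) J))) e.
  by rewrite leq_add2l.
have e2 : l' (addm (fun x => A x /\ I x) J) = l' (addm (fun x => B x /\ I x) J).
  by move: e; rewrite e1 => /addnI.
move=> b Bb; have [a [i [Aa Ii bE]]] := eqAB e1 b (subm_addl HI Bb).
rewrite bE; apply: (submodD HA) => //.
have Bi : B i.
  by rewrite -[i](addKr a) -bE addrC; apply: (submodB HB) => //; exact: AB.
have [a' [j [[Aa' Ia'] Jj iE]]] := eqAB' e2 i (subm_addl HJ (conj Bi Ii)).
rewrite iE; apply: (submodD HA) => //.
apply: IJA; have -> : j = i - a' by rewrite iE addrC addKr.
split; first exact: (submodB HI).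
by rewrite iE addrC addKr.
Qed.

End Rank.

Lemma submod_left_ideal (R : pzRingType) (I : R^o -> Prop) :
  submod I <-> left_ideal (I : R -> Prop).
Proof.
split=> [[I0 HI]|[I0 ID IZ]].
  split=> // [x y Ix Iy|a x Ix]; first by have := HI 1 x y Ix Iy; rewrite scale1r.
  by have := HI a x 0 Ix I0; rewrite addr0.
by split=> // a x y Ix Iy; apply: ID => //; exact: IZ.
Qed.

Section Hopkins.
Variable k : comPzRingType.
Hypothesis artk : artinian k.
Implicit Types I J N : k^o -> Prop.

Lemma artinian_min (P : (k^o -> Prop) -> Prop) : (exists I, submod I /\ P I) ->
  exists I, [/\ submod I, P I & forall J, submod J -> P J -> subm J I -> subm I J].
Proof.
move=> [I0 [HI0 PI0]]; apply: contrapT => nmin.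
pose E := {I : k^o -> Prop | submod I /\ P I}.
have step (I : E) : exists J : E, subm (sval J) (sval I) /\ ~ subm (sval I) (sval J).
  case: I => I [HI PI] /=; apply: contrapT => nJ; apply: nmin; exists I; split=> // J HJ PJ JI.
  by apply: contrapT => IJ; apply: nJ; exists (exist _ J (conj HJ PJ)).
have [f fP] := choice step.
pose s n := sval (iter n f (exist _ I0 (conj HI0 PI0) : E)).
have [||n nP] := @artk (fun n => s n).
- move=> n; apply/submod_left_ideal; rewrite /s; case: (iter n f _) => I [].
  by [].
- by move=> n x; case: (fP (iter n f (exist _ I0 (conj HI0 PI0) : E))) => h _ /h.
case: (fP (iter n f (exist _ I0 (conj HI0 PI0) : E))) => _; apply => x.
exact: (nP n.+1 (leqnSn n) x).
Qed.

Definition max_ideal I := [/\ submod I, ~ I 1 &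
  forall J, submod J -> subm I J -> ~ J 1 -> subm J I].

Lemma max_ideal_exists I : submod I -> ~ I 1 -> exists m, max_ideal m /\ subm I m.
Proof. by move=> HI /(submod_avoiding HI)[m [? ? ? ?]]; exists m. Qed.

Lemma max_ideal_inv m c : max_ideal m -> ~ m c -> exists d mu : k, m mu /\ d * c = 1 + mu.
Proof.
move=> [Hm m1 maxm] mc; apply: contrapT => nd; apply: mc.
have HJ := submod_addm Hm (submod_span1 (c : k^o)).
apply: (maxm _ HJ (subm_addl (submod_span1 _))); last first.
  by apply: (subm_addr Hm); exact: span1_id.
case=> mu [_ [mmu [d ->] e]]; apply: nd; exists d, (- mu); split.
  exact: submodN Hm mmu.
by rewrite e addrAC subrr add0r.
Qed.

(** Let [I] be the least ideal modulo which [k] has finite length. If [I] is nonzero, multiplication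
    by a maximal ideal cannot shrink it ([stable]), since a maximal proper part of [I] would again
    give finite length. An ideal [J] minimal with [J I] nonzero then produces [x = x * e] with [e]
    and [1 - e] in one maximal ideal. *)
Lemma artinian_ranked : ranked_above (fun x : k^o => x = 0).
Proof.
have HT : submod (fun _ : k^o => True) by split.
have [|I [HI rI minI]] := artinian_min (P := @ranked_above k k^o).
  exists (fun _ => True); split=> //; exists (fun _ => 0%N) => A B _ _ TA _.
  by split=> // _ x _; exact: TA.
have HIJ J : submod J -> submod (fun x : k^o => J x /\ I x).
  move=> HJ; split=> [|r x y [Bx Ix] [By Iy]]; first by split; [case: HJ | case: HI].
  by split; [case: HJ => _; apply | case: HI => _; apply].
have least J : submod J -> ranked_above J -> subm I J.
  move=> HJ rJ x Ix.
  by have [] := minI _ (HIJ J HJ) (ranked_inter HJ HI rJ rI) (fun y => @proj2 _ _) x Ix.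
have [[b [Ib b0]]|I0] := pselect (exists b, I b /\ b <> 0); last first.
  have -> : (fun x : k^o => x = 0) = I; last by [].
  apply: funext => x; apply: propext; split=> [->|Ix]; first by case: HI.
  by apply: contrapT => x0; apply: I0; exists x.
have stable m N : max_ideal m -> submod N ->
    (forall a b, m a -> I b -> N (a * b)) -> subm I N.
  move=> mm HN mIN; have [Hm m1 maxm] := mm; apply: contrapT => nIN.
  have [x [Ix Nx]] : exists x, I x /\ ~ N x.
    by apply: contrapT => h; apply: nIN => x Ix; apply: contrapT => Nx; apply: h; exists x.
  have [N' [HN' NN' N'x maxN']] := submod_avoiding HN Nx.
  (* By maximality of [N'], [x] lies in [N' + k y]; a coefficient in [m] would put [c y] into [N],
     hence [x] into [N']. *)
  have key (y : k^o) : I y -> ~ N' y -> exists n c : k^o, [/\ N' n, x = n + (c : k) *: y & ~ m c].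
    move=> Iy N'y; have [n [_ [N'n [c ->] xE]]] : addm N' (span1 y) x.
      apply: contrapT => h; apply: N'y.
      apply: (maxN' _ (submod_addm HN' (submod_span1 y)) (subm_addl (submod_span1 y)) h).
      exact: subm_addr HN' _ (span1_id y).
    exists n, c; split=> // mc; apply: N'x; rewrite xE; apply: (submodD HN') => //.
    by apply: NN'; exact: mIN.
  have cI : cover (fun y => N' y /\ I y) I.
    split=> [y []//|B HB N'B BI].
    have [sub|nsub] := pselect (subm B N'); first by left=> y By; split; [exact: sub | exact: BI].
    right; have Bx : B x.
      have [y [By N'y]] : exists y, B y /\ ~ N' y.
        by apply: contrapT => h; apply: nsub => y By; apply: contrapT => N'y; apply: h; exists y.
      have [n [c [N'n xE _]]] := key y (BI y By) N'y.
      rewrite xE; apply: (submodD HB); last exact: (submodZ c HB By).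
      apply: N'B; split=> //; have -> : n = x - (c : k) *: y by rewrite xE addrK.
      exact: (submodB HI Ix (submodZ c HI (BI y By))).
    move=> z Iz; have [N'z|N'z] := pselect (N' z); first exact: N'B.
    have [n [c [N'n xE mc]]] := key z Iz N'z.
    have [d [mu [mmu dc]]] := max_ideal_inv mm mc.
    (* [c] is invertible modulo [m], so [z] is recovered from [x - n = c z] up to [mu z], which lies
       in [N]. *)
    have -> : z = (d : k) *: (x - n) - (mu : k) *: z.
      by rewrite xE addrAC subrr add0r scalerA dc scalerDl scale1r addrK.
    apply: (submodB HB).
      apply: (submodZ _ HB); apply: (submodB HB Bx); apply: N'B; split=> //.
      have -> : n = x - (c : k) *: z by rewrite xE addrK.
      exact: (submodB HI Ix (submodZ c HI Iz)).
    by apply: N'B; split; [apply: NN'; exact: mIN | exact: (submodZ mu HI Iz)].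
  have rN'I := ranked_cover (HIJ _ HN') HI cI rI.
  by have [] := least _ (HIJ _ HN') rN'I x Ix.
have [|J [HJ [x [c [Jx Ic xc]]] minJ]] :=
  artinian_min (P := fun J : k^o -> Prop => exists a c : k, [/\ J a, I c & a * c <> 0]).
  by exists (fun _ => True); split=> //; exists 1, b; rewrite mul1r.
have Hann : submod (fun z : k^o => (z : k) * x = 0).
  split=> [|r z w zx wx]; first exact: mul0r.
  by rewrite mulrDl wx addr0 -[_ * z * x]mulrA zx mulr0.
(* Take [m] above the annihilator of [x]. By [stable], [x m] still acts nontrivially on [I], so
   minimality puts [x] itself in [x m]. *)
have [|m [mm annm]] := max_ideal_exists Hann.
  by rewrite mul1r => x0; apply: xc; rewrite x0 mul0r.
have [Hm m1 _] := mm.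
have Hxm : submod (fun z : k^o => exists2 e : k, m e & z = x * e).
  split=> [|r _ _ [e me ->] [e' me' ->]]; first by exists 0; [case: Hm | rewrite mulr0].
  exists (r * e + e'); first by case: Hm => _; apply.
  by rewrite mulrDr mulrCA.
have [e me xe] : exists2 e : k, m e & x = x * e.
  apply: (minJ _ Hxm) => //; last first.
    by move=> _ [e me ->]; rewrite mulrC; exact: (submodZ e HJ Jx).
  apply: contrapT => nP; apply: xc.
  apply: (stable m (fun z : k^o => x * z = 0) mm) => // [|a d ma Id].
    split=> [|r z w zx wx]; first exact: mulr0.
    by rewrite mulrDr wx addr0 mulrCA zx mulr0.
  apply: contrapT => h; apply: nP; exists (x * a), d; split=> //; first by exists a.
  by rewrite -mulrA.
case: m1; rewrite -(subrK e 1); apply: (submodD Hm _ me); apply: annm.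
by rewrite mulrBl mul1r mulrC -xe subrr.
Qed.

End Hopkins.

(** * Length of modules over an Artin algebra *)

Section FiniteRank.
Variable R : pzRingType.
Implicit Types M N V : lmodType R.

Definition strict_mono M (l : (M -> Prop) -> nat) :=
  forall A B, submod A -> submod B -> subm A B ->
  (l A <= l B)%N /\ (l A = l B -> subm B A).

(** Equivalent to composition length at most [n]; the function form passes to submodules, quotients
    and extensions by taking images and preimages. *)
Definition rk M n := exists l, @strict_mono M l /\ (l (fun _ => True) <= n)%N.

Lemma submod_preim M N (f : {linear M -> N}) (A : N -> Prop) :
  submod A -> submod (fun x => A (f x)).
Proof.
move=> [A0 HA]; split=> [|a x y Ax Ay]; first by rewrite linear0.
by rewrite linearP; exact: HA.
Qed.

Definition imagem M N (f : {linear M -> N}) (A : M -> Prop) := fun y => exists2 x, A x & f x = y.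

Lemma submod_image M N (f : {linear M -> N}) (A : M -> Prop) : submod A -> submod (imagem f A).
Proof.
move=> [A0 HA]; split=> [|a _ _ [x Ax <-] [y Ay <-]]; first by exists 0 => //; rewrite linear0.
by exists (a *: x + y); [exact: HA | rewrite linearP].
Qed.

Lemma imagem_mono M N (f : {linear M -> N}) (A B : M -> Prop) :
  subm A B -> subm (imagem f A) (imagem f B).
Proof. by move=> AB _ [x Ax <-]; exists x => //; exact: AB. Qed.

Lemma submodT M : submod (fun _ : M => True). Proof. by []. Qed.

Lemma rk_inj M N (i : {linear N -> M}) n : injective i -> rk M n -> rk N n.
Proof.
move=> ii [l [Hl ln]]; exists (fun A => l (imagem i A)); split=> [A B HA HB AB|].
  have [h1 h2] := Hl _ _ (submod_image i HA) (submod_image i HB) (imagem_mono AB).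
  split=> // e y By; have [x Ax /ii <-//] := h2 e (i y) (ex_intro2 _ _ y By erefl).
apply: leq_trans ln.
by have [] := Hl _ _ (submod_image i (submodT N)) (submodT M) (fun _ _ => I).
Qed.

Lemma rk_inj_lt M N (i : {linear N -> M}) n : injective i -> ~ surjective i -> rk M n ->
  exists2 m, (m < n)%N & rk N m.
Proof.
move=> ii ni [l [Hl ln]].
have [h1 h2] := Hl _ _ (submod_image i (submodT N)) (submodT M) (fun _ _ => I).
exists (l (imagem i (fun _ => True))).
  apply: leq_trans ln; rewrite ltn_neqAle h1 andbT; apply/eqP => /h2 h; apply: ni => y.
  by have [x _ <-] := h y I; exists x.
exists (fun A => l (imagem i A)); split=> // A B HA HB AB.
have [h3 h4] := Hl _ _ (submod_image i HA) (submod_image i HB) (imagem_mono AB).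
split=> // e y By; have [x Ax /ii <-//] := h4 e (i y) (ex_intro2 _ _ y By erefl).
Qed.

(** The value of [l] at the kernel can be subtracted throughout, and it is positive because the
    kernel is nonzero. *)
Lemma rk_surj_lt M N (p : {linear M -> N}) n : surjective p -> ~ injective p -> rk M n ->
  exists2 m, (m < n)%N & rk N m.
Proof.
move=> ps np [l [Hl ln]]; pose l0 := l (fun x => p x = 0).
have H0 := submod_ker p.
have ker_pre (A : N -> Prop) : submod A -> subm (fun x => p x = 0) (fun x => A (p x)).
  by move=> [A0 _] x ->.
have le0 (A : N -> Prop) : submod A -> (l0 <= l (fun x => A (p x)))%N.
  by move=> HA; have [] := Hl _ _ H0 (submod_preim p HA) (ker_pre A HA).
exists (l (fun _ => True) - l0)%N.
  have H00 : submod (fun x : M => x = 0).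
    by split=> // a x y -> ->; rewrite scaler0 addr0.
  have sub0 : subm (fun x : M => x = 0) (fun x => p x = 0).
    by move=> x ->; rewrite linear0.
  have [h1 h2] := Hl _ _ H00 H0 sub0.
  have l0_gt0 : (0 < l0)%N.
    rewrite lt0n; apply/eqP => e; apply: np; apply: inj0 => x px; apply: h2 => //.
    by move: h1; rewrite -/l0 e leqn0 => /eqP.
  apply: leq_trans ln; rewrite -subn_gt0 subKn //; exact: le0 (submodT N).
exists (fun A => l (fun x => A (p x)) - l0)%N; split=> // A B HA HB AB.
have [h1 h2] := Hl _ _ (submod_preim p HA) (submod_preim p HB) (fun x => AB (p x)).
split=> [|e y By]; first exact: leq_sub2r.
have [x xy] := ps y; rewrite -xy; apply: h2; last by rewrite xy.
by rewrite -(subnK (le0 A HA)) -(subnK (le0 B HB)) e.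
Qed.

Lemma rk_surj M N (p : {linear M -> N}) n : surjective p -> rk M n -> rk N n.
Proof.
move=> ps [l [Hl ln]]; exists (fun A => l (fun x => A (p x))); split=> // A B HA HB AB.
have [h1 h2] := Hl _ _ (submod_preim p HA) (submod_preim p HB) (fun x => AB (p x)).
by split=> // e y By; have [x xy] := ps y; rewrite -xy; apply: h2 => //; rewrite xy.
Qed.

Lemma rk_ext (A B C : lmodType R) (i : {linear A -> B}) (p : {linear B -> C} ) m n : ses i p ->
  rk A m -> rk C n -> rk B (m + n).
Proof.
move=> ip [l [Hl lm]] [l' [Hl' ln]].
exists (fun X => l (fun a => X (i a)) + l' (imagem p X))%N; split=> [X Y HX HY XY|].
  have [h1 h2] := Hl _ _ (submod_preim i HX) (submod_preim i HY) (fun x => XY (i x)).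
  have [h3 h4] := Hl' _ _ (submod_image p HX) (submod_image p HY) (imagem_mono XY).
  split=> [|e]; first exact: leq_add.
  have e1 : l (fun a => X (i a)) = l (fun a => Y (i a)).
    apply/eqP; rewrite eqn_leq h1 /= -(leq_add2r (l' (imagem p X))) e.
    by rewrite leq_add2l.
  have e2 : l' (imagem p X) = l' (imagem p Y) by move: e; rewrite e1 => /addnI.
  move=> y Yy; have [x Xx xy] := h4 e2 (p y) (ex_intro2 _ _ y Yy erefl).
  have [a aE] : exists a, i a = y - x by apply: (ses_ex ip); rewrite linearB xy subrr.
  have -> : y = i a + x by rewrite aE subrK.
  apply: (submodD HX) => //; apply: h2 => //; rewrite aE.
  by apply: (submodB HY) => //; exact: XY.
apply: leq_add => //; apply: leq_trans ln.
by have [] := Hl' _ _ (submod_image p (submodT B)) (submodT C) (fun _ _ => I).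
Qed.

(** A finitely generated submodule with the largest value of [l] absorbs every further element. *)
Lemma rk_fin_gen M n : rk M n -> fin_gen M.
Proof.
move=> [l [Hl ln]].
pose sp m (g : 'I_m -> M) := fun x => exists c : 'I_m -> R, x = \sum_i c i *: g i.
have Hsp m g : submod (@sp m g).
  split=> [|a _ _ [c ->] [d ->]].
    by exists (fun _ => 0); rewrite big1 // => i _; rewrite scale0r.
  exists (fun i => a * c i + d i); rewrite scaler_sumr -big_split.
  by apply: eq_bigr => i _; rewrite scalerDl scalerA.
pose P r := `[< exists m (g : 'I_m -> M), l (sp m g) = r >].
have exP : exists r, P r by exists (l (sp 0%N (fun _ => 0))); apply/asboolP; exists 0%N, (fun _ => 0).
have leP r : P r -> (r <= n)%N.
  move=> /asboolP[m [g <-]]; apply: leq_trans ln.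
  by have [] := Hl _ _ (Hsp m g) (submodT M) (fun _ _ => I).
have [r /asboolP[m [g gr]] rmax] := ex_maxnP exP leP.
exists m, g => x.
pose g' (i : 'I_m.+1) := if unlift ord0 i is Some j then g j else x.
have sub : subm (sp m g) (sp m.+1 g').
  move=> _ [c ->]; exists (fun i => if unlift ord0 i is Some j then c j else 0).
  rewrite big_ord_recl unlift_none scale0r add0r; apply: eq_bigr => i _.
  by rewrite liftK /g' liftK.
have [h1 h2] := Hl _ _ (Hsp _ g) (Hsp _ g') sub.
apply: h2; last first.
  exists (fun i => if unlift ord0 i is Some j then 0 else 1).
  rewrite big_ord_recl unlift_none scale1r /g' unlift_none big1 ?addr0 // => i _.
  by rewrite liftK scale0r.
apply/eqP; rewrite eqn_leq h1 gr; apply: rmax; apply/asboolP; by exists m.+1, g'.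
Qed.

Hypothesis rankedR : ranked_above (fun x : R^o => x = 0).

Lemma fin_gen_rk M : fin_gen M -> exists n, rk M n.
Proof.
move=> /fin_gen_free_cover[n [p ps]].
suff [m mP] : exists m, rk ({ffun 'I_n -> R^o} : lmodType R) m.
  by exists m; exact: rk_surj ps mP.
apply: (@in_add_ind R (fun M => exists m, rk M m) R^o).
- move=> A B [a Ha] [b Hb]; have [u [v uv]] := ses_prod A B.
  by exists (a + b)%N; exact: rk_ext uv Ha Hb.
- by move=> A B [i [q /summand_inj[ii _]]] [b Hb]; exists b; exact: rk_inj ii Hb.
- have [l Hl] := rankedR; exists (l (fun _ => True)), l; split=> // A B HA HB AB.
  by apply: Hl => // x ->; case: HA.
- by exists n; exact: direct_summand_refl.
Qed.

End FiniteRank.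

Section RestrictScalars.
Variable k : comPzRingType.
Implicit Types A B : kalg k.

(** Length is measured over [k], where an algebra, its opposite and the endomorphism algebras are
    all finitely generated; multiplication by a ring element, which need not be [A]-linear, is then
    available as a map too. *)
Definition kmod A (M : lmodType A) : lmodType k := bimod (endo_rmorph M).

Lemma kmod_scale A (M : lmodType A) (c : k) (x : M) :
  (c *: (x : kmod M) : kmod M) = kalg_map A c *: x.
Proof. by []. Qed.

Lemma kmod_linear A (M N : lmodType A) (f : {linear M -> N}) : linear (f : kmod M -> kmod N).
Proof. by move=> c x y; rewrite !kmod_scale -linearZ -linearD. Qed.
Definition kmod_map A (M N : lmodType A) (f : {linear M -> N}) : {linear kmod M -> kmod N} :=
  mklin (kmod_linear f).

Lemma kmod_submod A (M : lmodType A) (N : M -> Prop) : submod N -> submod (N : kmod M -> Prop).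
Proof. by move=> [N0 HN]; split=> // c x y Nx Ny; exact: HN. Qed.

Lemma kmod_fin_gen A (M : lmodType A) : fin_gen (kmod M) -> fin_gen M.
Proof.
case=> n [g gP]; exists n, g => x; have [c ->] := gP x.
by exists (fun i => kalg_map A (c i)).
Qed.

Lemma artin_kmod_fin_gen A (M : lmodType A) : artin_algebra A -> fin_gen M -> fin_gen (kmod M).
Proof.
move=> [_ [m [g gP]]] [n [h hP]]; apply/fin_genP; exists ('I_n * 'I_m)%type.
exists (fun ij => g ij.2 *: h ij.1 : M) => x.
have [c ->] := hP x; have [d dP] := choice (fun i => gP (c i)).
exists (fun ij => d ij.1 ij.2).
rewrite -(pair_bigA _ (fun i j => (d i j : k) *: (g j *: h i : kmod M))) /=.
apply: eq_bigr => i _; rewrite {1}dP scaler_suml; apply: eq_bigr => j _.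
by rewrite -scalerA.
Qed.

Lemma artin_rk A (M : lmodType A) : artin_algebra A -> fin_gen M -> exists n, rk (kmod M) n.
Proof.
move=> HA fM; apply: fin_gen_rk (artin_kmod_fin_gen HA fM).
by apply: artinian_ranked; case: HA.
Qed.

Lemma artin_noeth A : artin_algebra A -> noeth A.
Proof.
move=> HA M N i fM ii; have [n rM] := artin_rk HA fM.
apply: kmod_fin_gen; apply: rk_fin_gen.
exact: (@rk_inj _ (kmod M) (kmod N) (kmod_map i) n ii rM).
Qed.

(** Evaluation at finitely many generators embeds End(T), over [k], in a power of [T] of finite
    length. *)
Lemma artin_endo A (T : lmodType A) : artin_algebra A -> fin_gen T -> artin_algebra (endo_alg T).
Proof.
move=> HA fT; split; first by case: HA.
have [n [g gP]] := fT.
have [r rT] : exists r, rk (kmod ({ffun 'I_n -> T} : lmodType A)) r.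
  apply: (artin_rk HA).
  apply: (@in_add_ind A (@fin_gen A) T) => [U V|U V|//|].
  - exact: fin_gen_prod.
  - exact: fin_gen_summand.
  - by exists n; exact: direct_summand_refl.
have lu : linear ((fun f : endo T => [ffun i => (f : {linear T -> T}) (g i)]) :
    kmod ((endo_alg T)^o : lmodType (endo_alg T)) -> kmod ({ffun 'I_n -> T} : lmodType A)).
  move=> c f h; apply/ffunP => i; rewrite !ffunE.
  by [].
have ui : injective (mklin lu).
  apply: inj0 => f /ffunP f0; apply: linear_ext => t; have [c ->] := gP t.
  rewrite linear_sum big1 // => i _; rewrite linearZ.
  by have := f0 i; rewrite /= !ffunE => ->; rewrite /= scaler0.
have [m [h hP]] := rk_fin_gen (rk_inj ui rT).
exists m, h => f; have [c ->] := hP f; by exists c.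
Qed.

Lemma artin_op A : artin_algebra A -> artin_algebra (op_alg A).
Proof.
move=> [Hk [n [g gP]]]; split=> //; exists n, g => a; have [c ->] := gP a.
by exists c; apply: eq_bigr => i _; rewrite kalg_mapC.
Qed.

End RestrictScalars.

(** * Krull-Schmidt *)

Lemma bounded_stable (c : nat -> nat) b : (forall n, (c n <= c n.+1)%N) ->
  (forall n, (c n <= b)%N) -> exists N, forall n, (N <= n)%N -> c n = c N.
Proof.
move=> inc bnd.
pose P r := `[< exists n, c n = r >].
have [||r /asboolP[N Nr] rmax] := @ex_maxnP P b.
- by exists (c 0%N); apply/asboolP; exists 0%N.
- by move=> r /asboolP[n <-].
exists N => n Nn; apply/eqP; rewrite eqn_leq Nr rmax /=; last by apply/asboolP; exists n.
rewrite -Nr -(subnK Nn); elim: (n - N)%N => // d IH.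
by rewrite addSn (leq_trans IH).
Qed.

Section Fitting.
Variable R : pzRingType.
Implicit Types M N X Y Z : lmodType R.

Lemma iter_linear M (h : {linear M -> M}) n : linear (iter n h).
Proof. by elim: n => [|n IH] a x y //=; rewrite IH linearP. Qed.
Definition iterlin M (h : {linear M -> M}) n := mklin (iter_linear h n).

Lemma fitting_stable M r (h : {linear M -> M}) : rk M r -> exists2 n, (0 < n)%N &
  (forall x, iter (n + n) h x = 0 -> iter n h x = 0) /\
  (forall x, exists y, iter n h x = iter (n + n) h y).
Proof.
move=> [l [Hl lr]].
pose K n := fun x => iterlin h n x = 0.
pose J n := imagem (iterlin h n) (fun _ => True).
have HK n : submod (K n) := submod_ker (iterlin h n).
have HJ n : submod (J n) := submod_image (iterlin h n) (submodT M).
have [N HN] := @bounded_stable (fun n => l (K n)) r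
  (fun n => proj1 (Hl _ _ (HK n) (HK n.+1) (fun x e => etrans (congr1 h e) (linear0 h))))
  (fun n => leq_trans (proj1 (Hl _ _ (HK n) (submodT M) (fun _ _ => I))) lr).
have JS n : subm (J n.+1) (J n).
  by move=> _ [x _ <-]; exists (h x) => //=; rewrite -iterSr.
have Jr n : (l (J n) <= r)%N.
  exact: leq_trans (proj1 (Hl _ _ (HJ n) (submodT M) (fun _ _ => I))) lr.
(* The images decrease; subtracting their values from the bound [r] makes an increasing bounded
   sequence. *)
have [||N' HN'] := @bounded_stable (fun n => r - l (J n))%N r.
- by move=> n; apply: leq_sub2l; case: (Hl _ _ (HJ n.+1) (HJ n) (JS n)).
- by move=> n; exact: leq_subr.
pose n := (maxn N N').+1.
have Nn : (N <= n)%N by rewrite leqW // leq_maxl.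
have nN' : (N' <= n)%N by rewrite leqW // leq_maxr.
exists n => //; split.
- have sub : subm (K n) (K (n + n)).
    move=> x e; rewrite /K /= iterD (_ : iter n h x = 0) //.
    exact: (linear0 (iterlin h n)).
  have [_ h2] := Hl _ _ (HK n) (HK (n + n)%N) sub.
  by apply: h2; rewrite !HN // (leq_trans Nn) // leq_addr.
- have sub : subm (J (n + n)%N) (J n).
    by move=> _ [x _ <-]; exists (iter n h x) => //=; rewrite iterD.
  have [_ h2] := Hl _ _ (HJ (n + n)%N) (HJ n) sub.
  have e : l (J (n + n)%N) = l (J n).
    rewrite -(subKn (Jr (n + n)%N)) -(subKn (Jr n)).
    by rewrite (HN' n) // (HN' (n + n)%N) // (leq_trans nN') // leq_addr.
  move=> x; have [|y _ yE] := h2 e (iter n h x); last by exists y.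
  by exists x.
Qed.

End Fitting.

Section KrullSchmidt.
Variables (k : comPzRingType) (A : kalg k).
Hypothesis artA : artin_algebra A.
Implicit Types M N T X Y Z : lmodType A.

(** [e] is the projection onto the image of the [n]-th power of [h] along its kernel, and [g]
    inverts that power on the image and is 0 on the kernel. *)
Lemma fitting M (h : {linear M -> M}) : fin_gen M ->
  exists n (e g : {linear M -> M}), (0 < n)%N /\
  [/\ forall x, e (e x) = e x, forall x, iter n h (e x) = iter n h x,
      forall x, g (iter n h x) = e x & forall x, iter n h (g x) = e x].
Proof.
move=> fM; have [r rM] := artin_rk artA fM.
have [n n0 [st1 st2]] := fitting_stable (kmod_map h) rM.
have {}st1 x : iter (n + n) h x = 0 -> iter n h x = 0 := st1 x.
have {}st2 x : exists y, iter n h x = iter (n + n) h y := st2 x.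
pose hn := iterlin h n.
have hnE x : hn x = iter n h x by [].
have uniq z y : z = hn y -> hn z = 0 -> z = 0.
  by move=> -> e; apply: st1; rewrite iterD.
have [e eP] : exists e : {linear M -> M}, forall x, hn (e x) = hn x /\ exists y, e x = hn y.
  apply: (linear_of_rel (P := fun x z => hn z = hn x /\ exists y, z = hn y)).
  - move=> x; have [y xy] := st2 x; exists (hn y); split; last by exists y.
    by rewrite [RHS]xy iterD.
  - move=> a x x' z z' [e1 [y zy]] [e2 [y' zy']]; split.
      by rewrite (linearP hn a z z') (linearP hn a x x') e1 e2.
    by exists (a *: y + y'); rewrite zy zy' linearP.
  - by move=> z []; rewrite linear0 => hz [y zy]; exact: uniq zy hz.
have [g gP] : exists g : {linear M -> M}, forall x, hn (g x) = e x /\ exists y, g x = hn y.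
  apply: (linear_of_rel (P := fun x z => hn z = e x /\ exists y, z = hn y)).
  - move=> x; have [_ [y xy]] := eP x; have [y' yy'] := st2 y.
    by exists (hn y'); split; [rewrite xy [RHS]yy' iterD | exists y'].
  - move=> a x x' z z' [e1 [y zy]] [e2 [y' zy']]; split.
      by rewrite (linearP hn a z z') (linearP e a x x') e1 e2.
    by exists (a *: y + y'); rewrite zy zy' linearP.
  - by move=> z []; rewrite linear0 => hz [y zy]; exact: uniq zy hz.
have eqz z z' y y' : z = hn y -> z' = hn y' -> hn z = hn z' -> z = z'.
  move=> zy zy' e1; apply: subr0_eq; apply: (uniq _ (y - y')).
    by rewrite linearB zy zy'.
  by rewrite linearB e1 subrr.
exists n, e, g; split=> //; split=> x.
- have [e1 [y1 e2]] := eP (e x); have [e3 [y2 e4]] := eP x.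
  exact: (eqz _ _ _ _ e2 e4).
- by case: (eP x).
- have [e1 [y1 e2]] := gP (hn x); have [e3 [y2 e4]] := eP x.
  apply: (eqz _ _ _ _ e2 e4); rewrite e1.
  have [e5 [y3 e6]] := eP (hn x); apply: (eqz _ _ _ _ e6 (erefl (hn (e x)))).
  by rewrite e5 e3.
- by case: (gP x).
Qed.

Lemma indec_idempotent Z (e : {linear Z -> Z}) : indecomposable Z ->
  (forall x, e (e x) = e x) -> (forall x, e x = 0) \/ (forall x, e x = x).
Proof.
move=> [_ iZ] ee.
have [X [i [ii iP]]] := sub_exists (submod_im e).
have [Y [j [ji jP]]] := sub_exists (submod_ker e).
have [x|p pE] := factor_inj (f := e) ii; first by apply/iP; exists x.
have lq : linear (fun x => x - e x).
  by move=> a x y; rewrite (linearP e) scalerBr opprD addrACA.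
have [x|q qE] := factor_inj (f := mklin lq) ji.
  by apply/jP; rewrite /= linearB ee subrr.
have [|X0|Y0] := iZ X Y (linpair p q).
- apply: inj_surj_bij.
    apply: inj0 => x /= [px qx]; have := qE x; rewrite /= qx linear0 -pE px linear0 subr0.
    by [].
  move=> [x y]; exists (i x + j y) => /=.
  have eix : e (i x) = i x by have /iP[z <-] : exists y, i y = i x; [exists x | rewrite ee].
  have ejy : e (j y) = 0 by apply/jP; exists y.
  congr pair; first by apply: ii; rewrite pE linearD eix ejy addr0.
  by apply: ji; rewrite qE /= linearD eix ejy addr0 addrAC subrr add0r.
- by left=> x; rewrite -pE (X0 (p x)) linear0.
- right=> x; apply/esym/subr0_eq; transitivity (j (q x)); first by rewrite qE.
  by rewrite (Y0 (q x)) linear0.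
Qed.

Lemma indec_nilp_or_bij Z (h : {linear Z -> Z}) : fin_gen Z -> indecomposable Z ->
  (exists n, forall x, iter n h x = 0) \/ bijective h.
Proof.
move=> fZ iZ; have [n' [e [g [n0 [ee he ge hg]]]]] := fitting h fZ.
case: n' n0 he ge hg => [//|n] _ he ge hg.
have [e0|e1] := indec_idempotent iZ ee.
  by left; exists n.+1 => x; rewrite -he e0; exact: (linear0 (iterlin h n.+1)).
right; apply: inj_surj_bij => [|y].
  apply: inj0 => x hx; rewrite -(e1 x) -ge iterSr hx.
  by rewrite -[iter n h 0]/(iterlin h n 0) !linear0.
by exists (iter n h (g y)); rewrite -[LHS]/(iter n.+1 h (g y)) hg e1.
Qed.

Lemma indec_inj_bij Z (h : {linear Z -> Z}) : fin_gen Z -> indecomposable Z ->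
  injective h -> bijective h.
Proof.
move=> fZ iZ ih; have [[n hn]|//] := indec_nilp_or_bij h fZ iZ.
case: iZ => nZ _; case: nZ => x; move: (hn x); elim: n {hn} => //= n IH e.
by apply: IH; apply: ih; rewrite e linear0.
Qed.

(** Locality of End(Z). With [u] inverse to the sum, [b x = 0] gives [u (a x) = x]; so if [u a] is
    nilpotent, [b] is injective, hence bijective. *)
Lemma indec_local2 Z (a b : {linear Z -> Z}) : fin_gen Z -> indecomposable Z ->
  bijective (a \+ b : {linear Z -> Z}) -> bijective a \/ bijective b.
Proof.
move=> fZ iZ /bij_inv[u [uK Ku]].
have [[n un]|bij] := indec_nilp_or_bij (u \o a : {linear Z -> Z}) fZ iZ; last first.
  left; apply: (eq_bij (f := (a \+ b) \o (u \o a))) => [|x /=]; last exact: Ku.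
  by apply: bij_comp bij; exists u.
right; apply: indec_inj_bij => //; apply: inj0 => x bx.
have ux : u (a x) = x by rewrite -[RHS]uK /= bx addr0.
by rewrite -(un x); elim: n {un} => //= n <-.
Qed.

Lemma indec_local Z (I : finType) (h : I -> {linear Z -> Z}) : fin_gen Z ->
  indecomposable Z -> (forall x, \sum_i h i x = x) -> exists i, bijective (h i).
Proof.
move=> fZ iZ; have lh r : linear (fun x => \sum_(i <- r) h i x).
  move=> a x y; rewrite scaler_sumr -big_split; apply: eq_bigr => i _.
  by rewrite linearP.
have main r : bijective (mklin (lh r)) -> exists i, bijective (h i).
  elim: r => [|i r IH].
    case=> g gK _; case: iZ => nZ _; case: nZ => x; rewrite -[LHS]gK -[RHS]gK.
    by rewrite /= !big_nil.
  move=> bij; have [||] := @indec_local2 _ (h i) (mklin (lh r)) fZ iZ.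
  - by apply: (eq_bij bij) => x; rewrite /= big_cons.
  - by exists i.
  - exact: IH.
move=> hx; apply: (main (index_enum I)); exists id => x; exact: hx.
Qed.

Lemma split_of_bij Z Y (u : {linear Z -> Y}) (v : {linear Y -> Z}) :
  bijective (v \o u : {linear Z -> Z}) -> direct_summand Z Y.
Proof. by case/bij_inv=> w [wK _]; exists u, (w \o v : {linear Y -> Z}) => x; exact: wK. Qed.

Lemma indec_in_add Z T : fin_gen Z -> indecomposable Z -> in_add T Z -> direct_summand Z T.
Proof.
move=> fZ iZ /in_addP[J [u [v uv]]].
have [x|a ba] := @indec_local Z J (fun a => v a \o u a : {linear Z -> Z}) fZ iZ.
  by rewrite -uv.
exact: split_of_bij ba.
Qed.

Lemma indec_summand2 Z X Y : fin_gen Z -> indecomposable Z ->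
  direct_summand Z (X * Y)%type -> direct_summand Z X \/ direct_summand Z Y.
Proof.
move=> fZ iZ [j [q jq]].
pose a := ((q \o inl_lin X Y) \o (fst \o j) : {linear Z -> Z}).
pose b := ((q \o inr_lin X Y) \o (snd \o j) : {linear Z -> Z}).
have [|/split_of_bij|/split_of_bij] := @indec_local2 _ a b fZ iZ; [|by left|by right].
exists id => x; rewrite -[RHS]jq /= -linearD; congr (q _).
  by rewrite [RHS]surjective_pairing; congr pair; rewrite /= ?addr0 ?add0r.
by rewrite [RHS]surjective_pairing; congr pair; rewrite /= ?addr0 ?add0r.
Qed.

Definition decomposition M (I : finType) (Z : I -> lmodType A)
    (i : forall a, {linear Z a -> M}) (p : forall a, {linear M -> Z a}) :=
  [/\ forall a, indecomposable (Z a), forall a, cancel (i a) (p a),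
      forall a b, a != b -> forall z, p a (i b z) = 0 &
      forall x, \sum_a i a (p a x) = x].

Lemma rk_kmod_inj_lt M N (i : {linear N -> M}) n : injective i -> ~ surjective i ->
  rk (kmod M) n -> exists2 m, (m < n)%N & rk (kmod N) m.
Proof. by move=> ii si; exact: (rk_inj_lt (i := kmod_map i) ii si). Qed.

Lemma decomposable M : ~ is_zero M -> ~ indecomposable M ->
  exists X Y (f : {linear M -> (X * Y)%type}) (g : {linear (X * Y)%type -> M}),
  [/\ cancel f g, cancel g f, ~ is_zero X & ~ is_zero Y].
Proof.
move=> M0 nM; apply: contrapT => nXY; apply: nM; split=> // X Y f bf.
have [X0|X0] := pselect (is_zero X); first by left.
right; apply: contrapT => Y0; apply: nXY.
by have [g [fg gf]] := bij_inv bf; exists X, Y, f, g.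
Qed.

Lemma prod_rk_lt M (X Y : lmodType A) (f : {linear M -> (X * Y)%type})
    (g : {linear (X * Y)%type -> M}) n : cancel f g -> cancel g f -> ~ is_zero Y ->
  rk (kmod M) n -> exists2 m, (m < n)%N & rk (kmod X) m.
Proof.
move=> fg gf Y0; apply: (@rk_kmod_inj_lt M X (g \o inl_lin X Y : {linear X -> M})).
  by move=> x y /= /(can_inj gf)[].
move=> s; apply: Y0 => y; have [x /= e] := s (g (0, y)).
by have [_ <-] := can_inj gf e.
Qed.

Lemma prod_rk_lt_r M (X Y : lmodType A) (f : {linear M -> (X * Y)%type})
    (g : {linear (X * Y)%type -> M}) n : cancel f g -> cancel g f -> ~ is_zero X ->
  rk (kmod M) n -> exists2 m, (m < n)%N & rk (kmod Y) m.
Proof.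
move=> fg gf X0; apply: (@rk_kmod_inj_lt M Y (g \o inr_lin X Y : {linear Y -> M})).
  by move=> x y /= /(can_inj gf)[].
move=> s; apply: X0 => x; have [y /= e] := s (g (x, 0)).
by have [<- _] := can_inj gf e.
Qed.

Lemma decomposition_exists M : fin_gen M -> exists (I : finType) (Z : I -> lmodType A)
  (i : forall a, {linear Z a -> M}) (p : forall a, {linear M -> Z a}), decomposition i p.
Proof.
move=> fM; have [n rM] := artin_rk artA fM.
elim/ltn_ind: n M fM rM => n IH M fM rM.
have [M0|M0] := pselect (is_zero M).
  exists 'I_0, (fun _ => M), (fun _ => idfun), (fun _ => idfun).
  by split=> [[]|[]|[]|x] //; rewrite [RHS]M0 big_ord0.
have [iM|/(decomposable M0)[X [Y [f [g [fg gf X0 Y0]]]]]] := pselect (indecomposable M).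
  exists 'I_1, (fun _ => M), (fun _ => idfun), (fun _ => idfun).
  by split=> // [a b|x]; [rewrite !ord1 | rewrite big_ord1].
have fXY : fin_gen (X * Y)%type by apply: fin_gen_surj fM => z; exists (g z); exact: gf.
have fX := fin_gen_summand (summandl X Y) fXY.
have fY := fin_gen_summand (summandr X Y) fXY.
have [m mn rX] := prod_rk_lt fg gf Y0 rM.
have [m' mn' rY] := prod_rk_lt_r fg gf X0 rM.
have [I [Z [i [p [d1 d2 d3 d4]]]]] := IH m mn X fX rX.
have [I' [Z' [i' [p' [d1' d2' d3' d4']]]]] := IH m' mn' Y fY rY.
pose ZZ (c : I + I') := match c with inl a => Z a | inr a => Z' a end.
pose ii (c : I + I') : {linear ZZ c -> M} := match c return {linear ZZ c -> M} with
  | inl a => (g \o inl_lin X Y) \o i a : {linear Z a -> M}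
  | inr a => (g \o inr_lin X Y) \o i' a : {linear Z' a -> M} end.
pose pp (c : I + I') : {linear M -> ZZ c} := match c return {linear M -> ZZ c} with
  | inl a => p a \o (fst \o f) : {linear M -> Z a}
  | inr a => p' a \o (snd \o f) : {linear M -> Z' a} end.
exists (I + I')%type, ZZ, ii, pp.
have pi1 (w : X) : fst (f (g (inl_lin X Y w))) = w by rewrite gf.
have pi2 (w : X) : snd (f (g (inl_lin X Y w))) = 0 by rewrite gf.
have pi3 (w : Y) : fst (f (g (inr_lin X Y w))) = 0 by rewrite gf.
have pi4 (w : Y) : snd (f (g (inr_lin X Y w))) = w by rewrite gf.
split=> [[a|a]|[a|a] z|[a|a] [b|b] ab z|x].
- exact: d1.
- exact: d1'.
- by apply: etrans (d2 a z); congr (p a _); exact: pi1.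
- by apply: etrans (d2' a z); congr (p' a _); exact: pi4.
- by apply: etrans (d3 a b ab z); congr (p a _); exact: pi1.
- by apply: etrans (linear0 (p a)); congr (p a _); exact: pi3.
- by apply: etrans (linear0 (p' a)); congr (p' a _); exact: pi2.
- by apply: etrans (d3' a b ab z); congr (p' a _); exact: pi4.
- rewrite big_sumType.
  have -> : \sum_a ii (inl a) (pp (inl a) x) = g (inl_lin X Y (fst (f x))).
    by rewrite -[fst (f x)]d4 !linear_sum.
  have -> : \sum_a ii (inr a) (pp (inr a) x) = g (inr_lin X Y (snd (f x))).
    by rewrite -[snd (f x)]d4' !linear_sum.
  rewrite /= -[RHS]fg -(linearD g); congr (g _).
  by rewrite [RHS]surjective_pairing; congr pair; rewrite /= ?addr0 ?add0r.
Qed.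

Lemma indec_summand_exists M : fin_gen M -> ~ is_zero M ->
  exists Z, indecomposable Z /\ direct_summand Z M.
Proof.
move=> fM M0; have [I [Z [i [p [d1 d2 d3 d4]]]]] := decomposition_exists fM.
have [a|nI] := pselect (inhabited I); last first.
  case: M0 => x; rewrite -[LHS]d4 big1 // => a _; by case: nI.
by case: a => a; exists (Z a); split=> //; exists (i a), (p a); exact: d2.
Qed.

Lemma direct_summand_prod X X' Y Y' : direct_summand X X' -> direct_summand Y Y' ->
  direct_summand (X * Y)%type (X' * Y')%type.
Proof.
move=> [i [p ip]] [j [q jq]].
have l1 : linear (fun z : (X * Y)%type => (i z.1, j z.2) : (X' * Y')%type).
  by move=> a x y; rewrite !linearP.
have l2 : linear (fun z : (X' * Y')%type => (p z.1, q z.2) : (X * Y)%type).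
  by move=> a x y; rewrite !linearP.
by exists (mklin l1), (mklin l2) => -[x y] /=; rewrite ip jq.
Qed.

Lemma complement X M : direct_summand X M -> exists Y (f : {linear M -> (X * Y)%type})
  (g : {linear (X * Y)%type -> M}), cancel f g /\ cancel g f.
Proof.
move=> /summand_complement[Y [i [p [_ [f bf]]]]].
by have [g [fg gf]] := bij_inv bf; exists Y, f, g.
Qed.

Lemma iso_summand M N (f : {linear M -> N}) (g : {linear N -> M}) :
  cancel f g -> direct_summand M N.
Proof. by move=> fg; exists f, g. Qed.

(** [rk] only bounds the length from above; this is the exact length. *)
Definition min_rk M r := rk (kmod M) r /\ forall m, (m < r)%N -> ~ rk (kmod M) m.

Lemma min_rk_exists M n : rk (kmod M) n -> exists2 r, (r <= n)%N & min_rk M r.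
Proof.
move=> rM; have [|r /asboolP rr rmin] := @ex_minnP (fun r => `[< rk (kmod M) r >]).
  by exists n; apply/asboolP.
exists r; first by apply: rmin; apply/asboolP.
by split=> // m mr /asboolP /rmin; rewrite leqNgt mr.
Qed.

(** Let [X] be a common summand of largest length. An indecomposable [Z] in the complement of [X] in
    one module is also a summand of the other: inside [X] it would be repeated, against basicness,
    and outside it would enlarge [X]. So both modules are isomorphic to [X]. *)
Lemma basic_unique T T' : fin_gen T -> fin_gen T' -> basic_module T -> basic_module T' ->
  in_add T' T -> in_add T T' -> exists f : {linear T -> T'}, bijective f.
Proof.
move=> fT fT' bT bT' TT' T'T.
have [n rT] := artin_rk artA fT.
pose P r := `[< exists X, [/\ direct_summand X T, direct_summand X T' & min_rk X r] >].
have [||r /asboolP[X [XT XT' minX]] maxr] := @ex_maxnP P n.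
- pose O := {ffun 'I_0 -> T} : lmodType A.
  have O0 : is_zero O by move=> x; apply/ffunP => -[].
  have rO : rk (kmod O) n.
    have [i [p ip]] := zero_summand T O0.
    exact: (rk_inj (i := kmod_map i) (can_inj ip) rT).
  have [r _ mr] := min_rk_exists rO.
  by exists r; apply/asboolP; exists O; split=> //; exact: zero_summand.
- move=> r /asboolP[X [[i [p ip]] _ [_ minX]]].
  rewrite leqNgt; apply/negP => /minX; apply.
  exact: (rk_inj (i := kmod_map i) (can_inj ip) rT).
have key U V : fin_gen U -> basic_module U -> fin_gen V ->
    in_add V U -> direct_summand X U -> direct_summand X V ->
    (forall Z, direct_summand (X * Z)%type U -> direct_summand (X * Z)%type V -> is_zero Z) ->
    exists (f : {linear U -> X}) (g : {linear X -> U}), cancel f g /\ cancel g f.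
  move=> fU bU fV UV XU XV HZ.
  have [Y [f [g [fg gf]]]] := complement XU.
  have XYU : direct_summand (X * Y)%type U := iso_summand gf.
  have fY : fin_gen Y.
    exact: fin_gen_summand (direct_summand_trans (summandr X Y) XYU) fU.
  have [Y0|Y0] := pselect (is_zero Y).
    exists (fst \o f : {linear U -> X}), (g \o inl_lin X Y : {linear X -> U}).
    split=> [u|x] /=; last by rewrite gf.
    by rewrite -[RHS]fg; congr (g _); case: (f u) => x y /=; rewrite [y]Y0.
  have [Z [iZ ZY]] := indec_summand_exists fY Y0.
  have fZ := fin_gen_summand ZY fY.
  have XZU : direct_summand (X * Z)%type U.
    exact: direct_summand_trans (direct_summand_prod (direct_summand_refl X) ZY) XYU.
  have ZU := direct_summand_trans (summandr X Z) XZU.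
  have ZV : direct_summand Z V by apply: (indec_in_add fZ iZ); exact: in_add_summand ZU UV.
  have [Y' [f' [g' [fg' gf']]]] := complement XV.
  have [|ZX|ZY'] := indec_summand2 (X := X) (Y := Y') fZ iZ.
  - exact: direct_summand_trans ZV (iso_summand fg').
  - case: (bU Z iZ); apply: direct_summand_trans XZU.
    exact: direct_summand_prod ZX (direct_summand_refl Z).
  - case: iZ => nZ _; case: nZ; apply: HZ => //.
    apply: direct_summand_trans (iso_summand gf').
    exact: direct_summand_prod (direct_summand_refl X) ZY'.
have HZ Z : direct_summand (X * Z)%type T -> direct_summand (X * Z)%type T' -> is_zero Z.
  move=> h1 h2; apply: contrapT => Z0.
  have [i [p ip]] := h1.
  have [s _ mins] := min_rk_exists (rk_inj (i := kmod_map i) (can_inj ip) rT).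
  have /maxr : P s by apply/asboolP; exists (X * Z)%type.
  have ii : injective (inl_lin X Z) by move=> x y [].
  have ni : ~ surjective (inl_lin X Z).
    by move=> sX; apply: Z0 => z; have [x [_ <-]] := sX (0, z).
  have [m ms rX] := rk_kmod_inj_lt ii ni (proj1 mins).
  by move=> sr; case: minX => _ /(_ m (leq_trans ms sr)).
have [f [g [fg gf]]] := key T T' fT bT fT' TT' XT XT' HZ.
have [f' [g' [fg' gf']]] := key T' T fT' bT' fT T'T XT' XT (fun Z h h' => HZ Z h' h).
exists (g' \o f : {linear T -> T'}), (g \o f') => x /=; first by rewrite gf' fg.
by rewrite gf fg'.
Qed.

(** Among the summands with the same additive closure, one of least length has no repeated summand,
    because one of two copies could be dropped. *)
Lemma basic_version T : fin_gen T ->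
  exists T', [/\ basic_module T', direct_summand T' T & in_add T' T].
Proof.
move=> fT; have [n rT] := artin_rk artA fT.
pose P r := `[< exists X, [/\ direct_summand X T, in_add X T & rk (kmod X) r] >].
have [|r /asboolP[X [XT TX rX]] minr] := @ex_minnP P.
  by exists n; apply/asboolP; exists T; split=> //; [exact: direct_summand_refl | exact: in_add_refl].
exists X; split=> // Z iZ ZZX.
have [Y [f [g [fg gf]]]] := complement ZZX.
pose u := g \o linpair (inr_lin Z Z \o fst : {linear (Z * Y)%type -> (Z * Z)%type})
  (snd : {linear (Z * Y)%type -> Y}) : {linear (Z * Y)%type -> X}.
have ui : injective u by move=> [z y] [z' y'] /= /(can_inj gf)[-> ->].
have nu : ~ surjective u.
  move=> s; case: iZ => nZ _; case: nZ => z; have [[z' y'] /= e] := s (g (z, 0, 0)).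
  by have [<- _] := can_inj gf e.
have [m mr rZY] := rk_kmod_inj_lt ui nu rX.
have ZYX : direct_summand (Z * Y)%type X.
  apply: direct_summand_trans (iso_summand gf).
  exact: direct_summand_prod (summandl Z Z) (direct_summand_refl Y).
have : (r <= m)%N; last by rewrite leqNgt mr.
apply: minr; apply/asboolP; exists (Z * Y)%type; split=> //.
  exact: direct_summand_trans ZYX XT.
apply: in_add_trans TX; apply: in_add_summand (iso_summand fg) _.
have aZ : in_add (Z * Y)%type Z by apply: in_add_summand (summandl Z Y) (in_add_refl _).
have aY : in_add (Z * Y)%type Y by apply: in_add_summand (summandr Z Y) (in_add_refl _).
by apply: in_add_prod => //; exact: in_add_prod.
Qed.

End KrullSchmidt.

(** * Basic modules and basic rings *)

Lemma max_left_ideal_exists (R : pzRingType) (I : R -> Prop) : left_ideal I -> ~ I 1 ->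
  exists m, maximal_left_ideal m /\ forall x, I x -> m x.
Proof.
move=> /(@submod_left_ideal R I) HI I1.
have [m [Hm Im m1 maxm]] := submod_avoiding HI I1.
exists m; split=> //; split=> //; first exact/submod_left_ideal.
by move=> J /submod_left_ideal HJ mJ J1 x Jx; exact: maxm HJ mJ J1 x Jx.
Qed.

Lemma jacobson_idempotent (R : pzRingType) (e : R) : e * e = e -> jacobson e -> e = 0.
Proof.
move=> ee Je.
have HI : left_ideal (fun x => exists r, x = r * (1 - e)).
  split=> [|_ _ [r ->] [s ->]|a _ [r ->]]; first by exists 0; rewrite mul0r.
    by exists (r + s); rewrite mulrDl.
  by exists (a * r); rewrite mulrA.
have [[r rE]|n1] := pselect (exists r, 1 = r * (1 - e)).
  by rewrite -[e]mul1r rE -mulrA mulrBl mul1r ee subrr mulr0.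
have [m [mm Im]] := max_left_ideal_exists HI n1.
have [[_ mD _] m1 _] := mm; case: m1; rewrite -(subrK e 1).
by apply: mD; [apply: Im; exists 1; rewrite mul1r | exact: Je].
Qed.

(** [e] and [f] are isomorphic orthogonal idempotents. If the image of [e] in a division ring is
    invertible, that of [f] is 0, while [e = u * f * v]; hence [e] lies in the radical. *)
Lemma basic_ring_idempotents (R : pzRingType) (e f u v : R) : basic_ring R ->
  e * e = e -> u * v = e -> v * u = f -> e * f = 0 -> e = 0.
Proof.
move=> [n [D [p [divD _ ker]]]] ee uv vu ef; apply: jacobson_idempotent => //.
apply/ker => i; apply: contrapT => pe0.
have [y [ye _]] := (proj2 (divD i)) _ pe0.
have pf0 : p i f = 0.
  by rewrite -[LHS]mul1r -ye -mulrA -rmorphM ef rmorph0 mulr0.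
apply: pe0; rewrite -ee -{2}uv -uv -mulrA [v * _]mulrA vu !rmorphM.
by rewrite pf0 mul0r mulr0.
Qed.

Lemma basic_ring_idempotents_op (S S0 : pzRingType) (e f u v : S) :
  S = S0^c :> pzRingType -> basic_ring S0 ->
  e * e = e -> u * v = e -> v * u = f -> f * e = 0 -> e = 0.
Proof.
move=> ES; subst S => HS ee uv vu fe.
exact: (@basic_ring_idempotents S0 e f v u HS ee uv vu fe).
Qed.

(** A summand [X * X] gives two orthogonal idempotents in End(T), exchanged by the maps between the
    copies. The opposite ring is allowed because the sides alternate along the sequence. *)
Lemma basic_module_of_ring (R S : pzRingType) (T : lmodType R)
    (phi : {rmorphism S -> endo T}) :
  bijective phi -> basic_ring S \/ (exists2 S0 : pzRingType, S = S0^c :> pzRingType & basic_ring S0) ->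
  basic_module T.
Proof.
move=> [psi phiK psiK] HS X iX [i [p ip]].
pose a : {linear X -> T} := i \o inl_lin X X.
pose b : {linear X -> T} := i \o inr_lin X X.
pose a' : {linear T -> X} := fst \o p.
pose b' : {linear T -> X} := snd \o p.
have a'a x : a' (a x) = x by rewrite /= ip.
have b'b x : b' (b x) = x by rewrite /= ip.
have a'b x : a' (b x) = 0 by rewrite /= ip.
have b'a x : b' (a x) = 0 by rewrite /= ip.
pose e := psi (a \o a' : {linear T -> T}).
pose f := psi (b \o b' : {linear T -> T}).
pose u := psi (a \o b' : {linear T -> T}).
pose v := psi (b \o a' : {linear T -> T}).
have eqS s t : phi s = phi t -> s = t := can_inj phiK (x1 := s) (x2 := t).
have ee : e * e = e.
  by apply: eqS; rewrite rmorphM !psiK; apply: linear_ext => t; rewrite /= -/(a' _) ip.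
have uv : u * v = e.
  by apply: eqS; rewrite rmorphM !psiK; apply: linear_ext => t; rewrite /= ip.
have vu : v * u = f.
  by apply: eqS; rewrite rmorphM !psiK; apply: linear_ext => t; rewrite /= ip.
have ef : e * f = 0.
  apply: eqS; rewrite rmorphM !psiK rmorph0; apply: linear_ext => t.
  by rewrite /= ip /= !linear0.
have fe : f * e = 0.
  apply: eqS; rewrite rmorphM !psiK rmorph0; apply: linear_ext => t.
  by rewrite /= ip /= !linear0.
have e0 : e = 0.
  case: HS => [HS|[S0 ES HS]]; first exact: basic_ring_idempotents HS ee uv vu ef.
  exact: (basic_ring_idempotents_op ES HS ee uv vu fe).
case: iX => nX _; case: nX => x; rewrite -[LHS]a'a.
have : phi e = 0 by rewrite e0 rmorph0.
rewrite psiK => e1; have e2 : a (a' (a x)) = 0.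
  exact: (congr1 (fun g : {linear T -> T} => g (a x)) e1).
by rewrite a'a in e2; rewrite e2 linear0.
Qed.

Section QuotientRing.
Variables (E : pzRingType) (K : E -> Prop).
Hypotheses (K0 : K 0) (KD : forall x y, K x -> K y -> K (x + y)).
Hypotheses (KL : forall a x, K x -> K (a * x)) (KR : forall a x, K x -> K (x * a)).
Variables (Q : lmodType E) (p : {linear E^o -> Q}).
Hypotheses (ps : surjective p) (pK : forall x : E, p x = 0 <-> K x).

(** The ring is built on the quotient module already available; the proof of surjectivity is a
    parameter because it supplies the representatives used in the product. *)
Definition qring of surjective p : Type := Q.
HB.instance Definition _ := GRing.Zmodule.on (qring ps).

Definition qrep (q : qring ps) : E := projT1 (cid (ps q)).
Lemma qrepK q : p (qrep q) = q.
Proof. by rewrite /qrep; case: cid. Qed.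

Definition qmul (x y : qring ps) : qring ps := p (qrep x * qrep y).

Lemma eq_qpi (x y : E) : p x = p y <-> K (x - y).
Proof.
rewrite -pK linearB; split=> [->|/eqP]; first by rewrite subrr.
by rewrite subr_eq0 => /eqP.
Qed.

Lemma qmulE (x y : E) : qmul (p x) (p y) = p (x * y).
Proof.
apply/eq_qpi; set x' := qrep _; set y' := qrep _.
have -> : x' * y' - x * y = x' * (y' - y) + (x' - x) * y.
  by rewrite mulrBr mulrBl addrA subrK.
by apply: KD; [apply: KL | apply: KR]; apply/eq_qpi; rewrite qrepK.
Qed.

Fact qmulA : associative qmul.
Proof.
move=> x y z; have [a <-] := ps x; have [b <-] := ps y; have [c <-] := ps z.
by rewrite !qmulE mulrA.
Qed.
Fact qmul1l : left_id (p (1 : E) : qring ps) qmul.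
Proof. by move=> x; have [a <-] := ps x; rewrite qmulE mul1r. Qed.
Fact qmul1r : right_id (p (1 : E) : qring ps) qmul.
Proof. by move=> x; have [a <-] := ps x; rewrite qmulE mulr1. Qed.
Fact qmulDl : left_distributive qmul +%R.
Proof.
move=> x y z; have [a <-] := ps x; have [b <-] := ps y; have [c <-] := ps z.
by rewrite -[_ + _ in LHS](linearD p) !qmulE -[RHS](linearD p) mulrDl.
Qed.
Fact qmulDr : right_distributive qmul +%R.
Proof.
move=> x y z; have [a <-] := ps x; have [b <-] := ps y; have [c <-] := ps z.
by rewrite -[_ + _ in LHS](linearD p) !qmulE -[RHS](linearD p) mulrDr.
Qed.
HB.instance Definition _ := GRing.Zmodule_isPzRing.Build (qring ps)
  qmulA qmul1l qmul1r qmulDl qmulDr.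

Definition qpi (x : E) : qring ps := p x.
Fact qpi_zmod : zmod_morphism qpi.
Proof. by move=> a b; exact: (linearB p). Qed.
Fact qpi_monoid : monoid_morphism qpi.
Proof. by split=> // a b; exact: (esym (qmulE a b)). Qed.

Lemma quotient_ring_of_module : exists (D : pzRingType) (pi : {rmorphism E -> D}),
  surjective pi /\ forall x, pi x = 0 <-> K x.
Proof.
exists (qring ps : pzRingType).
exists (HB.pack_for {rmorphism E -> qring ps} qpi
    (GRing.isZmodMorphism.Build _ _ _ qpi_zmod)
    (GRing.isMonoidMorphism.Build _ _ _ qpi_monoid)).
by split=> // x; have [a <-] := ps x; exists a.
Qed.

End QuotientRing.

Section BasicRing.
Variable E : pzRingType.

Definition two_sided (K : E -> Prop) := [/\ K 0, forall x y, K x -> K y -> K (x + y),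
  forall a x, K x -> K (a * x) & forall a x, K x -> K (x * a)].

Lemma quotient_ring_exists (K : E -> Prop) : two_sided K ->
  exists (D : pzRingType) (pi : {rmorphism E -> D}),
  surjective pi /\ forall x, pi x = 0 <-> K x.
Proof.
move=> [K0 KD KL KR].
have HK : submod (K : E^o -> Prop).
  by split=> // a x y Kx Ky; apply: KD => //; exact: KL.
have [Q [p [ps pK]]] := quotient_exists HK.
exact (quotient_ring_of_module KD KL KR ps pK).
Qed.

(** The common intersection lies in the radical because [1 - x] has a left inverse there. Conversely
    each [K i] is itself a maximal left ideal, its quotient being a division ring. *)
Lemma basic_ring_of_ideals n (K : 'I_n -> E -> Prop) :
  (forall i, two_sided (K i)) -> (forall i, ~ K i 1) ->
  (forall i x, ~ K i x -> exists y, K i (y * x - 1) /\ K i (x * y - 1)) ->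
  (forall d : 'I_n -> E, exists x, forall i, K i (x - d i)) ->
  (forall x, (forall i, K i x) -> exists y, y * (1 - x) = 1) ->
  basic_ring E.
Proof.
move=> K2 K1 Kdiv Kcrt Kinv.
have KN i x : K i x -> K i (- x) by case: (K2 i) => _ _ KL _ Kx; rewrite -mulN1r; exact: KL.
have [D DP] := choice (fun i => quotient_ring_exists (K2 i)).
pose p i : {rmorphism E -> D i} := projT1 (cid (DP i)).
have pP i : surjective (p i) /\ forall x, p i x = 0 <-> K i x := projT2 (cid (DP i)).
exists n, D, p; split=> [i|d|x].
- have [ps pK] := pP i; split=> [e|y y0].
    by apply: (K1 i); apply/pK; rewrite rmorph1.
  have [x xE] := ps y; rewrite -xE in y0 *.
  have [|z [z1 z2]] := Kdiv i x; first by move/pK.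
  exists (p i z); split; apply/eqP; rewrite -subr_eq0 -(rmorph1 (p i)) -rmorphM -rmorphB;
    by apply/eqP/pK.
- have [r rP] : exists r : 'I_n -> E, forall i, p i (r i) = d i.
    by have [r rP] := choice (fun i => proj1 (pP i) (d i)); exists r.
  have [x xP] := Kcrt r; exists x => i; rewrite -rP; apply/eqP.
  by rewrite -subr_eq0 -rmorphB; apply/eqP/(proj2 (pP i)).
- have [KK|nK] := pselect (forall i, K i x); split=> h.
  + by move=> i; apply/(proj2 (pP i)).
  + move=> I mI; apply: contrapT => Ix; have [[I0 ID IL] I1 maxI] := mI.
    pose J z := exists i r, I i /\ z = i + r * x.
    have HJ : left_ideal J.
      split=> [|_ _ [i [r [Ii ->]]] [j [s [Ij ->]]]|a _ [i [r [Ii ->]]]].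
      - by exists 0, 0; rewrite mul0r addr0.
      - by exists (i + j), (r + s); split; [exact: ID | rewrite mulrDl addrACA].
      - by exists (a * i), (a * r); split; [exact: IL | rewrite mulrDr mulrA].
    have [J1|nJ1] := pselect (J 1); last first.
      apply: Ix; apply: (maxI J) => // [y Iy|]; first by exists y, 0; rewrite mul0r addr0.
      by exists 0, 1; rewrite mul1r add0r.
    have [i [r [Ii e1]]] := J1; apply: I1.
    have [|y yE] := Kinv (r * x).
      by move=> j; case: (K2 j) => _ _ KL _; exact: KL.
    by rewrite -yE e1 addrK; exact: IL.
  + case: nK => i; apply: h; split.
    * by case: (K2 i) => K0 KD KL _; split.
    * exact: K1.
    * move=> J [J0 JD JL] KJ J1 y Jy; apply: contrapT => nKy; apply: J1.
      have [z [z1 _]] := Kdiv i y nKy.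
      have -> : 1 = z * y + (- (z * y - 1)) by rewrite opprB addrC subrK.
      by apply: JD; [exact: JL | apply/KJ/KN].
  + by case: nK => i; apply/(proj2 (pP i)).
Qed.

End BasicRing.

(** * Endomorphism rings of basic modules are basic *)

Section EndoBasic.
Variables (k : comPzRingType) (A : kalg k).
Hypothesis artA : artin_algebra A.
Implicit Types M N T X Y Z : lmodType A.

Lemma inj_bij M (h : {linear M -> M}) : fin_gen M -> injective h -> bijective h.
Proof.
move=> fM ih; have [n [e [g [n0 [ee he ge hg]]]]] := fitting artA h fM.
have ihn : injective (iter n h) by elim: n {he ge hg n0} => // n IH x y /ih /IH.
apply: inj_surj_bij => // y; case: n n0 ihn he hg {ge} => // n _ ihn he hg.
by exists (iter n h (g y)); rewrite -[LHS]/(iter n.+1 h (g y)) hg; apply: ihn; rewrite he.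
Qed.

Lemma indec_surj_bij Z (h : {linear Z -> Z}) : fin_gen Z -> indecomposable Z ->
  surjective h -> bijective h.
Proof.
move=> fZ iZ sh; have [[n hn]|//] := indec_nilp_or_bij artA h fZ iZ.
case: iZ => nZ _; case: nZ => x.
have [y <-] : exists y, iter n h y = x.
  elim: n {hn} x => [|n IH] x; first by exists x.
  by have [z <-] := sh x; have [y <-] := IH z; exists y.
exact: hn.
Qed.

Lemma indec_iso Z Z' (u : {linear Z -> Z'}) (v : {linear Z' -> Z}) :
  indecomposable Z -> indecomposable Z' ->
  bijective (v \o u : {linear Z -> Z}) -> bijective u /\ bijective v.
Proof.
move=> [nZ _] iZ' /bij_inv[w [wK Kw]].
pose e : {linear Z' -> Z'} := (u \o w) \o v.
have ee x : e (e x) = e x by rewrite /= [v (u _)]Kw.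
have [e0|e1] := indec_idempotent iZ' ee.
  case: nZ => x; have ux : u x = 0.
    by rewrite -[RHS](e0 (u x)); congr (u _); exact: (esym (wK x)).
  by rewrite -[LHS]wK /= ux !linear0.
have bu : bijective u.
  exists (w \o v) => x /=; [exact: wK | exact: e1].
split=> //; apply: (eq_bij (f := (v \o u) \o (w \o v))) => [|x /=]; last by rewrite [u _]e1.
apply: bij_comp; first by exists w.
by exists u => x /=; [exact: e1 | exact: wK].
Qed.

Section Decomposed.
Variables (T : lmodType A) (I : finType) (Z : I -> lmodType A).
Variables (i : forall a, {linear Z a -> T}) (p : forall a, {linear T -> Z a}).
Hypotheses (fT : fin_gen T) (bT : basic_module T) (dT : decomposition i p).

Let fZ a : fin_gen (Z a).
Proof. by case: dT => _ d2 _ _; apply: fin_gen_summand fT; exists (i a), (p a); exact: d2. Qed.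
Let iZ a : indecomposable (Z a). Proof. by case: dT. Qed.

Definition diag (a : I) (x : endo T) : {linear Z a -> Z a} :=
  p a \o ((x : {linear T -> T}) \o i a).
(** Modulo this set, End(T) becomes End(Z a) modulo its radical. It is an ideal only because
    distinct [Z a] are not isomorphic when [T] is basic. *)
Definition nonunit_at (a : I) (x : endo T) := ~ bijective (diag a x).

Lemma sum_endo (J : finType) (x : J -> endo T) t :
  (\sum_j x j : {linear T -> T}) t = \sum_j (x j : {linear T -> T}) t.
Proof. by elim/big_rec2: _ => // j y f _ <-. Qed.

Lemma cross_not_bij a b (u : {linear Z a -> Z b}) (v : {linear Z b -> Z a}) :
  a != b -> ~ bijective (v \o u : {linear Z a -> Z a}).
Proof.
move=> ab bij; have [_ d2 d3 _] := dT.
have [bu _] := indec_iso (iZ a) (iZ b) bij; have [w [uw wu]] := bij_inv bu.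
apply: (bT (iZ a)).
exists (lincopair (i a) (i b \o u : {linear Z a -> T})).
exists (linpair (p a) (w \o p b : {linear T -> Z a})) => -[x y] /=.
by rewrite !linearD d2 (d3 _ _ ab) (d3 b a) 1?eq_sym // d2 linear0 uw addr0 add0r.
Qed.

Lemma sum_diag a (x y : endo T) z : diag a (x * y) z =
  \sum_b ((p a \o (x : {linear T -> T})) \o i b) (((p b \o (y : {linear T -> T})) \o i a) z).
Proof.
have [_ _ _ d4] := dT.
by rewrite /= -[in LHS](d4 ((y : {linear T -> T}) (i a z))) !linear_sum.
Qed.

(** The diagonal entry of a product is the sum over [b] of the composites through [Z b]. By locality
    one of these is bijective, and then [b = a] because [T] is basic. *)
Lemma bij_diag_mul a (x y : endo T) : bijective (diag a (x * y)) ->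
  bijective (diag a x \o diag a y).
Proof.
move=> /bij_inv[w [wK Kw]].
have [z|b bb] := @indec_local _ _ artA (Z a) I (fun b => w \o
  (((p a \o (x : {linear T -> T})) \o i b) \o ((p b \o (y : {linear T -> T})) \o i a))
  : {linear Z a -> Z a}) (fZ a) (iZ a).
  by rewrite -[RHS]wK sum_diag linear_sum.
have bij : bijective (((p a \o (x : {linear T -> T})) \o i b) \o
    ((p b \o (y : {linear T -> T})) \o i a) : {linear Z a -> Z a}).
  case: bb => w' w'K Kw'; exists (w' \o w) => z /=; first exact: w'K.
  by apply: (can_inj Kw); exact: Kw'.
have [ab|ab] := eqVneq a b; last by case: (cross_not_bij ab bij).
by subst b.
Qed.

Lemma nonunit_two_sided a : two_sided (nonunit_at a).
Proof.
split=> [|x y Kx Ky|x y Ky|x y Ky].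
- case=> g gK _; case: (iZ a) => nZ _; case: nZ => z.
  by rewrite -[LHS]gK -[RHS]gK /= !linear0.
- move=> bij; have [|//|//] := @indec_local2 _ _ artA _ (diag a x) (diag a y) (fZ a) (iZ a).
  by apply: (eq_bij bij) => z; rewrite /= linearD.
- move=> /bij_diag_mul[w wK Kw]; apply: Ky; apply: (indec_inj_bij artA) => // z z' e.
  by apply: (can_inj wK); exact: (congr1 (diag a x) e).
- move=> /bij_diag_mul[w wK Kw]; apply: Ky; apply: indec_surj_bij => // z.
  by exists (diag a x (w z)); exact: Kw.
Qed.

(** The Fitting idempotent [e] of [x] factors through a power of [x], so it lies in every
    [nonunit_at] ideal. A nonzero image of [e] would contain a summand isomorphic to some [Z a],
    contradicting membership at [a]. Hence [e = 0], [x] is nilpotent, and [1 - x] is injective. *)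
Lemma nonunit_nil x : (forall a, nonunit_at a x) -> bijective ((1 : endo T) - x : {linear T -> T}).
Proof.
move=> Kx; have [n [e [g [n0 [ee he ge hg]]]]] := fitting artA (x : {linear T -> T}) fT.
have Kn m : (0 < m)%N -> forall a, nonunit_at a (iterlin x m : endo T).
  case: m => // m _ a; have [_ _ _ KR] := nonunit_two_sided a.
  have -> : (iterlin x m.+1 : endo T) = x * (iterlin x m : endo T) by apply: linear_ext.
  exact: KR.
have Ke a : nonunit_at a (e : endo T).
  have [_ _ KL _] := nonunit_two_sided a.
  have -> : (e : endo T) = (g : endo T) * (iterlin x n : endo T).
    by apply: linear_ext => t; rewrite -ge.
  exact/KL/Kn.
have e0 t : e t = 0.
  apply: contrapT => et.
  have [W [j [ji jP]]] := sub_exists (submod_im e).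
  have [y|q qE] := factor_inj (f := e) ji; first by apply/jP; exists y.
  have ej w : e (j w) = j w by have /jP[y <-] : exists y, j y = j w; [exists w | rewrite ee].
  have qj w : q (j w) = w by apply: ji; rewrite qE ej.
  have fW : fin_gen W by apply: fin_gen_summand fT; exists j, q.
  have nW : ~ is_zero W.
    by move=> W0; apply: et; rewrite -qE (W0 (q t)) linear0.
  have [V [iV [c [d cd]]]] := indec_summand_exists artA fW nW.
  have fV : fin_gen V by apply: fin_gen_summand fW; exists c, d.
  have [_ _ _ d4] := dT.
  have [z|a ba] := @indec_local _ _ artA V I (fun a =>
    ((d \o q) \o i a) \o (p a \o (j \o c)) : {linear V -> V}) fV iV.
    rewrite -[RHS]cd -[c z in RHS]qj -[j _ in RHS]d4 !linear_sum.
    by [].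
  have [bu bv] := indec_iso iV (iZ a) ba.
  have [_ _ KL _] := nonunit_two_sided a.
  have := KL ((j \o c) \o (d \o q) : {linear T -> T}) (e : endo T) (Ke a); apply.
  apply: (eq_bij (bij_comp bu bv)) => z /=.
  by congr (p a (j (c (d _)))); apply: ji; rewrite !qE ee.
apply: inj_bij => //; apply: inj0 => t /= /eqP; rewrite subr_eq0 => /eqP tx.
have : iter n x t = t by elim: n {n0 he ge hg Kn} => //= n ->; rewrite -tx.
by move=> <-; rewrite -he e0; exact: (linear0 (iterlin x n)).
Qed.

Lemma nonunit_conditions (K := nonunit_at) :
  [/\ forall a, ~ K a 1,
      forall a x, ~ K a x -> exists y, K a (y * x - 1) /\ K a (x * y - 1),
      forall d : I -> endo T, exists x, forall a, K a (x - d a) &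
      forall x, (forall a, K a x) -> exists y, y * (1 - x) = 1 /\ (1 - x) * y = 1].
Proof.
have [_ d2 d3 _] := dT.
have K0 a x : (forall z, diag a x z = 0) -> K a x.
  move=> h [g gK _]; case: (iZ a) => nZ _; case: nZ => z.
  by rewrite -[LHS]gK -[RHS]gK !h.
split=> [a|a x /contrapT/bij_inv[w [wK Kw]]|d|x Kx].
- by apply; exists id => z; exact: d2.
- exists (i a \o (w \o p a) : {linear T -> T}); split; apply: K0 => z.
    rewrite /= linearB /= d2 d2; apply/eqP; rewrite subr_eq0; apply/eqP.
    exact: wK.
  rewrite /= d2 linearB d2; apply/eqP; rewrite subr_eq0; apply/eqP.
  exact: Kw.
- exists (\sum_a ((i a \o (diag a (d a) \o p a) : {linear T -> T}) : endo T)) => b.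
  apply: K0 => z; rewrite /= linearB sum_endo linear_sum (bigD1 b) //= d2 d2 big1.
    by rewrite addr0 subrr.
  by move=> a ab; rewrite (d3 b a) // eq_sym.
- have [g [gK Kg]] := bij_inv (nonunit_nil Kx).
  by exists g; split; apply: linear_ext => t; [exact: gK | exact: Kg].
Qed.

End Decomposed.

Lemma endo_basic T : fin_gen T -> basic_module T -> basic_ring (endo T) /\ basic_ring (endo T)^c.
Proof.
move=> fT bT; have [I [Z [i [p dT]]]] := decomposition_exists artA fT.
have K2 := nonunit_two_sided fT bT dT.
have [K1 Kdiv Kcrt Kinv] := nonunit_conditions fT bT dT.
have crt d : exists x, forall j : 'I_#|I|, nonunit_at i p (enum_val j) (x - d j).
  have [x xP] := Kcrt (fun a => d (enum_rank a)); exists x => j.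
  by have := xP (enum_val j); rewrite enum_valK.
have all x : (forall j : 'I_#|I|, nonunit_at i p (enum_val j) x) -> forall a, nonunit_at i p a x.
  by move=> h a; have := h (enum_rank a); rewrite enum_rankK.
split.
  apply: (@basic_ring_of_ideals (endo T) #|I| (fun j => nonunit_at i p (enum_val j))).
  - by move=> j; exact: K2.
  - by move=> j; exact: K1.
  - by move=> j x; exact: Kdiv.
  - exact: crt.
  - by move=> x h; have [y [y1 _]] := Kinv x (all x h); exists y.
apply: (@basic_ring_of_ideals (endo T)^c #|I| (fun j => nonunit_at i p (enum_val j))).
- by move=> j; case: (K2 (enum_val j)) => h1 h2 h3 h4; split.
- by move=> j; exact: K1.
- by move=> j x /Kdiv[y [y1 y2]]; exists y.
- exact: crt.
- by move=> x h; have [y [_ y2]] := Kinv x (all x h); exists y.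
Qed.

End EndoBasic.

(** * Injective envelopes, special approximations *)

Section SecondVariable.
Variable R : pzRingType.
Implicit Types A B C K M N P Q X Y Z : lmodType R.

(** Pulling the sequence back along [f] gives an extension of [K] by [Y], which splits. *)
Lemma ext1_lift K Y X M (i : {linear Y -> X}) (p : {linear X -> M}) (f : {linear K -> M}) :
  ses i p -> ext1 K Y -> exists g : {linear K -> X}, forall x, p (g x) = f x.
Proof.
move=> ip KY; have [Q [j [q [r [jq e1 _ _ _]]]]] := ses_pullback f ip.
have [t tP] := KY _ _ _ _ (idfun : {linear Y -> Y}) jq.
have [s [sq _]] := ses_retraction jq tP.
by exists (r \o s : {linear K -> X}) => x; rewrite /= e1 sq.
Qed.

Lemma ext1_middle_r Z N' N N'' (i : {linear N' -> N}) (p : {linear N -> N''}) :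
  ses i p -> fin_gen Z -> ext1 Z N' -> ext1 Z N'' -> ext1 Z N.
Proof.
move=> ip fZ H' H''; have [K [P [j [q [jq fP]]]]] := fgproj_cover fZ.
apply: (ext1_of_proj jq (proj2 fP)) => f.
have [g'' g''P] := H'' _ _ _ _ (p \o f : {linear K -> N''}) jq.
have [g gP] := (proj2 fP) _ _ p g'' (ses_surj ip).
have ld : linear (fun a => f a - g (j a)).
  by move=> a x y; rewrite (linearP f) (linearP j) (linearP g) scalerBr opprD addrACA.
have [x|d dP] := factor_ker (f := mklin ld) ip.
  by rewrite /= linearB gP g''P subrr.
have [h hP] := H' _ _ _ _ d jq.
exists (g \+ (i \o h) : {linear P -> N}) => a; rewrite /= hP dP /=.
by rewrite addrC subrK.
Qed.

Lemma extn_shift_r n W N' N N'' (i : {linear N' -> N}) (p : {linear N -> N''}) :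
  ses i p -> fin_gen W -> noeth R ->
  extn n W N -> extn n.+1 W N' -> extn n W N''.
Proof.
move=> ip + noethR; elim: n W => [|n IH] W fW HN HN'.
  have [K [P [j [q [jq fP]]]]] := fgproj_cover fW.
  apply: (ext1_of_proj jq (proj2 fP)) => f.
  have [f' f'P] := ext1_lift f ip (HN' _ _ _ _ jq fP).
  have [g gP] := HN _ _ _ _ f' jq.
  by exists (p \o g : {linear P -> N''}) => a; rewrite /= gP f'P.
move=> K P j q jq fP; apply: IH.
- exact: noethR (proj1 fP) (ses_inj jq).
- exact: HN jq fP.
- exact: HN' jq fP.
Qed.

End SecondVariable.

Section CompositionFamily.
Variable R : pzRingType.

(* [cfam I]: there is a finite chain of left ideals from I to R with simple
   quotients. *)
Inductive cfam : (R^o -> Prop) -> Prop :=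
| cfam_all (I : R^o -> Prop) : (forall x, I x) -> cfam I
| cfam_step (I : R^o -> Prop) (r : R) : submod I -> ~ I r ->
    (forall s : R, I (s * r) \/ exists u, I (r - u * s * r)) ->
    cfam (addm I (span1 (r : R^o))) -> cfam I.

End CompositionFamily.

Section Existence.
Variables (k : comPzRingType) (A : kalg k).
Hypothesis artA : artin_algebra A.
Let noethA := artin_noeth artA.
Implicit Types K L M N P T X Y Z W : lmodType A.

(** The next [r] is chosen outside [I] with [I + A r] of least length, which makes its quotient by
    [I] simple. *)
Lemma cfam_exists (I : A^o -> Prop) : submod I -> cfam I.
Proof.
have [n [l [Hl ln]]] := artin_rk artA (proj1 (fgproj_regular A)).
have kl (B C : A^o -> Prop) : submod B -> submod C -> subm B C ->
    (l B <= l C)%N /\ (l B = l C -> subm C B).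
  move=> HB HC; exact: Hl (kmod_submod HB) (kmod_submod HC).
have [m] := ubnP (n - l I); elim: m I => // m IH I lI HI.
have [all|nall] := pselect (forall x, I x); first exact: cfam_all.
have [r0 nr0] : exists r, ~ I r by apply/existsNP.
pose P q := `[< exists r : A^o, ~ I r /\ l (addm I (span1 r)) = q >].
have [|q /asboolP[r [nr rq]] qmin] := @ex_minnP P.
  by exists (l (addm I (span1 r0))); apply/asboolP; exists r0.
have HIr (s : A^o) := submod_addm HI (submod_span1 s).
apply: (@cfam_step A I r) => // [s|].
  have [Isr|nIsr] := pselect (I ((s : A) * r)); [by left | right].
  pose sr : A^o := (s : A) * r.
  have sub : subm (addm I (span1 sr)) (addm I (span1 r)).
    move=> _ [a [_ [Ia [c ->] ->]]]; exists a, ((c * s) *: r); split=> //.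
      by exists (c * s).
    by rewrite -scalerA.
  have [h1 h2] := kl _ _ (HIr sr) (HIr r) sub.
  have [|a [_ [Ia [u ->] rE]]] := h2 _ r (subm_addr HI (span1_id r)).
    apply/eqP; rewrite eqn_leq h1 rq; apply: qmin; apply/asboolP; by exists sr.
  exists u; rewrite {1}rE -mulrA.
  by rewrite -[_ * (s * r)]/(u *: sr) addrK.
apply: IH => //.
have [h1 h2] := kl _ _ HI (HIr r) (subm_addl (submod_span1 r)).
have lt : (l I < l (addm I (span1 r)))%N.
  rewrite ltn_neqAle h1 andbT; apply/eqP => /h2 h; apply: nr; apply: h.
  exact: subm_addr HI _ (span1_id r).
have top : (l (addm I (span1 r)) <= n)%N.
  by apply: leq_trans ln; case: (kl _ _ (HIr r) (submodT _) (fun _ _ => Logic.I)).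
rewrite -ltnS (leq_trans _ lI) // ltnS ltn_sub2l //; exact: leq_trans lt top.
Qed.

Definition essential M M' (i : {linear M -> M'}) :=
  forall x, x <> 0 -> exists a m, a *: x <> 0 /\ i m = a *: x.

(** Climb a chain of left ideals. On elements killed by [I], multiplication by [r] lands in [M],
    which costs at most the length of [M], and its kernel is killed by the next ideal [I + A r]. The
    bound depends only on the chain and on [M]. *)
Lemma essential_bound (I : A^o -> Prop) M m : cfam I -> rk (kmod M) m ->
  exists b, forall M' (i : {linear M -> M'}), injective i -> essential i ->
  forall (K : lmodType k) (j : {linear K -> kmod M'}), injective j ->
  (forall x a, I a -> (a : A) *: (j x : M') = 0) -> rk K b.
Proof.
move=> cI rM; elim: cI => {I} [I all|I r HI nr simp _ [b bP]].
  exists 0%N => M' i ii ei K j ji ann.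
  have K0 (x : K) : x = 0.
    by apply: ji; rewrite linear0 -[j x]scale1r; apply: ann.
  by exists (fun _ => 0%N); split=> // B C [B0 _] _ _; split=> // _ x _; rewrite (K0 x).
exists (b + m)%N => M' i ii ei K j ji ann.
(* Multiplication by [r] is only [k]-linear, which is why [K] is a module over [k]. *)
have lt : linear (fun x : K => (r *: (j x : M') : kmod M')).
  move=> c x y; rewrite linearP scalerDr; congr (_ + _).
  rewrite -[c *: j x]/(kalg_map A c *: (j x : M')) -[RHS]/(kalg_map A c *: (r *: (j x : M'))).
  by rewrite !scalerA kalg_mapC.
(* As [I] kills [j x], the module generated by [r *: j x] is zero or simple; an essential submodule
   contains it. *)
have [x|t tP] := factor_inj (f := mklin lt) (i := kmod_map i) ii.
  have [rx0|rx0] := pselect (r *: (j x : M') = 0).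
    by exists 0; rewrite linear0; exact: (esym rx0).
  have [a [m' [ax m'E]]] := ei _ rx0.
  have [Iar|[u Iu]] := simp a.
    by case: ax; rewrite scalerA; exact: ann.
  have e : (r - u * a * r) *: (j x : M') = 0 by apply: ann.
  exists (u *: m' : M); transitivity (u *: (a *: (r *: (j x : M')))).
    by rewrite /= linearZ /= m'E.
  have e' : r *: (j x : M') = u *: (a *: (r *: (j x : M'))).
    by apply: subr0_eq; rewrite !scalerA -scalerBl.
  exact: (esym e').
have [C [c [ci cP]]] := sub_exists (submod_im t).
have [x|q qE] := factor_inj (f := t) ci; first by apply/cP; exists x.
have sq : surjective q.
  by move=> y; have /cP[x xE] : exists z, c z = c y; [exists y | exists x; apply: ci; rewrite qE].
have [K' [e eq]] := ses_ker sq.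
apply: (rk_ext eq); last exact: rk_inj ci rM.
apply: (bP M' i ii ei K' (j \o e : {linear K' -> kmod M'})).
  by move=> x y /= /ji /(ses_inj eq).
move=> x _ [a [_ [Ia [s ->] ->]]] /=; rewrite scalerDl ann // add0r -scalerA.
have : t (e x) = 0 by rewrite -qE (ses0 x eq) linear0.
move=> t0; have := tP (e x); rewrite t0 linear0 /= => <-.
by rewrite scaler0.
Qed.

(** Take an essential extension of largest length. To split an extension [Q] of it, divide by a
    submodule [C] that is largest among those meeting it in 0: the result is again essential over
    [M], so by maximality nothing was added. *)
Lemma injective_envelope M : fin_gen M ->
  exists (I : lmodType A) (i : {linear M -> I}), [/\ fin_gen I, injective i & forall N, fin_gen N -> ext1 N I].
Proof.
move=> fM; have [m rM] := artin_rk artA fM.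
have H0 : submod (fun x : A^o => x = 0) by split=> // a x y -> ->; rewrite scaler0 addr0.
have [b bP] := essential_bound (cfam_exists H0) rM.
have ess_rk M' (i : {linear M -> M'}) : injective i -> essential i -> rk (kmod M') b.
  move=> ii ei; apply: (bP M' i ii ei (kmod M') idfun) => // x a ->.
  exact: scale0r.
pose P r := `[< exists M' (i : {linear M -> M'}),
  [/\ fin_gen M', injective i, essential i & min_rk M' r] >].
have [||r /asboolP[I [i [fI ii ei mI]]] maxr] := @ex_maxnP P b.
- have [r _ mr] := min_rk_exists rM; exists r; apply/asboolP.
  exists M, idfun; split=> // x x0; exists 1, x.
  by rewrite scale1r.
- move=> r /asboolP[M' [i [_ ii ei [_ mr]]]].
  by rewrite leqNgt; apply/negP => /mr; apply; exact: ess_rk ii ei.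
exists I, i; split=> // N fN.
have [K [P0 [j [q [jq fP]]]]] := fgproj_cover fN.
apply: (ext1_of_proj jq (proj2 fP)) => f.
have [Q [u [v [w [uv e1 e2 e3]]]]] := ses_pushout f jq.
have fQ := fin_gen_ext uv fI fN.
have [n [l [Hl ln]]] := artin_rk artA fQ.
have ui := ses_inj uv.
pose disj (C : Q -> Prop) := submod C /\ forall x, C (u x) -> x = 0.
pose PC s := `[< exists C, disj C /\ l C = s >].
have [||s /asboolP[C [[HC C0] Cs]] maxs] := @ex_maxnP PC n.
- exists (l (fun y => y = 0)); apply/asboolP; exists (fun y => y = 0); split=> //; split.
    by split=> // a x y -> ->; rewrite scaler0 addr0.
  by move=> x ux; apply: ui; rewrite ux linear0.
- move=> s /asboolP[C [[HC _] <-]]; apply: leq_trans ln.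
  by case: (Hl _ _ (kmod_submod HC) (submodT _) (fun _ _ => Logic.I)).
have [QC [p [ps pk]]] := quotient_exists HC.
pose pu : {linear I -> QC} := p \o u.
have pui : injective pu by apply: inj0 => x /pk; exact: C0.
have essC y : y <> 0 -> exists a x, a *: y <> 0 /\ pu x = a *: y.
  have [z <-] := ps y => pz.
  have HCz := submod_addm HC (submod_span1 z).
  have [[x [Cx x0]]|nx] := pselect (exists x, addm C (span1 z) (u x) /\ x <> 0).
    have [c [_ [Cc [a ->] uE]]] := Cx; exists a, x.
    have pux : pu x = a *: p z.
      by rewrite /pu /= uE linearD linearZ /= (_ : p c = 0) ?add0r //; apply/pk.
    split=> // az; apply: x0; apply: pui; rewrite pux az linear0.
    by [].
  case: pz; apply/pk.
  have [h1 h2] := Hl _ _ (kmod_submod HC) (kmod_submod HCz) (subm_addl (submod_span1 z)).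
  apply: h2; last by apply: (subm_addr HC); exact: span1_id.
  apply/eqP; rewrite eqn_leq h1 Cs; apply: maxs; apply/asboolP.
  exists (addm C (span1 z)); split=> //; split=> // x Cx.
  by apply: contrapT => x0; apply: nx; exists x.
have fQC := fin_gen_surj ps fQ.
have ci : injective (pu \o i : {linear M -> QC}) by move=> x y /= /pui /ii.
have ec : essential (pu \o i : {linear M -> QC}).
  move=> y /essC[a [x [ay xE]]].
  have x0 : x <> 0 by move=> x0; apply: ay; rewrite -xE x0 linear0.
  have [b' [m' [bx m'E]]] := ei x x0; exists (b' * a), m'.
  rewrite -scalerA -xE -linearZ /= -m'E; split=> //.
  by move=> h; apply: bx; rewrite -m'E; apply: pui; rewrite linear0.
have [s' _ ms'] := min_rk_exists (ess_rk QC _ ci ec).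
have /maxr s'r : P s' by apply/asboolP; exists QC, (pu \o i : {linear M -> QC}).
have pus : surjective pu.
  apply: contrapT => ns; have [m' m's' rm'] := rk_kmod_inj_lt pui ns (proj1 ms').
  by case: mI => _ /(_ m' (leq_trans m's' s'r)).
have [g [gK Kg]] := bij_inv (inj_surj_bij pui pus).
exists (g \o (p \o w) : {linear P0 -> I}) => a /=.
by rewrite e1; exact: gK.
Qed.

Hypothesis HC : contravariantly_finite A.

Definition Yclass Y := forall X, fpd X -> ext1 X Y.

Lemma special_approx M : fin_gen M -> exists Y X (i : {linear Y -> X}) (phi : {linear X -> M}),
  [/\ ses i phi, fpd X & Yclass Y].
Proof.
move=> fM.
pose approx X (phi : {linear X -> M}) := forall Z (f : {linear Z -> M}), fpd Z ->
  exists g : {linear Z -> X}, forall z, f z = phi (g z).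
pose P r := `[< exists X (phi : {linear X -> M}), [/\ fpd X, approx X phi & rk (kmod X) r] >].
have [|r /asboolP[X [phi [fX aX rX]]] minr] := @ex_minnP P.
  have [X [phi [fX aX]]] := HC fM; move/(fin_proj_dimE noethA): fX => fX.
  have [r rX] := artin_rk artA (proj1 fX).
  exists r; apply/asboolP; exists X, phi; split=> // Z f /(fin_proj_dimE noethA); exact: aX.
have ps : surjective phi.
  have [n [p ps]] := fin_gen_free_cover fM; move=> m; have [y <-] := ps m.
  have [g gP] := aX _ p (fpd_proj (fgproj_free A n)).
  by exists (g y).
(* The image of the Fitting idempotent of [h] still approximates [M], so by least length it is all
   of [X]. *)
have minimal (h : {linear X -> X}) : (forall x, phi (h x) = phi x) -> bijective h.
  move=> ph; have [n [e [g [n0 [ee he ge hg]]]]] := fitting artA h (proj1 fX).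
  have phn x m : phi (iter m h x) = phi x by elim: m => //= m IH; rewrite ph.
  have pe x : phi (e x) = phi x by rewrite -(phn _ n) he phn.
  have [W [j [ji jP]]] := sub_exists (submod_im e).
  have [x|q qE] := factor_inj (f := e) ji; first by apply/jP; exists x.
  have ej w : e (j w) = j w by have /jP[y <-] : exists y, j y = j w; [exists w | rewrite ee].
  have qj w : q (j w) = w by apply: ji; rewrite qE ej.
  have fW : fpd W by apply: (fpd_summand noethA) fX; exists j, q.
  have js : surjective j.
    apply: contrapT => nj; have [m mr rW] := rk_kmod_inj_lt ji nj rX.
    have : (r <= m)%N; last by rewrite leqNgt mr.
    apply: minr; apply/asboolP; exists W, (phi \o j : {linear W -> M}); split=> // Z f fZ.
    have [u uP] := aX Z f fZ; exists (q \o u : {linear Z -> W}) => z.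
    by rewrite /= qE pe.
  apply: (inj_bij artA (proj1 fX)); apply: inj0 => x hx.
  have [w xw] := js x; rewrite -xw -ej xw -ge.
  case: n n0 {he ge hg phn} => // n _; rewrite iterSr hx -[iter n h 0]/(iterlin h n 0).
  by rewrite !linear0.
have [Y [i ip]] := ses_ker ps; exists Y, X, i, phi; split=> // Z fZ B C a b f ab.
have [X' [u [v [w [uv e1 e2 e3]]]]] := ses_pushout (i \o f : {linear B -> X}) ab.
have fX' := fpd_middle noethA uv fX fZ.
(* Sending [w C] to 0 extends [phi] to the pushout [X']. As [X'] has finite projective dimension,
   [psi] factors through [phi] by some [g], and [minimal] makes [g u] invertible with inverse [t].
   Then [t g w] maps [C] into the kernel [Y] and extends [f]. *)
have [psi psiP] : exists psi : {linear X' -> M}, forall z, exists x c, z = u x + w c /\ psi z = phi x.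
  apply: (linear_of_rel (P := fun z m => exists x c, z = u x + w c /\ m = phi x)).
  - by move=> z; have [x [c zE]] := e3 z; exists (phi x), x, c.
  - move=> s _ _ _ _ [x [c [-> ->]]] [x' [c' [-> ->]]].
    by exists (s *: x + x'), (s *: c + c'); rewrite !linearP scalerDr addrACA.
  - move=> _ [x [c [e0 ->]]].
    have [b0 b0E] : exists b0, a b0 = c.
      apply: (ses_ex ab); rewrite -e2; have := congr1 v e0.
      by rewrite linear0 linearD (ses0 x uv) add0r => /esym.
    have xE : x = - i (f b0).
      apply: (ses_inj uv); rewrite linearN; apply/eqP; rewrite -addr_eq0 -[u (i _)]e1 b0E.
      by rewrite -e0.
    by rewrite xE linearN (ses0 _ ip) oppr0.
have psiE x c : psi (u x + w c) = phi x.
  have [x' [c' [e0 ->]]] := psiP (u x + w c).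
  have d0 : u (x - x') = w (c' - c).
    rewrite !linearB; apply/eqP; rewrite subr_eq addrAC eq_sym subr_eq addrC eq_sym.
    by rewrite e0 addrC.
  have [b0 b0E] : exists b0, a b0 = c' - c.
    by apply: (ses_ex ab); rewrite -e2 -d0 (ses0 _ uv).
  have : x - x' = i (f b0) by apply: (ses_inj uv); rewrite d0 -b0E e1.
  move/(congr1 phi); rewrite linearB (ses0 _ ip) => /eqP.
  by rewrite subr_eq0 => /eqP.
have [g gP] := aX X' psi fX'.
have psiu x : psi (u x) = phi x by have := psiE x 0; rewrite linear0 addr0.
have psiw c : psi (w c) = 0 by have := psiE 0 c; rewrite linear0 add0r linear0.
have bh : bijective (g \o u : {linear X -> X}).
  by apply: minimal => x; rewrite /= -gP psiu.
have [t [tK Kt]] := bij_inv bh.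
have pt x : phi (t x) = phi x by rewrite -{2}[x]Kt /= -gP psiu.
have [c|y yP] := factor_ker (f := t \o (g \o w) : {linear C -> X}) ip.
  by rewrite /= pt -gP psiw.
by exists y => b0; apply: (ses_inj ip); rewrite yP /= e1; exact: tK.
Qed.

End Existence.

(** * Existence of strong tilting modules *)

Section FinitisticDimension.
Variables (k : comPzRingType) (A : kalg k).
Hypothesis artA : artin_algebra A.
Hypothesis HC : contravariantly_finite A.
Let noethA := artin_noeth artA.
Implicit Types K L M N P T X Y Z W : lmodType A.

(** The explicit [d] is what will bound the finitistic dimension. *)
Definition spec d M := exists Y X (i : {linear Y -> X}) (phi : {linear X -> M}),
  [/\ ses i phi, fin_gen X, pd_le d X & Yclass Y].

Lemma spec_mono d d' M : (d <= d')%N -> spec d M -> spec d' M.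
Proof.
move=> dd' [Y [X [i [phi [ip fX HX YY]]]]]; exists Y, X, i, phi; split=> //.
exact (pd_le_mono dd' HX).
Qed.

Lemma spec_zero d M : is_zero M -> spec d M.
Proof.
move=> M0; exists M, M, \0, idfun; split.
- by split=> [x y _|y|y]; [rewrite [LHS]M0 [RHS]M0 | exists y | split=> _; [exists 0; rewrite [LHS]M0 [RHS]M0 | rewrite [LHS]M0]].
- by exists 0%N, (fun _ => 0) => x; exists (fun _ => 0); rewrite big_ord0 [LHS]M0.
- move=> N; apply: extn_proj; move=> X Z p f _; exists \0 => x.
  by rewrite [x]M0 !linear0.
- move=> X _ B C i p f _; exists \0 => b.
  by rewrite [LHS]M0 [RHS]M0.
Qed.

(** A horseshoe construction: [X] is an extension of [X''] by [X'] mapping onto [M], and its kernel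
    is an extension of [Y''] by [Y']. *)
Lemma spec_ext d M' M M'' (mu : {linear M' -> M}) (pi : {linear M -> M''}) :
  ses mu pi -> spec d M' -> spec d M'' -> spec d M.
Proof.
move=> mp [Y' [X' [i' [a' [ia' fX' dX' YY']]]]] [Y'' [X'' [i'' [a'' [ia'' fX'' dX'' YY'']]]]].
have [K [P [ka [q [kq fP]]]]] := fgproj_cover fX''.
have [be beE] := (proj2 fP) _ _ pi (a'' \o q : {linear P -> M''}) (ses_surj mp).
have [x|de deE] := factor_ker (f := be \o ka : {linear K -> M}) mp.
  by rewrite /= beE /= (ses0 x kq) linear0.
have fK : fpd K.
  by apply: (fpd_left noethA kq (fpd_proj fP)); split=> //; exists d.
(* The syzygy [K] of [X''] has finite projective dimension, so its map to [M'] lifts through [X'];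
   the lift is the gluing map that defines the extension [X]. *)
have [ga gaE] := ext1_lift de ia' (YY' K fK).
have [X [j [q' [r [jq e1 e2 e3]]]]] := ses_pushout ga kq.
have [si siP] : exists si : {linear X -> M}, forall z, exists x b,
    z = j x + r b /\ si z = mu (a' x) + be b.
  apply: (linear_of_rel (P := fun z m => exists x b, z = j x + r b /\ m = mu (a' x) + be b)).
  - by move=> z; have [x [b zE]] := e3 z; exists (mu (a' x) + be b), x, b.
  - move=> s _ _ _ _ [x [b [-> ->]]] [y [c [-> ->]]].
    exists (s *: x + y), (s *: b + c); split.
      by rewrite (linearP j) (linearP r) scalerDr addrACA.
    by rewrite (linearP a') (linearP mu) (linearP be) scalerDr addrACA.
  - move=> _ [x [b [e0 ->]]].
    have [t tE] : exists t, ka t = b.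
      apply: (ses_ex kq); rewrite -e2; have := congr1 q' e0.
      by rewrite linear0 linearD (ses0 x jq) add0r => /esym.
    have xE : x = - ga t.
      apply: (ses_inj jq); rewrite linearN; apply/eqP; rewrite -addr_eq0 -e1 tE.
      by rewrite -e0.
    have := deE t; rewrite /= tE => <-.
    by rewrite xE !linearN gaE addNr.
have siE x b : si (j x + r b) = mu (a' x) + be b.
  have [x' [b' [e0 ->]]] := siP (j x + r b).
  have d0 : j (x - x') = r (b' - b).
    rewrite !linearB; apply/eqP; rewrite subr_eq addrAC eq_sym subr_eq addrC eq_sym.
    by rewrite e0 addrC.
  have [t tE] : exists t, ka t = b' - b.
    by apply: (ses_ex kq); rewrite -e2 -d0 (ses0 _ jq).
  have xE : x - x' = ga t by apply: (ses_inj jq); rewrite d0 -tE e1.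
  have h1 : mu (a' (x - x')) = be (b' - b) by rewrite xE gaE deE /= tE.
  rewrite !linearB in h1.
  by rewrite -[be b'](subrK (be b)) -h1 addrA [mu (a' x') + _]addrC subrK.
have sij x : si (j x) = mu (a' x) by have := siE x 0; rewrite !linear0 !addr0.
have sir b : si (r b) = be b by have := siE 0 b; rewrite !linear0 !add0r.
have pis z : pi (si z) = a'' (q' z).
  have [x [b ->]] := e3 z; rewrite siE !linearD (ses0 _ mp) (ses0 _ jq) !add0r.
  by rewrite linear0 add0r beE /= e2.
have ss : surjective si.
  move=> m; have [x'' xE] := ses_surj ia'' (pi m); have [b bE] := ses_surj kq x''.
  have [m' m'E] : exists m', mu m' = m - be b.
    by apply: (ses_ex mp); rewrite linearB beE /= bE xE subrr.
  have [x' x'E] := ses_surj ia' m'; exists (j x' + r b).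
  by rewrite siE x'E m'E subrK.
have [Y [i ip]] := ses_ker ss; exists Y, X, i, si; split=> //.
- exact: fin_gen_ext jq fX' fX''.
- move=> N; exact (extn_middle noethA jq (fin_gen_ext jq fX' fX'') (dX' N) (dX'' N)).
have [y|u uE] := factor_ker (f := j \o i' : {linear Y' -> X}) ip.
  by rewrite /= sij (ses0 _ ia') linear0.
have [y|v vE] := factor_ker (f := q' \o i : {linear Y -> X''}) ia''.
  by rewrite /= -pis (ses0 _ ip) linear0.
have uv : ses u v.
  split.
  - by move=> x y e; apply: (ses_inj ia'); apply: (ses_inj jq); rewrite -[LHS]uE -[RHS]uE e.
  - move=> y''; have [b bE] := ses_surj kq (i'' y'').
    have [m' m'E] : exists m', mu m' = be b.
      by apply: (ses_ex mp); rewrite beE /= bE (ses0 _ ia'').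
    have [x' x'E] := ses_surj ia' m'.
    have [y yE] : exists y, i y = r b - j x'.
      by apply: (ses_ex ip); rewrite linearB sij sir x'E m'E subrr.
    exists y; apply: (ses_inj ia''); rewrite vE /= yE linearB e2 (ses0 _ jq) subr0.
    exact: bE.
  - move=> y; split=> [vy|[y' <-]].
      have [x xE] : exists x, j x = i y.
        by apply: (ses_ex jq); have := vE y; rewrite vy linear0 /= => <-.
      have [y' y'E] : exists y', i' y' = x.
        apply: (ses_ex ia'); apply: (ses_inj mp); rewrite linear0 -sij xE.
        exact: ses0 ip.
      by exists y'; apply: (ses_inj ip); rewrite uE /= y'E.
    by apply: (ses_inj ia''); rewrite vE /= uE /= (ses0 _ jq) linear0.
move=> Z fZ; exact (ext1_middle_r uv (proj1 fZ) (YY' Z fZ) (YY'' Z fZ)).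
Qed.

(** Along the chain, the first [r] with [r *: x <> 0] makes the module generated by [r *: x] a copy
    of the simple quotient attached to [r]. The chain is finite, so [d] is a maximum of finitely
    many bounds. *)
Lemma simple_spec (I : A^o -> Prop) : cfam I ->
  exists d : nat, forall M (x : M), x <> 0 -> (forall a, I a -> (a : A) *: x = 0) ->
  exists (S : lmodType A) (j : {linear S -> M}), [/\ injective j, ~ is_zero S & spec d S].
Proof.
elim=> {I} [I all|I r HI nr simp _ [d dP]].
  by exists 0%N => M x x0 Ix; case: x0; rewrite -[x]scale1r; exact: Ix.
have HJ : submod (fun s : A^o => I ((s : A) * r)).
  split=> [|a s t Is It]; first by rewrite mul0r; case: HI.
  by rewrite mulrDl -[_ * s * r]mulrA; case: HI => _; apply.
have [S [p [ps pS]]] := quotient_exists HJ.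
have fS : fin_gen S := fin_gen_surj ps (proj1 (fgproj_regular A)).
have [Y [X [i [phi [ip [fX [d' HX]] YY]]]]] := special_approx artA HC fS.
have sS : spec d' S by exists Y, X, i, phi.
exists (maxn d d') => M x x0 Ix.
have [rx|rx] := pselect (r *: x = 0).
  have [|S' [j [ji nS sS']]] := dP M x x0.
    by move=> _ [a [_ [Ia [s ->] ->]]]; rewrite scalerDl Ix // add0r -scalerA rx scaler0.
  by exists S', j; split=> //; exact: spec_mono (leq_maxl _ _) sS'.
have [s|j jE] := @factor_surj _ _ _ _ p (scale_to (r *: x)) ps.
  by move=> /pS Is; rewrite /= scalerA Ix.
exists S, j; split.
- apply: inj0 => y; have [s <-] := ps y; rewrite jE /= scalerA => srx.
  apply/pS; have [//|[u Iu]] := simp s; case: rx.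
  have := Ix _ Iu; rewrite scalerBl -mulrA -[(u * _) *: x]scalerA srx scaler0 subr0.
  by [].
- move=> S0; apply: rx; have := jE 1; rewrite /= scale1r => <-.
  by rewrite [p 1]S0 linear0.
- exact: spec_mono (leq_maxr _ _) sS.
Qed.

Lemma spec_all : exists d, forall M, fin_gen M -> spec d M.
Proof.
have H0 : submod (fun x : A^o => x = 0) by split=> // a x y -> ->; rewrite scaler0 addr0.
have [d dP] := simple_spec (cfam_exists artA H0).
exists d => M fM; have [n rM] := artin_rk artA fM.
elim/ltn_ind: n M fM rM => n IH M fM rM.
have [M0|nM] := pselect (is_zero M); first exact: spec_zero.
have [x x0] : exists x : M, x <> 0 by apply/existsNP.
have [|S [j [ji nS sS]]] := dP M x x0; first by move=> a ->; rewrite scale0r.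
have [C [p jp]] := ses_coker ji.
have np : ~ injective (kmod_map p).
  move=> pi; apply: nS => s; apply: ji; apply: pi.
  by rewrite /= (ses0 _ jp) !linear0.
have [m mn rC] := rk_surj_lt (p := kmod_map p) (ses_surj jp) np rM.
apply: (spec_ext jp sS); apply: IH rC => //.
exact: fin_gen_surj (ses_surj jp) fM.
Qed.

(** Ext^1(M, Y) = 0 splits the approximation, so [M] is a summand of a module whose projective
    dimension is bounded by [d]. *)
Lemma finitistic_bound : exists d, forall M, fpd M -> pd_le d M.
Proof.
have [d dP] := spec_all; exists d => M fM N.
have [Y [X [i [phi [ip fX HX YY]]]]] := dP M (proj1 fM).
have [r rP] := YY M fM _ _ _ _ (idfun : {linear Y -> Y}) ip.
have [s [sp _]] := ses_retraction ip rP.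
by apply: (extn_summand noethA fX _ (HX N)); exists s, phi.
Qed.

(** The pullback [Q] is both an extension of [X] by [M], which makes its projective dimension
    finite, and of the injective [I] by [Y], which puts it in [Yclass]. *)
Lemma special_preenvelope M : fpd M -> exists (U Z : lmodType A) (u : {linear M -> U}) (v : {linear U -> Z}),
  [/\ ses u v, fpd U, fpd Z & Yclass U].
Proof.
move=> fM; have [I [i [fI ii eI]]] := injective_envelope artA (proj1 fM).
have [L [p ip]] := ses_coker ii.
have fL := fin_gen_surj (ses_surj ip) fI.
have [Y [X [y [phi [yphi fX YY]]]]] := special_approx artA HC fL.
have [Q [j [q [r [jq e1 e2 e3 e4]]]]] := ses_pullback phi ip.
exists Q, X, j, q; split=> //; first exact: (fpd_middle noethA jq).
have [t tP] : exists t : {linear Y -> Q}, forall w, r (t w) = 0 /\ q (t w) = y w.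
  apply: (linear_of_rel (P := fun w z => r z = 0 /\ q z = y w)).
  - by move=> w; apply: e3; rewrite linear0 (ses0 _ yphi).
  - by move=> a x x' z z' [h1 h2] [h3 h4]; rewrite !linearP h1 h2 h3 h4 scaler0 addr0.
  - by move=> z; rewrite !linear0 => -[*]; exact: e4.
have tr : ses t r.
  split.
  - move=> w w' e; apply: (ses_inj yphi); have [_ <-] := tP w; have [_ <-] := tP w'.
    by rewrite e.
  - by move=> z; have [x xE] := ses_surj yphi (p z); have [w [<- _]] := e3 _ _ (esym xE); exists w.
  - move=> z; split=> [rz|[w <-]]; last by case: (tP w).
    have [w wE] : exists w, y w = q z by apply: (ses_ex yphi); rewrite -e1 rz linear0.
    exists w; have [h1 h2] := tP w.
    by apply: subr0_eq; apply: e4; rewrite linearB ?rz ?h1 ?h2 ?wE subrr.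
move=> Z fZ; exact (ext1_middle_r tr (proj1 fZ) (YY Z fZ) (eI Z (proj1 fZ))).
Qed.

Lemma Yclass_prod X Y : Yclass X -> Yclass Y -> Yclass (X * Y)%type.
Proof.
have [u [v uv]] := ses_prod X Y => YX YY Z fZ.
exact (ext1_middle_r uv (proj1 fZ) (YX Z fZ) (YY Z fZ)).
Qed.

(** Passing to the cokernel of such an embedding lowers by one the degree in which Ext vanishes; in
    degree 0 the module itself is in [Yclass]. All terms are collected in one product. *)
Lemma coresolution_exists d M : fpd M -> (forall W, fpd W -> extn d W M) ->
  exists U : lmodType A, [/\ fpd U, Yclass U & cor U M].
Proof.
elim: d M => [|d IH] M fM HM.
  by exists M; split=> //; apply: cor_add; exact: in_add_refl.
have [U0 [Z [u [v [uv fU0 fZ YU0]]]]] := special_preenvelope fM.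
have [|U [fU YU cU]] := IH Z fZ.
  move=> W fW; apply: (extn_shift_r uv (proj1 fW) noethA); last exact: HM.
  exact: (perp_of_ext1 noethA YU0 fW).
exists (U0 * U)%type; split.
- exact: fpd_prod.
- exact: Yclass_prod.
- have a0 : in_add (U0 * U)%type U0.
    by apply: in_add_summand (summandl U0 U) (in_add_refl _).
  have a1 : in_add (U0 * U)%type U.
    by apply: in_add_summand (summandr U0 U) (in_add_refl _).
  by apply: (cor_step uv a0); exact: cor_mono a1 cU.
Qed.

Lemma basic_strong_exists : exists T, basic_strong_tilting T.
Proof.
have [d dP] := finitistic_bound.
have [|U [fU YU cU]] := @coresolution_exists d A^o (fpd_proj (fgproj_regular A)).
  by move=> W fW; exact: dP.
have [T [bT TU UT]] := basic_version artA (proj1 fU).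
exists T; split=> //; apply/(strongP noethA); split.
- exact: fpd_summand TU fU.
- exact: cor_mono UT cU.
- move=> M fM n; apply: extn_summand_r TU _; exact: (perp_of_ext1 noethA YU fM).
Qed.

End FinitisticDimension.

(** * Iteration *)

Section Steps.
Variable k : comPzRingType.
Implicit Types A B C E : kalg k.

Lemma side_artin b A : artin_algebra A -> artin_algebra (side b A).
Proof. by case: b => //; exact: artin_op. Qed.

Lemma side_basic b A : basic_ring A -> basic_ring (side b A) \/
  (exists2 S0 : pzRingType, side b A = S0^c :> pzRingType & basic_ring S0).
Proof. by case: b => HA; [right; exists A | left]. Qed.

Lemma step_action_bij right A B (s : strong_tilting_step right A B) :
  bijective (step_action s).
Proof. by case: right s => s; exact: step_iso_bij s. Qed.

Lemma step_action_map right A B (s : strong_tilting_step right A B) c :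
  step_action s (kalg_map (side (~~ right) B) c) = kalg_map (endo_alg (step_mod s)) c.
Proof. by case: right s => s; exact: step_iso_map s c. Qed.

Lemma step_lact_map right A B (s : strong_tilting_step right A B) c :
  lact (step_action s) (kalg_map (side right A) c) =
  kalg_map (endo_alg (bimod (step_action s))) c.
Proof.
apply: linear_ext => t; have := step_action_map s c.
by move/(congr1 (fun g : {linear step_mod s -> step_mod s} => g t)) => /= ->.
Qed.

Section Bimodule.
Variables (right : bool) (A B C : kalg k).
Variables (s : strong_tilting_step right A B) (t : strong_tilting_step (~~ right) B C).
Hypotheses (artA : artin_algebra A) (artB : artin_algebra B) (artC : artin_algebra C).
Hypothesis basB : basic_ring B.

Lemma step_strong right' A' B' (s' : strong_tilting_step right' A' B') :
  artin_algebra A' -> strong (step_mod s').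
Proof.
move=> artA'; have [h _] := step_modP s'.
by apply/(strongP (artin_noeth (side_artin right' artA'))).
Qed.

Lemma step_bimod_strong : strong (bimod (step_action t)).
Proof.
exact (@strong_step _ _ _ _ _ (step_action s) (step_action t)
  (artin_noeth (side_artin right artA)) (artin_noeth (side_artin (~~ right) artB))
  (artin_noeth (side_artin (~~ ~~ right) artC))
  (step_action_bij s) (step_action_bij t) (step_strong s artA) (step_strong t artB)).
Qed.

Lemma step_lact_bij : bijective (lact (step_action t)).
Proof.
exact (strong_lact_bij (artin_noeth (side_artin (~~ right) artB))
  (artin_noeth (side_artin (~~ ~~ right) artC)) (step_action_bij t) (step_strong t artB)).
Qed.

Lemma step_bimod_basic_strong : basic_strong_tilting (bimod (step_action t)).
Proof.
split; first exact/(strongP (artin_noeth (side_artin (~~ ~~ right) artC)))/step_bimod_strong.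
exact (basic_module_of_ring step_lact_bij (side_basic (~~ right) basB)).
Qed.

Lemma step_duality : hom_duality (step_action t)
  (@fin_proj_dim (side (~~ right) B)) (@fin_proj_dim (side (~~ ~~ right) C)).
Proof.
exact (strong_duality (artin_noeth (side_artin (~~ right) artB))
  (artin_noeth (side_artin (~~ ~~ right) artC)) (step_action_bij t) (step_strong t artB)
  step_bimod_strong).
Qed.

End Bimodule.

Section Transport.
Variables (S R R' : pzRingType) (M N : lmodType S).
Variables (a : {rmorphism R -> endo M}) (b : {rmorphism R' -> endo N}).
Variable theta : {linear M -> N}.
Hypotheses (aK : bijective a) (bK : bijective b) (tK : bijective theta).

Lemma transport_endo : exists f : {rmorphism R -> R'}, bijective f /\
  forall r x, (b (f r) : {linear N -> N}) (theta x) = theta ((a r : {linear M -> M}) x).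
Proof.
have [u [tu ut]] := bij_inv tK; have [b' bb' b'b] := bK; have [a' aa' a'a] := aK.
pose f r := b' ((theta \o (a r : {linear M -> M})) \o u : {linear N -> N}).
have fE r x : (b (f r) : {linear N -> N}) (theta x) = theta ((a r : {linear M -> M}) x).
  by rewrite /f b'b /= tu.
have eqb s s' : (forall x, (b s : {linear N -> N}) (theta x) = (b s' : {linear N -> N}) (theta x)) ->
    s = s'.
  by move=> h; apply: (can_inj bb'); apply: linear_ext => y; rewrite -(ut y).
have fZ : zmod_morphism f.
  move=> r s; apply: eqb => x.
  have -> : (b (f r - f s) : {linear N -> N}) (theta x) =
      (b (f r) : {linear N -> N}) (theta x) - (b (f s) : {linear N -> N}) (theta x).
    by rewrite rmorphB.
  by rewrite !fE rmorphB -linearB.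
have fM : monoid_morphism f.
  split=> [|r s]; apply: eqb => x; first by rewrite fE !rmorph1.
  have -> : (b (f r * f s) : {linear N -> N}) (theta x) =
      (b (f r) : {linear N -> N}) ((b (f s) : {linear N -> N}) (theta x)).
    by rewrite rmorphM.
  by rewrite !fE rmorphM.
exists (HB.pack_for {rmorphism R -> R'} f (GRing.isZmodMorphism.Build _ _ _ fZ)
    (GRing.isMonoidMorphism.Build _ _ _ fM)); split=> //.
exists (fun s => a' ((u \o (b s : {linear N -> N})) \o theta : {linear M -> M})) => [r|s] /=.
  by rewrite -[RHS]aa'; congr a'; apply: linear_ext => x; rewrite /= fE tu.
by apply: eqb => x; rewrite fE a'a /= ut.
Qed.

End Transport.

Lemma alg_iso_side b b' A B : b = b' -> alg_iso (side b A) (side b' B) -> alg_iso A B.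
Proof.
move=> <-; case: b => // -[f [bf fm]].
have fZ : zmod_morphism (f : A -> B) by exact: (rmorphB f).
have fM : monoid_morphism (f : A -> B).
  by split; [exact: (rmorph1 f) | move=> x y; exact: (rmorphM f (y : A) (x : A))].
by exists (HB.pack_for {rmorphism A -> B} (f : A -> B) (GRing.isZmodMorphism.Build _ _ _ fZ)
    (GRing.isMonoidMorphism.Build _ _ _ fM)).
Qed.

Lemma alg_iso_refl A : alg_iso A A.
Proof. by exists (idfun : {rmorphism A -> A}); split=> //; exists id. Qed.

Lemma alg_iso_trans A B C : alg_iso A B -> alg_iso B C -> alg_iso A C.
Proof.
move=> [f [bf fm]] [g [bg gm]]; exists (g \o f : {rmorphism A -> C}); split.
  exact: bij_comp.
by move=> c; rewrite /= fm gm.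
Qed.

Lemma alg_iso_sym A B : alg_iso A B -> alg_iso B A.
Proof.
move=> [f [[g fg gf] fm]]; have fi := can_inj fg.
have gZ : zmod_morphism g by move=> x y; apply: fi; rewrite rmorphB !gf.
have gM : monoid_morphism g.
  by split=> [|x y]; apply: fi; rewrite ?rmorphM ?rmorph1 !gf.
exists (HB.pack_for {rmorphism B -> A} g (GRing.isZmodMorphism.Build _ _ _ gZ)
    (GRing.isMonoidMorphism.Build _ _ _ gM)); split; first by exists f.
by move=> c /=; rewrite -fm fg.
Qed.

(** The module of [s1], read over [C], and the module of [s2] are both basic strong tilting, hence
    isomorphic. Up to passing to opposites, their endomorphism rings are [B], by the double
    centraliser property, and [D]. *)
Lemma step_period right A B C D (s0 : strong_tilting_step right A B)
    (s1 : strong_tilting_step (~~ right) B C) (s2 : strong_tilting_step (~~ ~~ right) C D) :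
  artin_algebra A -> artin_algebra B -> artin_algebra C -> artin_algebra D ->
  basic_ring B -> alg_iso B D.
Proof.
move=> artA artB artC artD basB.
have noethC := artin_noeth (side_artin (~~ ~~ right) artC).
have [/(strongP noethC) sM bM] := step_bimod_basic_strong s0 s1 artA artB artC basB.
have [/(strongP noethC) sN bN] := step_modP s2.
have noethD := artin_noeth (side_artin (~~ ~~ ~~ right) artD).
have noethB := artin_noeth (side_artin (~~ right) artB).
have [fM _ eM] := sM; have [fN _ eN] := sN.
have MN : in_add (step_mod s2) (bimod (step_action s1)).
  apply: (strong_in_add noethC noethD (step_action_bij s2) sN fM) => X fX.
  exact: (eM X fX 0%N).
have lb := step_lact_bij s1 artB artC.
have NM : in_add (bimod (step_action s1)) (step_mod s2).
  apply: (strong_in_add noethC noethB lb sM fN) => X fX.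
  exact: (eN X fX 0%N).
have [theta bt] := basic_unique (side_artin _ artC) (proj1 fM) (proj1 fN) bM bN MN NM.
have [f [bf fE]] := transport_endo lb (step_action_bij s2) bt.
apply: (@alg_iso_side (~~ right) (~~ ~~ ~~ right)); first by rewrite negbK.
exists f; split=> // c.
have [g gK _] := step_action_bij s2; apply: (can_inj gK); apply: linear_ext => y.
have [u [_ ut]] := bij_inv bt; rewrite -(ut y) fE step_lact_map step_action_map.
exact: (linearZ_LR theta).
Qed.

End Steps.

Section Iteration.
Variable k : comPzRingType.
Implicit Types A B C E Lambda : kalg k.

(** The module of [t], read over [C], is itself a step leading back to [B]. The sequence can thus be
    continued by alternation, and a single appeal to the existence theorem suffices. *)
Lemma back_step A B C (s : strong_tilting_step false A B) (t : strong_tilting_step true B C) :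
  artin_algebra A -> artin_algebra B -> artin_algebra C -> basic_ring B ->
  inhabited (strong_tilting_step false C B).
Proof.
move=> artA artB artC basB.
have bst := step_bimod_basic_strong s t artA artB artC basB.
have lb := step_lact_bij (right := false) t artB artC.
pose l := lact (step_action t).
have lZ : zmod_morphism (l : B -> op_alg (endo_alg (bimod (step_action t)))) by exact: (rmorphB l).
have lM : monoid_morphism (l : B -> op_alg (endo_alg (bimod (step_action t)))).
  by split; [exact: (rmorph1 l) | move=> x y; exact: (rmorphM l (y : op_alg B) (x : op_alg B))].
pose f : {rmorphism B -> side true (endo_alg (bimod (step_action t)))} :=
  HB.pack_for {rmorphism B -> side true (endo_alg (bimod (step_action t)))}
    (l : B -> op_alg (endo_alg (bimod (step_action t))))
    (GRing.isZmodMorphism.Build _ _ _ lZ) (GRing.isMonoidMorphism.Build _ _ _ lM).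
constructor; exact: (@StrongTiltingStep k false C B (bimod (step_action t)) bst f lb
  (step_lact_map t)).
Qed.

Section FromStep.
Variables (Lambda : kalg k) (T : lmodType Lambda).
Hypotheses (artL : artin_algebra Lambda) (basL : basic_ring Lambda).
Hypothesis bsT : basic_strong_tilting T.
Hypothesis HC : contravariantly_finite (side true (op_alg (endo_alg T))).

Lemma iteration_exists : unlimited_strong_tilting Lambda.
Proof.
have [sT bT] := bsT.
have [fT _ _] := proj1 (strongP (artin_noeth artL) T) sT.
pose L1 := op_alg (endo_alg T).
have artE := artin_endo artL (proj1 fT).
have artL1 : artin_algebra L1 := artin_op artE.
have [basE basL1] := endo_basic artL (proj1 fT) bT.
pose s0 : strong_tilting_step false Lambda L1 :=
  @StrongTiltingStep k false Lambda L1 T bsT (idfun : {rmorphism L1 -> side true (endo_alg T)})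
    (Bijective (fun _ => erefl) (fun _ => erefl)) (fun _ => erefl).
have artS1 : artin_algebra (side true L1) := artin_op artL1.
have [U bsU] := basic_strong_exists artS1 HC.
have [fU _ _] := proj1 (strongP (artin_noeth artS1) U) (proj1 bsU).
pose L2 := endo_alg U.
have artL2 : artin_algebra L2 := artin_endo artS1 (proj1 fU).
have [basL2 _] := endo_basic artS1 (proj1 fU) (proj2 bsU).
pose s1 : strong_tilting_step true L1 L2 :=
  @StrongTiltingStep k true L1 L2 U bsU (idfun : {rmorphism L2 -> side false (endo_alg U)})
    (Bijective (fun _ => erefl) (fun _ => erefl)) (fun _ => erefl).
have [s2] := back_step s0 s1 artL artL1 artL2 basL1.
pose L i : kalg k := if i is j.+1 then if odd j then L2 else L1 else Lambda.
have artLi i : artin_algebra (L i) by case: i => // j; rewrite /L; case: odd.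
have basLi i : basic_ring (L i) by case: i => // j; rewrite /L; case: odd.
have step i : strong_tilting_step (odd i) (L i) (L i.+1).
  by case: i => [|j]; [exact: s0 | rewrite /L /=; case: odd; [exact: s2 | exact: s1]].
by exists (StrongTiltingSequence artLi basLi step).
Qed.

End FromStep.

Section Sequence.
Variable L : strong_tilting_sequence k.

Lemma sequence_period i : alg_iso (L i.+1) (L i.+3).
Proof.
exact (step_period (seq_step L i) (seq_step L i.+1) (seq_step L i.+2) (seq_artin L i)
  (seq_artin L i.+1) (seq_artin L i.+2) (seq_artin L i.+3) (seq_basic L i.+1)).
Qed.

Lemma sequence_parity i j : (0 < i)%N -> (0 < j)%N -> odd i = odd j -> alg_iso (L i) (L j).
Proof.
have main n m : alg_iso (L n.+1) (L (n.+1 + m.*2)%N).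
  elim: m => [|m IH]; first by rewrite addn0; exact: alg_iso_refl.
  apply: alg_iso_trans IH _; rewrite doubleS !addnS addSn.
  exact: sequence_period.
have le_main i' j' : (0 < i')%N -> (i' <= j')%N -> odd i' = odd j' -> alg_iso (L i') (L j').
  case: i' => // n _ nj e; have := main n (j' - n.+1)./2.
  rewrite even_halfK ?subnKC //.
  by rewrite oddB // -e addbb.
move=> i0 j0 e; have [ij|/ltnW ji] := leqP i j; first exact: le_main.
by apply: alg_iso_sym; exact: le_main.
Qed.

Lemma sequence_bimodules i : (0 < i)%N ->
  basic_strong_tilting (bimod (step_action (seq_step L i))) /\
  hom_duality (step_action (seq_step L i))
    (@fin_proj_dim (side (odd i) (L i))) (@fin_proj_dim (side (odd i.+1) (L i.+1))).
Proof.
case: i => // i _; split.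
  exact (step_bimod_basic_strong (seq_step L i) (seq_step L i.+1) (seq_artin L i)
    (seq_artin L i.+1) (seq_artin L i.+2) (seq_basic L i.+1)).
exact (step_duality (seq_step L i) (seq_step L i.+1) (seq_artin L i)
  (seq_artin L i.+1) (seq_artin L i.+2)).
Qed.

End Sequence.
End Iteration.

(** * An example with non-isomorphic first and third terms *)

Lemma field_basis (K : fieldType) (V : lmodType K) : fin_gen V ->
  exists n (g : 'I_n -> V), (forall v, exists c : 'I_n -> K, v = \sum_j c j *: g j) /\
    forall c : 'I_n -> K, \sum_j c j *: g j = 0 -> forall j, c j = 0.
Proof.
move=> [n0 [g0 gP0]].
pose P n := `[< exists g : 'I_n -> V, forall v, exists c : 'I_n -> K, v = \sum_j c j *: g j >].
have [|n /asboolP[g gP] minn] := @ex_minnP P; first by exists n0; apply/asboolP; exists g0.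
exists n, g; split=> // c c0 j; apply: contrapT => cj; move/eqP: cj => cj.
case: n j g gP minn c c0 cj => [[]//|n] j g gP minn c c0 cj.
have : (n.+1 <= n)%N; last by rewrite ltnn.
apply: minn; apply/asboolP; exists (fun i => g (lift j i)) => v.
have [d ->] := gP v.
exists (fun i => d (lift j i) - d j / c j * c (lift j i)).
move: c0; rewrite !(bigD1_ord j) //= => c0.
have gj : g j = - (c j)^-1 *: \sum_i c (lift j i) *: g (lift j i).
  have -> : \sum_i c (lift j i) *: g (lift j i) = - (c j *: g j).
    by apply/eqP; rewrite -addr_eq0 addrC c0.
  by rewrite scalerN scaleNr opprK scalerA mulVf // scale1r.
rewrite gj scalerA scaler_sumr -big_split; apply: eq_bigr => i _ /=.
by rewrite scalerA -scalerDl addrC mulrN !mulNr.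
Qed.

(** * The side of the example with non-projective modules of finite projective dimension *)

Section ExampleSide.
Variables (K : fieldType) (S : kalg K) (e x a : S).
Hypothesis artS : artin_algebra S.
Let noethS := artin_noeth artS.
Hypotheses (ee : e * e = e) (ex : e * x = x) (xe : x * e = x) (xx : x * x = 0).
Hypotheses (ae : a * e = a) (ea : e * a = 0) (ax : a * x = 0) (x0 : x <> 0).
Let cst (c : K) : S := kalg_map S c.
Hypothesis span : forall s, exists c : K * K * K * K,
  s = cst c.1.1.1 * e + cst c.1.1.2 * x + cst c.1.2 * (1 - e) + cst c.2 * a.
Implicit Types M N P X Y V B : lmodType S.

Lemma act_killed M (s : S) : exists q : K, forall m : M, e *: m = 0 -> s *: m = cst q *: m.
Proof.
have [[[[p0 p1] q] r] /= ->] := span s; exists q => m em.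
have xm : x *: m = 0 by rewrite -xe -scalerA em scaler0.
have am : a *: m = 0 by rewrite -ae -scalerA em scaler0.
rewrite !scalerDl -!scalerA em xm am !scaler0 add0r addr0 add0r.
by rewrite scalerBl scale1r em subr0.
Qed.

Lemma killed_submod M : submod (fun m : M => e *: m = 0).
Proof.
split=> [|s m n em en]; first exact: scaler0.
have [q sq] := act_killed M s.
by rewrite (sq m em) scalerDr scalerA -kalg_mapC -scalerA em scaler0 en addr0.
Qed.

Lemma cst_comm M c (s : S) (m : M) : s *: (cst c *: m) = cst c *: (s *: m).
Proof. by rewrite !scalerA kalg_mapC. Qed.

(** [W] need only be a subspace over [K]: the one needed later is the sum of [x M] and the part
    killed by [e]. *)
Lemma kbasis M (W : M -> Prop) : fin_gen M -> submod (W : kmod M -> Prop) ->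
  exists n (g : 'I_n -> M),
  (forall m, exists c : 'I_n -> K, W (m - \sum_j cst (c j) *: g j)) /\
  forall c : 'I_n -> K, W (\sum_j cst (c j) *: g j) -> forall j, c j = 0.
Proof.
move=> fM HW; have [Q [p [ps pW]]] := quotient_exists HW.
have [n [h [hs hi]]] := field_basis (fin_gen_surj ps (artin_kmod_fin_gen artS fM)).
have [g gP] := choice (fun j => ps (h j)).
have pE (c : 'I_n -> K) : p (\sum_j cst (c j) *: (g j : M)) = \sum_j c j *: h j.
  transitivity (\sum_j p (c j *: (g j : kmod M))); first exact: (linear_sum p).
  by apply: eq_bigr => j _; rewrite linearZ /= gP.
exists n, g; split=> [m|c /pW Wc].
  have [c cE] := hs (p m); exists c; apply/pW.
  by rewrite linearB pE -cE subrr.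
by apply: hi; rewrite -pE.
Qed.

(** On elements killed by [e] the ring acts by scalars, so a basis over [K] may be sent to any
    elements killed by [e]; multiplying arbitrary lifts by [1 - e] provides such elements. *)
Lemma killed_projective N : fin_gen N -> (forall n : N, e *: n = 0) -> projective N.
Proof.
move=> fN eN M1 M2 p g ps.
have H0 : submod (fun n : kmod N => n = 0) by split=> // c y z -> ->; rewrite scaler0 addr0.
have [n [b [bs bi]]] := kbasis (W := fun n : N => n = 0) fN H0.
have fb m : (1 - e) *: m = m :> N by rewrite scalerBl scale1r eN subr0.
have [m mP] := choice (fun j => ps (g (b j))).
pose m' j := (1 - e) *: m j.
have em' j : e *: m' j = 0 by rewrite scalerA mulrBr mulr1 ee subrr scale0r.
have pm' j : p (m' j) = g (b j) by rewrite linearZ /= mP -linearZ /= fb.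
have [h hP] : exists h : {linear N -> M1}, forall n', exists c : 'I_n -> K,
    n' = \sum_j cst (c j) *: b j /\ h n' = \sum_j cst (c j) *: m' j.
  apply: (linear_of_rel (P := fun n' v => exists c : 'I_n -> K,
    n' = \sum_j cst (c j) *: b j /\ v = \sum_j cst (c j) *: m' j)).
  - move=> n'; have [c /eqP] := bs n'; rewrite subr_eq0 => /eqP cE.
    by exists (\sum_j cst (c j) *: m' j), c.
  - move=> s _ _ _ _ [c [-> ->]] [d [-> ->]].
    have [q sq] := act_killed N s; have [q' sq'] := act_killed M1 s.
    have [[[[p0 p1] q0] r] /= sE] := span s.
    have act M (y : M) : e *: y = 0 -> s *: y = cst q0 *: y.
      move=> ey; have xm : x *: y = 0 by rewrite -xe -scalerA ey scaler0.
      have am : a *: y = 0 by rewrite -ae -scalerA ey scaler0.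
      rewrite sE !scalerDl -!scalerA ey xm am !scaler0 add0r addr0 add0r.
      by rewrite scalerBl scale1r ey subr0.
    exists (fun j => q0 * c j + d j); rewrite !scaler_sumr -!big_split; split.
      apply: eq_bigr => j _ /=; rewrite cst_comm act // /cst rmorphD rmorphM scalerDl.
      by rewrite -!scalerA -/(cst _) -/(cst _) cst_comm.
    apply: eq_bigr => j _ /=; rewrite cst_comm act // /cst rmorphD rmorphM scalerDl.
    by rewrite -!scalerA -/(cst _) -/(cst _) cst_comm.
  - move=> v [c [c0 ->]]; rewrite big1 // => j _.
    by rewrite (bi c _ j) // /cst rmorph0 scale0r.
exists h => n'; have [c [-> ->]] := hP n'.
rewrite !linear_sum; apply: eq_bigr => j _.
by rewrite linearZ [RHS]linearZ; congr (_ *: _); exact: pm'.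
Qed.

(* On e M, the kernel of x is the image of x: e M is free over K[x]/(x^2). *)
Definition xfree M := forall y : M, e *: y = y -> x *: y = 0 -> exists w, y = x *: w.

Lemma xfree_regular : xfree S^o.
Proof.
move=> y ey xy; have [[[[p0 p1] q] r] /= yE] := span (y : S).
have eyE : e * (y : S) = cst p0 * e + cst p1 * x.
  rewrite yE !mulrDr !(mulrA e) -!kalg_mapC -!mulrA mulr1 !mulrN ee ex ea.
  by rewrite subrr mulr0 !addr0.
have xyE : x * (y : S) = cst p0 * x.
  by rewrite -[y in LHS]ey [e *: y]eyE mulrDr !(mulrA x) -!kalg_mapC -!mulrA xe xx mulr0 addr0.
have p00 : p0 = 0.
  apply: contrapT => /eqP p0n; apply: x0.
  have : cst p0^-1 * (cst p0 * x) = 0 by rewrite -xyE [x * _]xy mulr0.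
  by rewrite mulrA -rmorphM mulVf // rmorph1 mul1r.
exists (cst p1 : S); rewrite -[LHS]ey [e *: y]eyE p00 /cst rmorph0 mul0r add0r.
exact: kalg_mapC.
Qed.

(** Lift [y] to [v] in [e B]. Then [x *: v] comes from an element of [A] killed by [x], so it equals
    [x] times some [i t']; after subtracting [e *: i t'] the lift is killed by [x], hence a multiple
    of [x]. *)
Lemma xfree_quotient (A B C : lmodType S) (i : {linear A -> B}) (p : {linear B -> C}) :
  ses i p -> xfree A -> xfree B -> xfree C.
Proof.
move=> ip fA fB y ey xy; have [b bE] := ses_surj ip y.
pose v := e *: b.
have pv : p v = y by rewrite linearZ /= bE.
have ev : e *: v = v by rewrite scalerA ee.
have [t tE] : exists t, i t = x *: v by apply: (ses_ex ip); rewrite linearZ /= pv.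
have [||t' t'E] := fA t.
- by apply: (ses_inj ip); rewrite linearZ /= tE scalerA ex.
- by apply: (ses_inj ip); rewrite linearZ /= tE scalerA xx scale0r linear0.
have [||w wE] := fB (v - e *: i t').
- by rewrite scalerBr ev scalerA ee.
- by rewrite scalerBr -tE t'E linearZ /= scalerA xe subrr.
by exists (p w); rewrite -linearZ /= -wE linearB [p (e *: i _)]linearZ /= (ses0 _ ip) scaler0 subr0.
Qed.

Lemma xfree_proj P : fgproj P -> xfree P.
Proof.
move=> /fgproj_in_add.
apply: (@in_add_ind S xfree S^o) => [A B fA fB|A B [i [p ip]] fB|].
- move=> [u v] [eu ev] [xu xv].
  by have [w ->] := fA u eu xu; have [w' ->] := fB v ev xv; exists (w, w').
- move=> u eu xu; have [||w wE] := fB (i u); first by rewrite -linearZ /= eu.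
    by rewrite -linearZ /= xu linear0.
  by exists (p w); rewrite -linearZ /= -wE ip.
- exact: xfree_regular.
Qed.

Lemma fpd_xfree M : fpd M -> xfree M.
Proof.
move=> [fM [n Hn]]; elim: n M fM Hn => [|n IH] M fM Hn.
  exact/xfree_proj/projective_of_ext1.
have [K' [P [j [p [jp fP]]]]] := fgproj_cover fM.
have fK := noethS (proj1 fP) (ses_inj jp).
apply: (xfree_quotient jp); last exact: xfree_proj.
by apply: IH => // N; exact: Hn jp fP.
Qed.

Lemma act_fixed M (s : S) : exists p0 p1 r : K, forall (z : M) c d, e *: z = z ->
  s *: (cst c *: z + cst d *: (x *: z)) =
  cst (p0 * c) *: z + cst (p1 * c + p0 * d) *: (x *: z) + cst (r * c) *: (a *: z).
Proof.
have [[[[p0 p1] q] r] /= ->] := span s; exists p0, p1, r => z c d ez.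
have exz : e *: (x *: z) = x *: z by rewrite scalerA ex.
have xxz : x *: (x *: z) = 0 by rewrite scalerA xx scale0r.
have axz : a *: (x *: z) = 0 by rewrite scalerA ax scale0r.
rewrite scalerDr !cst_comm !scalerDl -!scalerA !scalerBl !scale1r ez exz xxz axz.
rewrite !subrr !scaler0 !addr0 !scalerDr !scalerA -!(rmorphM (kalg_map S)).
rewrite -!/(cst _) [c * p0]mulrC [c * p1]mulrC [c * r]mulrC [d * p0]mulrC.
rewrite /cst (rmorphD (kalg_map S)) mulrDl scalerDl -!addrA; congr (_ + _); congr (_ + _).
by rewrite addrC.
Qed.

(** [e Y] is free over K[x]/(x^2) on the [y j]. Lifts [b j] in [e B] and everything in [B] killed by
    [e] span a submodule [D] mapping isomorphically onto [Y]: an element of [D] in the kernel of [p]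
    is killed by [e] and comes from [V]. *)
Lemma xfree_section V B Y (i : {linear V -> B}) (p : {linear B -> Y}) :
  fin_gen Y -> xfree Y -> ses i p -> (forall v : V, e *: v = 0 -> v = 0) ->
  exists s : {linear Y -> B}, cancel s p.
Proof.
move=> fY xY ip eV.
(* A basis over [K] modulo this subspace becomes, after multiplication by [e], a basis of [e Y] over
   K[x]/(x^2). *)
pose W (y : Y) := exists u n : Y, e *: n = 0 /\ y = x *: u + n.
have HW : submod (W : kmod Y -> Prop).
  split=> [|c _ _ [u [n [en ->]]] [u' [n' [en' ->]]]].
    by exists 0, 0; rewrite !scaler0 addr0.
  exists (cst c *: u + u'), (cst c *: n + n'); split.
    by rewrite scalerDr cst_comm en en' scaler0 addr0.
  by rewrite !kmod_scale !scalerDr cst_comm addrACA.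
have [m [g [gs gi]]] := kbasis fY HW.
pose y j := e *: g j.
have ey j : e *: y j = y j by rewrite scalerA ee.
have egy j : e *: (g j - y j) = 0 by rewrite scalerBr ey subrr.
have [b0 b0P] := choice (fun j => ses_surj ip (y j)).
have [b [eb pb]] : exists b : 'I_m -> B, (forall j, e *: b j = b j) /\ forall j, p (b j) = y j.
  exists (fun j => e *: b0 j); split=> j; first by rewrite scalerA ee.
  by rewrite linearZ /= b0P ey.
pose D (z : B) := exists (c d : 'I_m -> K) (n : B), e *: n = 0 /\
  z = \sum_j (cst (c j) *: b j + cst (d j) *: (x *: b j)) + n.
have HD : submod D.
  split=> [|s _ _ [c [d [n [en ->]]]] [c' [d' [n' [en' ->]]]]].
    exists (fun _ => 0), (fun _ => 0), 0; rewrite scaler0 addr0; split=> //.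
    by rewrite big1 // => j _; rewrite /cst rmorph0 !scale0r addr0.
  have [p0 [p1 [r sP]]] := act_fixed B s; have [q sq] := act_killed B s.
  exists (fun j => p0 * c j + c' j), (fun j => p1 * c j + p0 * d j + d' j).
  exists (cst q *: n + \sum_j cst (r * c j) *: (a *: b j) + n'); split.
    rewrite !scalerDr cst_comm en en' scaler0 add0r addr0 scaler_sumr big1 // => j _.
    by rewrite cst_comm [e *: (a *: _)]scalerA ea scale0r scaler0.
  rewrite scalerDr (sq n en) scaler_sumr.
  transitivity (\sum_j (cst (p0 * c j) *: b j + cst (p1 * c j + p0 * d j) *: (x *: b j))
    + \sum_j cst (r * c j) *: (a *: b j) + cst q *: n
    + (\sum_j (cst (c' j) *: b j + cst (d' j) *: (x *: b j)) + n')).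
    by congr (_ + _ + _); rewrite -big_split; apply: eq_bigr => j _; rewrite sP.
  rewrite -[X in X + _]addrA addrACA -big_split /= [cst q *: n + _]addrC; congr (_ + _).
  apply: eq_bigr => j _; rewrite addrACA -!scalerDl.
  by rewrite /cst -!(rmorphD (kalg_map S)).
have key (c d : 'I_m -> K) : \sum_j (cst (c j) *: y j + cst (d j) *: (x *: y j)) = 0 ->
    forall j, c j = 0 /\ d j = 0.
  have gy (c' : 'I_m -> K) : \sum_j cst (c' j) *: g j =
      \sum_j cst (c' j) *: y j + \sum_j cst (c' j) *: (g j - y j).
    by rewrite -big_split; apply: eq_bigr => j _ /=; rewrite -scalerDr addrC subrK.
  have eg (c' : 'I_m -> K) : e *: (\sum_j cst (c' j) *: (g j - y j)) = 0.
    by rewrite scaler_sumr big1 // => j _; rewrite cst_comm egy scaler0.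
  have xs (d' : 'I_m -> K) : \sum_j cst (d' j) *: (x *: y j) = x *: (\sum_j cst (d' j) *: y j).
    by rewrite scaler_sumr; apply: eq_bigr => j _; rewrite cst_comm.
  rewrite big_split /= xs => /eqP; rewrite addr_eq0 => /eqP h0.
  have c0 : forall j, c j = 0.
    apply: gi; exists (- (\sum_j cst (d j) *: y j)), (\sum_j cst (c j) *: (g j - y j)).
    by rewrite eg gy h0 scalerN.
  have [||w wE] := xY (\sum_j cst (d j) *: y j).
  - by rewrite scaler_sumr; apply: eq_bigr => j _; rewrite cst_comm ey.
  - apply/eqP; rewrite -oppr_eq0 -h0 big1 // => j _.
    by rewrite c0 /cst rmorph0 scale0r.
  have d0 : forall j, d j = 0.
    by apply: gi; exists w, (\sum_j cst (d j) *: (g j - y j)); rewrite eg gy wE.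
  by [].
have [s sP] : exists s : {linear Y -> B}, forall u, p (s u) = u /\ D (s u).
  apply: (linear_of_rel (P := fun u z => p z = u /\ D z)).
  - move=> u; have [c [v [n [en cE]]]] := gs u.
    have [d [v' [n' [en' dE]]]] := gs v.
    have [n0 n0E] := ses_surj ip (n + \sum_j cst (c j) *: (g j - y j)).
    exists (\sum_j (cst (c j) *: b j + cst (d j) *: (x *: b j)) + (n0 - e *: n0)); split; last first.
      by exists c, d, (n0 - e *: n0); rewrite scalerBr scalerA ee subrr.
    have xn' : x *: n' = 0 by rewrite -xe -scalerA en' scaler0.
    have xv : x *: v = \sum_j cst (d j) *: (x *: y j).
      rewrite -[v in LHS](subrK (\sum_j cst (d j) *: g j)) dE !scalerDr scalerA xx scale0r add0r xn' add0r.
      rewrite scaler_sumr; apply: eq_bigr => j _.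
      by rewrite cst_comm /y scalerA [x *: (e *: _)]scalerA xe -scalerA.
    have en0 : e *: (n + \sum_j cst (c j) *: (g j - y j)) = 0.
      rewrite scalerDr en add0r scaler_sumr big1 // => j _.
      by rewrite cst_comm egy scaler0.
    rewrite linearD linearB linearZ /= n0E en0 subr0 linear_sum.
    rewrite -[RHS](subrK (\sum_j cst (c j) *: g j)) cE xv.
    have -> : \sum_j p (cst (c j) *: b j + cst (d j) *: (x *: b j)) =
        \sum_j cst (c j) *: y j + \sum_j cst (d j) *: (x *: y j).
      by rewrite -big_split; apply: eq_bigr => j _; rewrite linearD !linearZ /= pb.
    have -> : \sum_j cst (c j) *: g j =
      \sum_j cst (c j) *: y j + \sum_j cst (c j) *: (g j - y j).
      by rewrite -big_split; apply: eq_bigr => j _ /=; rewrite -scalerDr addrC subrK.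
    by rewrite [X in X + _ = _]addrC -!addrA; congr (_ + _); rewrite addrCA.
  - move=> t u u' z z' [<- Dz] [<- Dz']; split; first by rewrite linearP.
    by case: HD => _; apply.
  - move=> z [pz [c [d [n [en zE]]]]].
    have pzE : \sum_j (cst (c j) *: y j + cst (d j) *: (x *: y j)) + p n = 0.
      transitivity (p z) => //; rewrite zE linearD linear_sum; congr (_ + _); apply: eq_bigr => j _.
      by rewrite linearD !linearZ /= pb.
    have epn : e *: p n = 0 by rewrite -linearZ /= en linear0.
    have /key cd0 : \sum_j (cst (c j) *: y j + cst (d j) *: (x *: y j)) = 0.
      have := congr1 (fun u => e *: u) pzE; rewrite scaler0 scalerDr epn addr0 => h.
      rewrite -[RHS]h scaler_sumr; apply: eq_bigr => j _.
      by rewrite scalerDr !cst_comm ey [e *: (x *: _)]scalerA ex.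
    have zn : z = n.
      rewrite zE big1 ?add0r // => j _; have [-> ->] := cd0 j.
      by rewrite /cst rmorph0 !scale0r addr0.
    have [v vE] := ses_ex ip pz.
    have v0 : v = 0 by apply: eV; apply: (ses_inj ip); rewrite linearZ /= vE zn en linear0.
    by rewrite -vE v0 linear0.
by exists s => u; case: (sP u).
Qed.

(** Divide a free cover of [M] by the part [N] of its kernel killed by [e]. As [N] is projective,
    the quotient [X] has projective dimension at most one; the kernel of [X -> M] has no nonzero
    element killed by [e], so [xfree_section] splits the pullback of every test map. *)
Lemma example_contravariantly_finite : contravariantly_finite S.
Proof.
move=> M /fin_gen_free_cover[n [p ps]].
pose F := {ffun 'I_n -> S^o} : lmodType S.
have HN : submod (fun v : F => p v = 0 /\ e *: v = 0).
  have [k0 kP] := submod_ker p; have [l0 lP] := killed_submod F.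
  by split=> // s u v [pu eu] [pv ev]; split; [exact: kP | exact: lP].
have [N [j [ji jP]]] := sub_exists HN.
have [X [th jth]] := ses_coker ji.
have fN : fin_gen N := noethS (fin_gen_free S n) ji.
have eN (v : N) : e *: v = 0.
  apply: ji; rewrite linearZ /= linear0.
  by have /jP[] : exists w, j w = j v by exists v.
have fX : fpd X.
  apply: (fpd_right noethS jth (fpd_proj _) (fpd_proj (fgproj_free S n))).
  by split=> //; exact: killed_projective.
have [v|phi phiE] := @factor_surj _ _ _ _ th p (ses_surj jth).
  by move=> /(ses_ex jth)[w <-]; have /jP[] : exists w', j w' = j w by exists w.
have phis : surjective phi.
  by move=> m; have [v <-] := ps m; exists (th v); rewrite phiE.
have [V [i ip]] := ses_ker phis.
exists X, phi; split; first exact/(fin_proj_dimE noethS).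
move=> Y f /(fin_proj_dimE noethS) fY.
have [Q [t [q [r [tq e1 e2 e3 e4]]]]] := ses_pullback f ip.
have [v ev|s sq] := xfree_section (proj1 fY) (fpd_xfree fY) tq.
  apply: (ses_inj ip); rewrite linear0.
  have [u uE] := ses_surj jth (i v).
  have pu : p u = 0 by rewrite -phiE uE (ses0 _ ip).
  have [w wE] : exists w, j w = e *: u.
    by apply: (ses_ex jth); rewrite linearZ /= uE -linearZ /= ev linear0.
  have eu : e *: u = 0.
    have /jP[_] : exists w', j w' = e *: u by exists w.
    by rewrite scalerA ee.
  have [w' w'E] : exists w', j w' = u by apply/jP.
  by rewrite -uE -w'E (ses0 _ jth).
exists (r \o s : {linear Y -> X}) => y.
by rewrite /= e1 sq.
Qed.

End ExampleSide.

Section RegularStrong.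
Variables (k : comPzRingType) (A : kalg k).
Hypothesis artA : artin_algebra A.

(** This is [embeddings_split] for the regular module, whose endomorphisms are right
    multiplications; the order of products is therefore reversed. *)
Definition right_embeddings_split (R : pzRingType) := forall n (b : 'I_n -> R),
  (forall t, (forall j, t * b j = 0) -> t = 0) -> exists z : 'I_n -> R, \sum_j b j * z j = 1.

Lemma rmul_linear (R : pzRingType) (b : R) : linear (fun t : R^o => (t : R) * b : R^o).
Proof. by move=> a s t; rewrite mulrDl -mulrA. Qed.
Definition rmul (R : pzRingType) (b : R) : endo (R^o : lmodType R) := mklin (rmul_linear b).

Lemma endo_regular (R : pzRingType) (f : endo (R^o : lmodType R)) (t : R) :
  (f : {linear R^o -> R^o}) t = t * (f : {linear R^o -> R^o}) (1 : R).
Proof.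
rewrite -[X in _ = X]/(t *: (f : {linear R^o -> R^o}) (1 : R)) -linearZ; congr (_ _).
exact: (esym (mulr1 t)).
Qed.

Lemma regular_strong : right_embeddings_split A -> strong (A^o : lmodType A).
Proof.
move=> HA; have noethA := artin_noeth artA.
have fA := fgproj_regular A.
have noethE := artin_noeth (artin_endo artA (proj1 fA)).
pose phi : {rmorphism endo_alg A^o -> endo (A^o : lmodType A)} := idfun.
have bphi : bijective phi by exists id.
apply: (strong_of_embeddings_split noethA noethE bphi (fpd_proj fA)).
- exact: perp_proj (proj2 fA).
- exact/cor_add/in_add_refl.
move=> n y y0; have [|z z1] := HA n (fun j => (y j : {linear A^o -> A^o}) (1 : A)).
  by move=> t ty; apply: y0 => j; rewrite -[LHS]/((y j : {linear A^o -> A^o}) t) endo_regular.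
exists (fun j => rmul (z j)); apply: linear_ext => t.
have sumE (E : 'I_n -> endo (A^o : lmodType A)) :
    (\sum_j E j : {linear A^o -> A^o}) t = \sum_j (E j : {linear A^o -> A^o}) t.
  by elim/big_rec2: _ => // j x f _ <-.
rewrite sumE -[RHS](mulr1 (t : A)) -z1 mulr_sumr; apply: eq_bigr => j _.
by rewrite /= [in LHS]endo_regular mulrA.
Qed.

End RegularStrong.

Section ExampleAlgebra.
Variable K : fieldType.

(* (p, s, q, r) is the element p e + s x + q (1 - e) + r a of the opposite of the
   path algebra of the quiver with a loop x at the vertex of e and an arrow a leaving
   this vertex, modulo x^2 = 0 and a x = 0. *)
Definition exalg : Type := (K * K * K * K)%type.
HB.instance Definition _ := GRing.Zmodule.on exalg.

Definition exmul (u v : exalg) : exalg :=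
  (u.1.1.1 * v.1.1.1, u.1.1.1 * v.1.1.2 + u.1.1.2 * v.1.1.1, u.1.2 * v.1.2,
   u.1.1.1 * v.2 + u.2 * v.1.2).
Definition exone : exalg := (1, 0, 1, 0).

Fact exmulA : associative exmul.
Proof.
move=> [[[p s] q] r] [[[p' s'] q'] r'] [[[p2 s2] q2] r2]; rewrite /exmul /=.
by congr (_, _, _, _); ring.
Qed.
Fact exmul1l : left_id exone exmul.
Proof.
by move=> [[[p s] q] r]; rewrite /exmul /=; congr (_, _, _, _); ring.
Qed.
Fact exmul1r : right_id exone exmul.
Proof.
by move=> [[[p s] q] r]; rewrite /exmul /=; congr (_, _, _, _); ring.
Qed.
Fact exmulDl : left_distributive exmul +%R.
Proof.
move=> [[[p s] q] r] [[[p' s'] q'] r'] [[[p2 s2] q2] r2]; rewrite /exmul /=.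
by congr (_, _, _, _); rewrite /=; ring.
Qed.
Fact exmulDr : right_distributive exmul +%R.
Proof.
move=> [[[p s] q] r] [[[p' s'] q'] r'] [[[p2 s2] q2] r2]; rewrite /exmul /=.
by congr (_, _, _, _); rewrite /=; ring.
Qed.
HB.instance Definition _ := GRing.Zmodule_isPzRing.Build exalg
  exmulA exmul1l exmul1r exmulDl exmulDr.

Definition exconst (c : K) : exalg := (c, 0, c, 0).
Fact exconst_zmod : zmod_morphism exconst.
Proof. by move=> c d; congr (_, _, _, _); rewrite /= ?subr0. Qed.
Fact exconst_monoid : monoid_morphism exconst.
Proof. by split=> // c d; congr (_, _, _, _); rewrite /=; ring. Qed.
Definition exmap : {rmorphism K -> exalg} :=
  HB.pack_for {rmorphism K -> exalg} exconst
    (GRing.isZmodMorphism.Build _ _ _ exconst_zmod)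
    (GRing.isMonoidMorphism.Build _ _ _ exconst_monoid).
Fact exmapC c (u : exalg) : exmap c * u = u * exmap c.
Proof. by case: u => [[[p s] q] r]; congr (_, _, _, _); rewrite /=; ring. Qed.
Definition ex_kalg : kalg K := KAlg exmapC.

Definition ee : exalg := (1, 0, 0, 0).
Definition xx : exalg := (0, 1, 0, 0).
Definition ff : exalg := (0, 0, 1, 0).
Definition aa : exalg := (0, 0, 0, 1).

Lemma exmulE (u v : exalg) : u * v = exmul u v. Proof. by []. Qed.

Lemma field_artinian : artinian K.
Proof.
move=> I HI decr.
have [[n nP]|H] := pselect (exists n, forall x, I n x -> x = 0).
  exists n => m nm x Ix; rewrite (nP x Ix); by case: (HI m).
exists 0%N => n _ x _.
have [y [Iy /eqP y0]] : exists y, I n y /\ y <> 0.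
  apply: contrapT => h; apply: H; exists n => y Iy.
  by apply: contrapT => y0; apply: h; exists y.
have [_ _ IZ] := HI n; have -> : x = (x / y) * y by rewrite mulfVK.
exact: IZ.
Qed.

Lemma ex_artin : artin_algebra ex_kalg.
Proof.
split; first exact: field_artinian.
exists 4%N, (fun i => nth (0 : exalg) [:: ee; xx; ff; aa] i) => u.
exists (fun i => nth 0 [:: u.1.1.1; u.1.1.2; u.1.2; u.2] i).
rewrite !big_ord_recl big_ord0 /=.
by case: u => [[[p s] q] r]; congr (_, _, _, _); rewrite /=; ring.
Qed.

Lemma ex_basic : basic_ring ex_kalg.
Proof.
pose kk (i : 'I_2) (u : exalg) : Prop := if i == ord0 then u.1.1.1 = 0 else u.1.2 = 0.
apply: (@basic_ring_of_ideals exalg 2 kk).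
- move=> i; rewrite /kk; case: (i == ord0); split=> //= [u v|a u|a u].
  + by move=> /= h h'; rewrite /= h h' addr0.
  + by move=> h; rewrite /= h mulr0.
  + by move=> h; rewrite /= h mul0r.
  + by move=> /= h h'; rewrite /= h h' addr0.
  + by move=> h; rewrite /= h mulr0.
  + by move=> h; rewrite /= h mul0r.
- by move=> i; rewrite /kk; case: (i == ord0) => /= /eqP; rewrite oner_eq0.
- move=> i u; rewrite /kk; case: (i == ord0) => /eqP u0.
    by exists (u.1.1.1^-1, 0, 0, 0); rewrite /= mulVf // mulfV // subrr.
  by exists (0, 0, u.1.2^-1, 0); rewrite /= mulVf // mulfV // subrr.
- move=> d; exists ((d ord0).1.1.1, 0, (d ord_max).1.2, 0) => i; rewrite /kk.
  case: eqP => [->|i0] /=; first by rewrite subrr.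
  have -> : i = ord_max by apply: val_inj; case: i i0 => [[|[|m]] hm] //= i0; case: i0; apply: val_inj.
  by rewrite subrr.
- move=> u ku; have /= p0 := ku ord0; have /= q0 := ku ord_max.
  rewrite /kk /= in p0 q0.
  exists (1 + u); case: u p0 q0 {ku} => [[[p s] q] r] /= -> ->.
  by congr (_, _, _, _); rewrite /=; ring.
Qed.

Lemma ex_right_embeddings : right_embeddings_split exalg.
Proof.
move=> n b H.
(* If all coordinates at [ee] vanished, [xx] would annihilate every [b j] from the left; [ff] plays
   this part for the other vertex. *)
have [i pi] : exists i, (b i).1.1.1 != 0.
  apply/existsP; apply: contrapT => /negP; rewrite negb_exists => /forallP h.
  have : xx = 0 :> exalg.
    apply: H => j; have := h j; rewrite negbK => /eqP p0.
    by congr (_, _, _, _); rewrite /= ?p0; ring.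
  by case=> /eqP; rewrite oner_eq0.
have [j qj] : exists j, (b j).1.2 != 0.
  apply/existsP; apply: contrapT => /negP; rewrite negb_exists => /forallP h.
  have : ff = 0 :> exalg.
    apply: H => l; have := h l; rewrite negbK => /eqP q0.
    by congr (_, _, _, _); rewrite /= ?q0; ring.
  by case=> /eqP; rewrite oner_eq0.
(* [w] inverts the part of [b i] at [ee]; its last coordinate cancels the multiple of [aa] brought
   in by [b j * w']. *)
pose w : exalg := ((b i).1.1.1^-1, - (b i).1.1.2 / (b i).1.1.1 ^+ 2, 0,
  - (b j).2 / ((b i).1.1.1 * (b j).1.2)).
pose w' : exalg := (0, 0, (b j).1.2^-1, 0).
exists (fun l => (if l == i then w else 0) + (if l == j then w' else 0)).
have sum1 l0 (v : exalg) : \sum_l b l * (if l == l0 then v else 0) = b l0 * v.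
  rewrite (bigD1 l0) //= eqxx big1 ?addr0 // => l /negbTE ->; exact: mulr0.
under eq_bigr do rewrite mulrDr.
rewrite big_split /= !sum1 /w /w'.
case: (b i) pi => [[[p s] q] r] /= p0; case: (b j) qj => [[[p' s'] q'] r'] /= q0.
congr (_, _, _, _); rewrite /=; field; rewrite ?p0 ?q0 //.
Qed.

Lemma ex_left_annihilator (t : exalg) : ee * t = 0 -> aa * t = 0 -> t = 0.
Proof.
case: t => [[[p s] q] r]; rewrite !exmulE /exmul /= !mul1r !mul0r !addr0 add0r.
by case=> -> -> ->; case=> ->.
Qed.

Lemma ex_left_proper (z w : exalg) : z * ee + w * aa <> 1.
Proof.
case: z => [[[p s] q] r]; case: w => [[[p' s'] q'] r'].
move/(congr1 (fun u : exalg => u.1.2)) => /= /eqP.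
by rewrite !mulr0 addr0 eq_sym oner_eq0.
Qed.

End ExampleAlgebra.

Section Example.
Variable K : fieldType.
Notation Lam := (ex_kalg K).
Notation T := ((exalg K)^o : lmodType Lam).
Let artL : artin_algebra Lam := ex_artin K.
Let noethL := artin_noeth artL.

Lemma regular_strong_ex : strong T.
Proof. exact: (regular_strong artL (@ex_right_embeddings K)). Qed.

Lemma ext1_in_add (R : pzRingType) (M N X : lmodType R) : ext1 M X -> in_add X N -> ext1 M N.
Proof.
move=> HM /in_addP[J [u [v uv]]] A B i p f ip.
have [g gP] := choice (fun j => HM _ _ _ _ (u j \o f : {linear A -> X}) ip).
have lg : linear (fun b => \sum_j v j (g j b)).
  move=> a b c; rewrite scaler_sumr -big_split; apply: eq_bigr => j _ /=.
  by rewrite !linearP.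
exists (mklin lg) => a /=; rewrite [RHS]uv; apply: eq_bigr => j _.
by rewrite gP.
Qed.

(** The regular module is strong, so Ext^1 from a module of finite projective dimension to a
    finitely generated projective vanishes, and a projective syzygy splits off. *)
Lemma ex_fpd_projective (M : lmodType Lam) : fpd M -> fgproj M.
Proof.
move=> [fM [n Hn]]; elim: n M fM Hn => [|n IH] M fM Hn.
  exact: projective_of_ext1.
have [P' [P [j [p [jp fP]]]]] := fgproj_cover fM.
have fK := noethL (proj1 fP) (ses_inj jp).
have /fgproj_in_add aK : fgproj P' by apply: IH => // N; exact: Hn jp fP.
have [_ _ sT] := regular_strong_ex.
have fpdM : fpd M by split=> //; exists n.+1.
have [r rP] := ext1_in_add (sT M fpdM 0%N) aK (idfun : {linear P' -> P'}) jp.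
have [s [sp _]] := ses_retraction jp rP.
by apply: fgproj_summand fP; exists s, p.
Qed.

Lemma ex_contravariantly_finite : contravariantly_finite Lam.
Proof.
move=> M /fin_gen_free_cover[n [p ps]].
exists {ffun 'I_n -> T}, p; split.
  by apply/(fin_proj_dimE noethL)/fpd_proj; exact: fgproj_free.
move=> Y f /(fin_proj_dimE noethL)/ex_fpd_projective[_ pY].
by have [g gP] := pY _ _ p f ps; exists g.
Qed.

Lemma ex_basic_strong : basic_strong_tilting T.
Proof.
split; first exact/(strongP noethL)/regular_strong_ex.
pose rho (u : (exalg K)^c) : endo T := rmul (u : exalg K).
have rZ : zmod_morphism rho by move=> u v; apply: linear_ext => t; exact: mulrBr.
have rM : monoid_morphism rho.
  split=> [|u v]; apply: linear_ext => t; first exact: mulr1.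
  exact: mulrA.
pose f : {rmorphism (exalg K)^c -> endo T} := HB.pack_for {rmorphism (exalg K)^c -> endo T} rho
  (GRing.isZmodMorphism.Build _ _ _ rZ) (GRing.isMonoidMorphism.Build _ _ _ rM).
apply: (@basic_module_of_ring _ _ _ f); last by right; exists (exalg K) => //; exact: ex_basic.
exists (fun g : endo T => (g : {linear T -> T}) (1 : exalg K)) => [u|g] /=.
  exact: mul1r.
by apply: linear_ext => t; rewrite [RHS]endo_regular.
Qed.

(** Right multiplications reverse products and the two opposites cancel, so this is the converse of
    [exalg], and the relations required by [example_contravariantly_finite] are those of [exalg]
    read backwards. *)
Lemma ex_side_contravariantly_finite :
  contravariantly_finite (side true (op_alg (endo_alg T))).
Proof.
pose S := side true (op_alg (endo_alg T)).
have artS : artin_algebra S.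
  by apply: artin_op; apply: artin_op; apply: artin_endo => //; case: (fgproj_regular Lam).
pose r (u : exalg K) : S := rmul u.
have rE (u v : exalg K) : r u * r v = r (v * u) by apply: linear_ext => t; exact: (esym (mulrA _ _ _)).
have e0 (p s q r0 : K) : p = 0 -> s = 0 -> q = 0 -> r0 = 0 -> (p, s, q, r0) = 0 :> exalg K.
  by move=> -> -> -> ->.
apply: (@example_contravariantly_finite K S (r (ee K)) (r (xx K)) (r (aa K)) artS).
- by rewrite rE; congr (r _); congr (_, _, _, _); rewrite /= ?(mulr0, mul0r, mulr1, addr0, add0r).
- by rewrite rE; congr (r _); congr (_, _, _, _); rewrite /= ?(mulr0, mul0r, mulr1, addr0, add0r).
- by rewrite rE; congr (r _); congr (_, _, _, _); rewrite /= ?(mulr0, mul0r, mulr1, addr0, add0r).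
- rewrite rE (_ : _ * _ = 0); first by apply: linear_ext => t; exact: mulr0.
  by apply: e0; rewrite /= ?(mulr0, mul0r, mulr1, addr0, add0r).
- by rewrite rE; congr (r _); congr (_, _, _, _); rewrite /= ?(mulr0, mul0r, mulr1, addr0, add0r).
- rewrite rE (_ : _ * _ = 0); first by apply: linear_ext => t; exact: mulr0.
  by apply: e0; rewrite /= ?(mulr0, mul0r, mulr1, addr0, add0r).
- rewrite rE (_ : _ * _ = 0); first by apply: linear_ext => t; exact: mulr0.
  by apply: e0; rewrite /= ?(mulr0, mul0r, mulr1, addr0, add0r).
- move/(congr1 (fun g : endo T => ((g : {linear T -> T}) (1 : exalg K)).1.1.2)) => /= /eqP.
  by rewrite mulr1 mul0r addr0 oner_eq0.
- move=> s; exists ((fun g : endo T => (g : {linear T -> T}) (1 : exalg K)) s).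
  apply: linear_ext => t; rewrite [LHS]endo_regular.
  move: ((s : endo T) (1 : exalg K)) => u.
  rewrite -[RHS]/(exconst u.1.1.1 * ((t : exalg K) * ee K) + exconst u.1.1.2 * ((t : exalg K) * xx K)
    + exconst u.1.2 * ((t : exalg K) - (t : exalg K) * ee K) + exconst u.2 * ((t : exalg K) * aa K)).
  case: t => [[[p s'] q] r']; case: u => [[[p' s2] q'] r2].
  by congr (_, _, _, _); rewrite /=; ring.
Qed.

Lemma ex_not_iso (L : strong_tilting_sequence K) : L 0%N = Lam -> ~ ring_iso (L 0%N) (L 2%N).
Proof.
move=> -> [sg bsg].
have [tau sK tK] := bsg.
have art1 : artin_algebra (side true (L 1%N)) := artin_op (seq_artin L 1%N).
have art2 := seq_artin L 2%N.
pose t1 := seq_step L 1%N.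
have sT1 : strong (step_mod t1) := step_strong t1 (seq_artin L 1%N).
(* By [regular_strong] this follows from a condition on the ring alone, which travels along the
   assumed isomorphism. *)
have s2 : strong ((L 2%N)^o : lmodType (L 2%N)).
  apply: (regular_strong art2) => n b H.
  have [t|z zE] := @ex_right_embeddings K n (fun j => tau (b j)).
    move=> tb; apply: (can_inj sK); rewrite rmorph0; apply: H => j.
    by rewrite -[b j]tK -rmorphM tb rmorph0.
  exists (fun j => sg (z j)); rewrite -(rmorph1 sg) -zE rmorph_sum; apply: eq_bigr => j _.
  by rewrite rmorphM tK.
have sV : strong (bimod (step_action t1)).
  exact (@step_bimod_strong K false (L 0%N) (L 1%N) (L 2%N) (seq_step L 0%N) t1
    (seq_artin L 0%N) (seq_artin L 1%N) art2).
have [t [et at_ t0]] : exists t : step_mod t1, [/\ (step_action t1 (sg (ee K)) : {linear _ -> _}) t = 0,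
    (step_action t1 (sg (aa K)) : {linear _ -> _}) t = 0 & t <> 0].
  apply: contrapT => nt.
  have := strong_embeddings_split (artin_noeth art1) (step_action_bij t1) sT1.
  move=> /(_ 2%N (fun i => if i == ord0 then sg (ee K) else sg (aa K))) [t ht|z].
    apply: contrapT => t0; apply: nt; exists t; split=> //; first exact: (ht ord0).
    exact: (ht ord_max).
  rewrite !big_ord_recl big_ord0 addr0 /= => z1.
  apply: (@ex_left_proper K (tau (z ord0)) (tau (z (lift ord0 ord0)))).
  by apply: (can_inj sK); rewrite rmorphD !rmorphM !tK rmorph1.
have fV : fpd (bimod (step_action t1)) by case: sV.
have noeth2 := artin_noeth art2.
have noethE := artin_noeth (artin_endo art2 (proj1 (fgproj_regular (L 2%N)))).
pose phi : {rmorphism endo_alg (L 2%N)^o -> endo ((L 2%N)^o : lmodType (L 2%N))} := idfun.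
have bphi : bijective phi by exists id.
have [_ _ _ sep] := strong_good noeth2 noethE bphi s2 fV.
apply: t0; apply: (sep t) => h.
have kill (u : exalg K) : (step_action t1 (sg u) : {linear _ -> _}) t = 0 -> u * tau (h t) = 0.
  move=> ut; apply: (can_inj sK); rewrite rmorphM tK rmorph0.
  by rewrite -[LHS]/(sg u *: h t) -linearZ [X in h X]ut linear0.
have th0 : tau (h t) = 0 := ex_left_annihilator (kill _ et) (kill _ at_).
by rewrite -[LHS]tK th0 rmorph0.
Qed.

End Example.

Theorem theoremA :
  (forall (k : comPzRingType) (Lambda : kalg k) (T : lmodType Lambda),
     artin_algebra Lambda -> basic_ring Lambda ->
     contravariantly_finite Lambda ->
     basic_strong_tilting T ->
     contravariantly_finite (side true (op_alg (endo_alg T))) ->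
     unlimited_strong_tilting Lambda /\
     forall L : strong_tilting_sequence k, L 0%N = Lambda ->
       (forall i j, (0 < i)%N -> (0 < j)%N -> odd i = odd j ->
          alg_iso (L i) (L j)) /\
       (forall i, (0 < i)%N ->
          basic_strong_tilting (bimod (step_action (seq_step L i))) /\
          hom_duality (step_action (seq_step L i))
            (@fin_proj_dim (side (odd i) (L i)))
            (@fin_proj_dim (side (odd i.+1) (L i.+1)))))
  /\
  (exists (k : comPzRingType) (Lambda : kalg k) (T : lmodType Lambda),
     [/\ artin_algebra Lambda, basic_ring Lambda,
         contravariantly_finite Lambda,
         basic_strong_tilting T &
         contravariantly_finite (side true (op_alg (endo_alg T)))] /\
     exists L : strong_tilting_sequence k,
       L 0%N = Lambda /\ ~ ring_iso (L 0%N) (L 2%N)).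
Proof.
split=> [k Lambda T artL basL _ bsT HC|].
  split; first exact: (iteration_exists artL basL bsT HC).
  move=> L _; split; first exact: sequence_parity.
  exact: sequence_bimodules.
(* Any field would serve here. *)
exists rat, (ex_kalg rat), ((exalg rat)^o : lmodType (ex_kalg rat)).
have H := And5 (ex_artin rat) (ex_basic rat) (ex_contravariantly_finite (K := rat))
  (ex_basic_strong rat) (ex_side_contravariantly_finite (K := rat)).
split; first exact: H.
case: H => h1 h2 h3 h4 h5.
have [L L0] := iteration_exists h1 h2 h4 h5.
by exists L; split=> //; exact: ex_not_iso L0.
Qed.
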